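(* There is a constant $c>0$, independent of $h$ and of the local cut configurations, such that $$\inf_{\bar p_h\in Q_h\setminus\{0\}}\ \sup_{u_h\in\Sigma_h\setminus\{0\}}\frac{b_h(u_h,\bar p_h)}{\|u_h\|_\Sigma\,\|\bar p_h\|_{\Omega^{\mathcal T}}}\ge c>0 .$$ Hence the saddle-point problem: find $(u_h,\bar p_h)\in\Sigma_h\times Q_h$ such that $a_h(u_h,v_h)+b_h(v_h,\bar p_h)=(v_h\cdot n,p_D)_\Gamma$ for all $v_h\in\Sigma_h$ and $b_h(u_h,q_h)=-(f_h,q_h)_{\Omega^{\mathcal T}}$ for all $q_h\in Q_h$, is well-posed in the norms $\|\cdot\|_\Sigma$ on $\Sigma_h$ and $\|\cdot\|_{\Omega^{\mathcal T}}$ on $Q_h$.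
   Context: Geometry. $\Omega\subset\mathbb R^d$, $d\in\{2,3\}$, is a bounded open domain with Lipschitz boundary $\Gamma$; $\widetilde\Omega\supseteq\overline\Omega$ is a background domain with a shape regular, quasi-uniform simplicial triangulation $\widetilde{\mathcal T}_h$ of mesh size $h$. Active mesh: $\mathcal T_h=\{T\in\widetilde{\mathcal T}_h:\operatorname{meas}_d(T\cap\Omega)>0\}$; cut mesh: $\mathcal T_h^\Gamma=\{T\in\widetilde{\mathcal T}_h:\operatorname{meas}_{d-1}(T\cap\Gamma)>0\}$; uncut interior elements: $\mathcal T_h^i=\mathcal T_h\setminus\mathcal T_h^\Gamma$. $\Omega^{\mathcal T}$ is the domain covered by $\mathcal T_h$. For a facet $F$ shared by two elements of $\mathcal T_h$, $\omega_F$ denotes the union of these two elements. Patches. $\mathcal C_h=\{\mathcal T_\omega\}$ is a set of disjoint patches of neighbouring elements of $\mathcal T_h$. Each patch contains at least one root element $T_\omega\in\mathcal T_h^i$; every $T\in\mathcal T_h^\Gamma$ lies in some patch; the number of elements per patch is uniformly bounded, and the number of patch-interior facets to be crossed to get from any element of a patch to its root is uniformly bounded (uniformly in patch, cut position and $h$). All elements that are neither cut nor directly adjacent to cut elements form trivial patches $\{T\}$. $\mathcal F_h^{\mathcal C}$ is the set of all facets interior to some patch. Spaces and forms. $(\cdot,\cdot)_S,\|\cdot\|_S$ are the $L^2(S)$ inner product and norm. $k\in\mathbb N_0$; $Q_h=\mathbb P^k(\mathcal T_h)$ is the space of discontinuous piecewise polynomials of degree $\le k$; $\Sigma_h=\mathbb{RT}^k(\mathcal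 T_h)=\{v\in H(\operatorname{div};\Omega^{\mathcal T}): v|_T\in[\mathcal P^k(T)]^d+\mathcal P^k(T)\mathbf x\ \forall T\in\mathcal T_h\}$. $b_h(v,q)=(\operatorname{div}v,q)_{\Omega^{\mathcal T}}$; $a_h(u_h,v_h)=(u_h,v_h)_\Omega+\gamma_uj_h(u_h,v_h)$ with fixed $\gamma_u\ge0$. $p_D$ is given Dirichlet data on $\Gamma$ and $f_h:\Omega^{\mathcal T}\to\mathbb R$ a given source in $L^2(\Omega^{\mathcal T})$. Ghost penalty. $j_h(u_h,v_h)=\sum_{F\in\mathcal F_h^{\mathcal C}}j_F(u_h,v_h)$ is a symmetric non-negative bilinear form on $\Sigma_h$ with semi-norm $|\cdot|_j$, with $j_F$ continuous w.r.t. the $L^2(\omega_F)$-norm (uniformly), $j_F(r_h,r_h)\gtrsim\inf_v\|v-r_h\|^2_{\omega_F}$ (infimum over polynomials on $\omega_F$ of the same degree), and $\|r_h\|_\Omega+|r_h|_j\simeq\|r_h\|_{\Omega^{\mathcal T}}$ for all $r_h\in\Sigma_h$. Norm: $\|v\|_\Sigma^2=\|v\|_{\Omega_\gamma}^2+\|\operatorname{div}v\|_{\Omega^{\mathcal T}}^2$ with $\|v\|_{\Omega_\gamma}=\|v\|_{\Omega^{\mathcal T}}$ if $\gamma_u>0$ and $\|v\|_{\Omega_\gamma}=\|v\|_\Omega$ if $\gamma_u=0$. $a\lesssim b$ means $a\le cb$ with $c$ independent of the mesh size and the cut position; $\gtrsim$ and $\simeq$ are analogous. *)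

(* Defs.v *)
From HB Require Import structures.
From mathcomp Require Import all_boot all_order all_algebra.
From mathcomp Require Import all_classical all_reals all_analysis.
(* The notations of multinomials clash with those of MathComp-Analysis. *)
From mathcomp Require mpoly.
Import (canonicals, coercions) mpoly.

Set Implicit Arguments.
Unset Strict Implicit.
Unset Printing Implicit Defensive.

Import Order.TTheory GRing.Theory Num.Theory.
Import numFieldNormedType.Exports.

Local Open Scope classical_set_scope.
Local Open Scope ring_scope.

(* The normedModType norm of 'rV[R]_d is the maximum norm, so the Euclidean   *)
(* one is defined separately; both induce the same topology.                  *)
Definition dotr (R : realType) (d : nat) (x y : 'rV[R]_d) : R :=
  \sum_(i < d) x ord0 i * y ord0 i.

Definition enorm (R : realType) (d : nat) (x : 'rV[R]_d) : R :=
  Num.sqrt (dotr x x).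

(* [set 0] makes the diameter of the empty set 0 instead of -oo. *)
Definition ediam (R : realType) (d : nat) (A : set 'rV[R]_d) : \bar R :=
  ereal_sup ([set 0%E] `|`
    [set e | exists x y, [/\ A x, A y & e = (enorm (x - y))%:E]]).

Definition coords (R : realType) (d : nat) (i : 'I_d) (x : 'rV[R]_d) :
  measurableTypeR R := x ord0 i.

Section borel_rV.
Context (R : realType) (d : nat).

Let rV_set0 : g_sigma_preimage (@coords R d) set0.
Proof. exact: sigma_algebra0. Qed.

Let rV_setC A : g_sigma_preimage (@coords R d) A ->
  g_sigma_preimage (@coords R d) (~` A).
Proof. exact: sigma_algebraC. Qed.

Let rV_bigcup (F : (set 'rV[R]_d)^nat) :
  (forall i, g_sigma_preimage (@coords R d) (F i)) ->
  g_sigma_preimage (@coords R d) (\bigcup_i F i).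
Proof. exact: sigma_algebra_bigcup. Qed.

HB.instance Definition _ := @isMeasurable.Build default_measure_display
  'rV[R]_d (g_sigma_preimage (@coords R d)) rV_set0 rV_setC rV_bigcup.

Lemma measurable_coords (i : 'I_d) : measurable_fun [set: 'rV[R]_d] (coords i).
Proof.
move=> _ Y mY; rewrite setTI; apply: sub_sigma_algebra => /=.
rewrite -bigcup_seq/=; exists i => /=; first by rewrite mem_index_enum.
by exists Y => //; rewrite setTI.
Qed.

Lemma measurable_fun_rVP d1 (T1 : measurableType d1) (f : T1 -> 'rV[R]_d) :
  (forall i, measurable_fun [set: T1] (coords i \o f)) ->
  measurable_fun [set: T1] f.
Proof.
move=> mf.
suff H : g_sigma_preimage (fun i => coords i \o f) `<=` measurable.
  move=> _ A mA; apply: H; rewrite g_sigma_preimage_comp.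
  by exists A => //.
apply: smallest_sub; first exact: sigma_algebra_measurable.
move=> A; rewrite -bigcup_seq/= => -[i _] [B mB <-].
exact: mf.
Qed.

End borel_rV.

Section lebesgue_rV.
Context (R : realType).

Definition consrow (n : nat) (p : measurableTypeR R * 'rV[R]_n) : 'rV[R]_n.+1 :=
  \row_i (if unlift ord0 i is Some j then p.2 ord0 j else p.1).

Definition unconsrow (n : nat) (x : 'rV[R]_n.+1) : measurableTypeR R * 'rV[R]_n :=
  (x ord0 ord0, \row_j x ord0 (lift ord0 j)).

Lemma consrowK n : cancel (@consrow n) (@unconsrow n).
Proof.
move=> [x y]; rewrite /unconsrow mxE unlift_none/=; congr pair.
by apply/rowP => j; rewrite !mxE liftK.
Qed.

Lemma measurable_consrow n : measurable_fun setT (@consrow n).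
Proof.
apply: measurable_fun_rVP => i.
have [j ij|i0] := unliftP ord0 i.
  rewrite (_ : _ \o _ = coords j \o snd).
    by apply: measurableT_comp => //; exact: measurable_coords.
  by apply/funext => p /=; rewrite /coords mxE ij liftK.
rewrite (_ : _ \o _ = fst)//.
by apply/funext => p /=; rewrite /coords mxE i0 unlift_none.
Qed.

Lemma measurable_unconsrow n : measurable_fun setT (@unconsrow n).
Proof.
apply: measurable_fun_pair; first exact: measurable_coords.
apply: measurable_fun_rVP => i.
rewrite (_ : _ \o _ = coords (lift ord0 i)); first exact: measurable_coords.
by apply/funext => x /=; rewrite /coords mxE.
Qed.

Section step.
Context (n : nat) (mu : {sigma_finite_measure set 'rV[R]_n -> \bar R}).

Definition volS : set 'rV[R]_n.+1 -> \bar R :=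
  fun A => (@lebesgue_measure R \x mu)%E (@consrow n @^-1` A).

Let volS0 : volS set0 = 0%E.
Proof. by rewrite /volS preimage_set0 measure0. Qed.

Let volS_ge0 A : (0 <= volS A)%E.
Proof. exact: measure_ge0. Qed.

Let volS_sigma_additive : semi_sigma_additive volS.
Proof.
move=> F mF tF mUF; rewrite /volS preimage_bigcup.
apply: measure_semi_sigma_additive.
- by move=> i; rewrite -[X in measurable X]setTI; exact: measurable_consrow.
- by apply/trivIsetP => i j _ _ ij; rewrite -preimage_setI;
    move/trivIsetP : tF => /(_ _ _ I I ij) ->; rewrite preimage_set0.
- by rewrite -preimage_bigcup -[X in measurable X]setTI;
    exact: measurable_consrow.
Qed.

HB.instance Definition _ := isMeasure.Build _ _ _ volS
  volS0 volS_ge0 volS_sigma_additive.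

Let volS_sigma_finite : sigma_finite setT volS.
Proof.
have [F TF Foo] : sigma_finite setT (@lebesgue_measure R \x mu)%E.
  have /sigma_finiteP[F [TF ndF Foo]] := sigma_finiteT (@lebesgue_measure R).
  have /sigma_finiteP[G [TG ndG Goo]] := sigma_finiteT mu.
  exists (fun k => F k `*` G k).
    rewrite -setXTT TF TG predeqE => -[x y]; split.
      move=> [/= [k _ Fkx] [l _ Gly]]; exists (maxn k l) => //; split.
      - by move: x Fkx; exact/subsetPset/ndF/leq_maxl.
      - by move: y Gly; exact/subsetPset/ndG/leq_maxr.
    by move=> [k _ []/= ? ?]; split; exists k.
  move=> k; have [? ?] := Foo k; have [? ?] := Goo k.
  split; first exact: measurableX.
  by rewrite product_measure1E// lte_mul_pinfty// ge0_fin_numE.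
exists (fun k => @unconsrow n @^-1` F k).
  by rewrite -preimage_bigcup -TF preimage_setT.
move=> k; have [mF Fk] := Foo k; split.
  by rewrite -[X in measurable X]setTI; exact: measurable_unconsrow.
rewrite /volS -comp_preimage (_ : _ \o _ = id) ?preimage_id//.
by apply/funext => p /=; rewrite consrowK.
Qed.

HB.instance Definition _ := Measure_isSigmaFinite.Build _ _ _ volS
  volS_sigma_finite.

End step.

Fixpoint vol (d : nat) : {sigma_finite_measure set 'rV[R]_d -> \bar R} :=
  match d with
  | 0 => dirac (0 : 'rV[R]_0)
  | n.+1 => volS (vol n)
  end.

End lebesgue_rV.

Section hausdorff.
Context (R : realType) (d : nat) (s : nat).
Local Open Scope ereal_scope.

(* The factor, volume of the unit ball of R^s, normalises H^{d-1} to the usual *)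
(* length or surface area.                                                    *)
Definition hgauge (B : set 'rV[R]_d) : \bar R :=
  if B == set0 then 0
  else vol R s [set y | (enorm y <= 1)%R] * (ediam B * (2^-1)%:E) ^+ s.

Definition hcover (delta : R) (A : set 'rV[R]_d) : set ((set 'rV[R]_d)^nat) :=
  [set B | A `<=` \bigcup_i B i /\ forall i, ediam (B i) <= delta%:E].

Definition hpre (delta : R) (A : set 'rV[R]_d) : \bar R :=
  ereal_inf [set \sum_(i <oo) hgauge (B i) | B in hcover delta A].

Definition hausdorff (A : set 'rV[R]_d) : \bar R :=
  ereal_sup [set hpre delta A | delta in [set delta | (0 < delta)%R]].

Lemma ediam_ge0 (B : set 'rV[R]_d) : 0 <= ediam B.
Proof. by apply: ereal_sup_ubound; left. Qed.

Lemma ediam0 : ediam (set0 : set 'rV[R]_d) = 0.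
Proof.
apply/eqP; rewrite eq_le ediam_ge0 andbT; apply: ge_ereal_sup.
by move=> e [->|[x [y []]]].
Qed.

Lemma hgauge_ge0 B : 0 <= hgauge B.
Proof.
rewrite /hgauge; case: ifP => // _; apply: mule_ge0 => //.
by apply: expe_ge0; apply: mule_ge0; rewrite ?ediam_ge0// lee_fin.
Qed.

Lemma hgauge0 : hgauge set0 = 0.
Proof. by rewrite /hgauge eqxx. Qed.

Lemma hpre_ge0 delta A : 0 <= hpre delta A.
Proof.
apply: le_ereal_inf_tmp => x [B _ <-].
by apply: nneseries_ge0 => *; exact: hgauge_ge0.
Qed.

Lemma hpre0 delta : (0 < delta)%R -> hpre delta set0 = 0.
Proof.
move=> d0; apply/eqP; rewrite eq_le hpre_ge0 andbT.
apply: ereal_inf_lbound; exists (fun=> set0).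
  by split => // i; rewrite ediam0 lee_fin ltW.
by apply: eseries0 => i _ _; exact: hgauge0.
Qed.

Lemma le_hpre delta : {homo hpre delta : A B / A `<=` B >-> A <= B}.
Proof.
move=> A B AB; apply/ereal_inf_le_tmp => _ [F [BF dF] <-].
by exists F => //; split => //; exact: subset_trans AB BF.
Qed.

Lemma hpre_sigma_subadditive delta : sigma_subadditive (hpre delta).
Proof.
move=> A; have [[i ioo]|] := pselect (exists i, hpre delta (A i) = +oo).
  rewrite (eseries_pinfty _ _ ioo) ?leey// => n _.
  by rewrite -ltNye (lt_le_trans _ (hpre_ge0 _ _)).
rewrite -forallNE => Aoo.
suff add2e (e : {posnum R}) :
    hpre delta (\bigcup_n A n) <= \sum_(i <oo) hpre delta (A i) + e%:num%:E.
  by apply/lee_addgt0Pr => _/posnumP[].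
rewrite (le_trans _ (epsilon_trick _ _ _))//; last first.
  by move=> n; exact: hpre_ge0.
pose P n (B : (set 'rV[R]_d)^nat) := hcover delta (A n) B /\
  \sum_(k <oo) hgauge (B k) <= hpre delta (A n) + (e%:num / (2 ^ n.+1)%:R)%:E.
have [G PG] : {G : ((set 'rV[R]_d)^nat)^nat & forall n, P n (G n)}.
  apply: (@choice _ _ P) => n; rewrite /P /hpre.
  set S := (X in ereal_inf X); move infS : (ereal_inf S) => iS.
  case: iS infS => [r Sr|Soo|Soo].
  - have en1 : (0 < e%:num / (2 ^ n.+1)%:R)%R by [].
    have /(lb_ereal_inf_adherent en1) : ereal_inf S \is a fin_num by rewrite Sr.
    move=> [x [B cB muBx] xS].
    by exists B; split => //; rewrite muBx -Sr; exact/ltW.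
  - by have := Aoo n; rewrite /hpre Soo.
  - suff : lbound S 0 by move/le_ereal_inf_tmp; rewrite Soo.
    move=> /= _ [B _ <-]; apply: nneseries_ge0 => *; exact: hgauge_ge0.
have muG_ge0 x : 0 <= (hgauge \o uncurry G) x by exact: hgauge_ge0.
apply: (@le_trans _ _ (\esum_(i in setT) (hgauge \o uncurry G) i)).
  rewrite /hpre; apply: ereal_inf_lbound => /=.
  have /card_esym/ppcard_eqP[f] := card_nat2.
  exists (uncurry G \o f).
    split => [|i].
      apply: (@subset_trans _ (\bigcup_n \bigcup_k G n k)) => [t [i _]|].
        by move=> /((PG i).1.1) -[j _ ?]; exists i => //; exists j.
      move=> t [i _ [j _ Bijt]]; exists (f^-1%FUN (i, j)) => //=.
      by rewrite invK ?inE.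
    by rewrite /=; case: (f i) => a b; exact: (PG a).1.2.
  rewrite -(esum_pred_image (hgauge \o uncurry G) _ xpredT) ?[fun=> _]set_true//.
  by rewrite image_eq.
rewrite (_ : esum _ _ = \sum_(i <oo) \sum_(j <oo ) hgauge (G i j)); last first.
  pose J : nat -> set (nat * nat) := fun i => [set (i, j) | j in setT].
  rewrite (_ : setT = \bigcup_k J k); last first.
    by rewrite predeqE => -[a b]; split => // _; exists a => //; exists b.
  rewrite esum_bigcupT /=; last 2 first.
    - apply/trivIsetP => i j _ _ ij.
      rewrite predeqE => -[n m] /=; split => //= -[] [_] _ [<-{n} _].
      by move=> [m' _] [] /esym/eqP; rewrite (negbTE ij).
    - by move=> p; exact: hgauge_ge0.
  rewrite -(image_id [set: nat]) -fun_true esum_pred_image//; last first.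
    by move=> n _; apply: esum_ge0 => p _; exact: hgauge_ge0.
  apply: eq_eseriesr => /= j _.
  rewrite -(esum_pred_image (hgauge \o uncurry G) (pair j) predT)//=; last 2 first.
    by move=> ? _; exact: hgauge_ge0.
    by move=> ? ? _ _; exact: (@can_inj _ _ _ snd).
  by congr esum; rewrite predeqE => -[a b]; split; move=> [i _ <-]; exists i.
apply: lee_lim.
- apply: is_cvg_nneseries => n *.
  by apply: nneseries_ge0 => m *; exact: (muG_ge0 (n, m)).
- by apply: is_cvg_nneseries => n *; apply: adde_ge0 => //; exact: hpre_ge0.
- by near=> n; apply: lee_sum => i _; exact: (PG i).2.
Unshelve. all: by end_near. Qed.

Let hausdorff0 : hausdorff set0 = 0.
Proof.
rewrite /hausdorff (_ : [set _ | _ in _] = [set 0]) ?ereal_sup1//.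
apply/seteqP; split => [_ [delta /= d0 <-]|_ ->] /=; first by rewrite hpre0.
by exists 1%R => /=; [exact: ltr01|rewrite hpre0].
Qed.

Let hausdorff_ge0 A : 0 <= hausdorff A.
Proof.
apply: (le_trans (hpre_ge0 1 A)); apply: ereal_sup_ubound.
by exists 1%R => //=; exact: ltr01.
Qed.

Let le_hausdorff : {homo hausdorff : A B / A `<=` B >-> A <= B}.
Proof.
move=> A B AB; apply: ge_ereal_sup => _ [delta /= d0 <-].
apply: (le_trans (le_hpre delta AB)).
by apply: ereal_sup_ubound; exists delta.
Qed.

Let hausdorff_sigma_subadditive : sigma_subadditive hausdorff.
Proof.
move=> F; apply: ge_ereal_sup => _ [delta /= d0 <-].
apply: (le_trans (hpre_sigma_subadditive delta F)).
apply: lee_nneseries => [i _ _|i _]; first exact: hpre_ge0.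
by apply: ereal_sup_ubound; exists delta.
Qed.

HB.instance Definition _ := isOuterMeasure.Build R 'rV[R]_d hausdorff
  hausdorff0 hausdorff_ge0 le_hausdorff hausdorff_sigma_subadditive.

Definition hausdorff_outer : {outer_measure set 'rV[R]_d -> \bar R} :=
  hausdorff.

Definition hmeasure :
  {measure set (caratheodory_type hausdorff_outer) -> \bar R} :=
  hausdorff_outer.

End hausdorff.

Definition L2 (disp : measure_display) (T : measurableType disp) (R : realType)
    (mu : {measure set T -> \bar R}) (D : set T) (f : T -> R) : Prop :=
  measurable_fun D f /\ (\int[mu]_(x in D) (f x ^+ 2)%:E < +oo)%E.

Section calculus.
Context (R : realType) (d : nat).
Implicit Types (U : set 'rV[R]_d) (phi g : 'rV[R]_d -> R).

Definition partial (i : 'I_d) phi : 'rV[R]_d -> R :=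
  fun x => 'D_(delta_mx ord0 i) phi x.

Definition grad phi (x : 'rV[R]_d) : 'rV[R]_d := \row_i partial i phi x.

(* C^oo: every iterated partial derivative is (Frechet-)differentiable *)
Definition smooth phi : Prop :=
  forall (s : seq 'I_d) (x : 'rV[R]_d), differentiable (foldr partial phi s) x.

Definition test_function U phi : Prop :=
  let supp := closure [set x | phi x <> 0] in
  [/\ smooth phi, compact supp & supp `<=` U].

Definition weak_div U (v : 'rV[R]_d -> 'rV[R]_d) g : Prop :=
  forall phi, test_function U phi ->
    \int[vol R d]_(x in U) dotr (v x) (grad phi x) =
    - \int[vol R d]_(x in U) (g x * phi x).

Definition Hdiv U (v : 'rV[R]_d -> 'rV[R]_d) : Prop :=
  (forall i : 'I_d, L2 (vol R d) U (fun x => v x ord0 i)) /\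
  (exists g, L2 (vol R d) U g /\ weak_div U v g).

End calculus.

Section domains.
Context (R : realType) (d : nat).
Implicit Types (Om : set 'rV[R]_d).

Definition bdry Om : set 'rV[R]_d := closure Om `\` interior Om.

Definition bounded_domain Om : Prop :=
  [/\ Om !=set0, open Om, connected Om & bounded_set Om].

(* Near each boundary point, Om is the strict epigraph, in some unit          *)
(* direction e, of a Lipschitz function psi on the hyperplane orthogonal to   *)
(* e; y - (y . e) e is the orthogonal projection of y onto that hyperplane.   *)
Definition lipschitz_bdry Om : Prop :=
  forall x, bdry Om x ->
  exists (e : 'rV[R]_d) (L : R) (psi : 'rV[R]_d -> R),
    [/\ enorm e = 1,
        forall y z, `|psi y - psi z| <= L * enorm (y - z) &
        \forall y \near x, Om y <-> psi (y - dotr y e *: e) < dotr y e].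

(* Near x, up to an arbitrarily thin double cone around the hyperplane        *)
(* orthogonal to nu, Om lies on the side of -nu; where bdry Om is the graph   *)
(* of a function differentiable at x, nu is the classical outward normal.     *)
Definition outward_normal_at Om (nu x : 'rV[R]_d) : Prop :=
  enorm nu = 1 /\
  forall eps, 0 < eps -> \forall y \near x, y <> x ->
    (dotr (y - x) nu <= - eps * enorm (y - x) -> Om y) /\
    (eps * enorm (y - x) <= dotr (y - x) nu -> ~ Om y).

(* surface measure on boundaries *)
Definition Hbdry := hmeasure R d d.-1.

(* The normal of a Lipschitz boundary exists only almost everywhere. *)
Definition outward_unit_normal Om (n : 'rV[R]_d -> 'rV[R]_d) : Prop :=
  (forall i : 'I_d, measurable_fun
     (bdry Om : set (caratheodory_type (hausdorff_outer R d d.-1)))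
     (fun x => n x ord0 i)) /\
  Hbdry [set x | bdry Om x /\ ~ outward_normal_at Om (n x) x] = 0%E.

End domains.

(* An element is given by the set of indices of its d + 1 vertices, and a     *)
(* facet by the set of its d vertices.                                        *)
Record mesh (R : realType) (d : nat) := Mesh {
  nv : nat;
  vert : 'I_nv -> 'rV[R]_d;
  elts : {set {set 'I_nv}}
}.

Notation cell Th := {set 'I_(nv Th)}.

Section meshes.
Context (R : realType) (d : nat) (Th : mesh R d).
Implicit Types (T F : cell Th).

Definition hull T : set 'rV[R]_d :=
  [set x | exists w : 'I_(nv Th) -> R,
    [/\ forall i, 0 <= w i, forall i, i \notin T -> w i = 0,
        \sum_i w i = 1 & x = \sum_i w i *: vert i]].

Definition nondegenerate T : Prop :=
  #|T| = d.+1 /\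
  forall w : 'I_(nv Th) -> R,
    (forall i, i \notin T -> w i = 0) ->
    \sum_i w i = 0 -> \sum_i w i *: vert i = 0 -> forall i, w i = 0.

Definition triangulates (bg : set 'rV[R]_d) : Prop :=
  [/\ forall T, T \in elts Th -> nondegenerate T,
      forall T T', T \in elts Th -> T' \in elts Th ->
        hull T `&` hull T' = hull (T :&: T') &
      closure bg = \bigcup_(T in [set T | T \in elts Th]) hull T].

Definition hT T : R := fine (ediam (hull T)).

Definition mesh_size : R := \big[Num.max/0]_(T in elts Th) hT T.

(* each element contains a ball of radius at least h_T / sigma *)
Definition shape_regular (sigma : R) : Prop :=
  forall T, T \in elts Th -> exists (x : 'rV[R]_d) (r : R),
    [/\ 0 < r, hT T <= sigma * r &
        forall y, enorm (y - x) <= r -> hull T y].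

Definition quasi_uniform (kappa : R) : Prop :=
  forall T, T \in elts Th -> mesh_size <= kappa * hT T.

Definition adjacent : rel (cell Th) :=
  fun T T' => (T != T') && (#|T :&: T'| == d).

Section cut.
Variable Om : set 'rV[R]_d.

Definition active : {set cell Th} :=
  [set T in elts Th | `[< (0 < vol R d (hull T `&` Om))%E >]]%SET.

Definition cut : {set cell Th} :=
  [set T in elts Th | `[< (0 < Hbdry R d (hull T `&` bdry Om))%E >]]%SET.

Definition uncut : {set cell Th} := active :\: cut.

Definition OmT : set 'rV[R]_d := \bigcup_(T in [set T | T \in active]) hull T.

(* Patches of at most Np elements, with a root reached from every element of  *)
(* the patch by crossing at most Nf facets interior to the patch.             *)
Definition patches (Np Nf : nat) (Ch : {set {set cell Th}}) : Prop :=
  [/\ finset.trivIset Ch,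
      forall P, P \in Ch -> P \subset active /\ (#|P| <= Np)%N,
      forall P, P \in Ch -> exists root, [/\ root \in P, root \in uncut &
        forall T, T \in P -> exists s : seq (cell Th),
          [/\ path adjacent T s, last T s = root, {subset s <= P} &
              (size s <= Nf)%N]],
      forall T, T \in active -> T \in cut -> T \in finset.cover Ch &
      forall T, T \in active -> T \notin cut ->
        (forall T', T' \in cut -> ~~ adjacent T T') -> [set T]%SET \in Ch].

Definition patch_facets (Ch : {set {set cell Th}}) : {set cell Th} :=
  [set F | [exists P in Ch, [exists T in P, [exists T' in P,
     adjacent T T' && (F == T :&: T')]]]]%SET.

Definition omF F : set 'rV[R]_d :=
  \bigcup_(T in [set T | T \in active /\ F \subset T]) hull T.

End cut.
End meshes.

Section fem.
Context (R : realType) (d k : nat) (Th : mesh R d) (Om : set 'rV[R]_d).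

(* Broken polynomials: one polynomial (or vector of polynomials) for each     *)
(* element, equal to 0 outside the active mesh.                               *)
Definition bscal := {ffun cell Th -> mpoly.mpoly d R}.
Definition bvec := {ffun cell Th -> {ffun 'I_d -> mpoly.mpoly d R}}.

Definition peval (p : mpoly.mpoly d R) (x : 'rV[R]_d) : R :=
  mpoly.meval (fun i => x ord0 i) p.

Definition pveval (a : 'I_d -> mpoly.mpoly d R) (x : 'rV[R]_d) : 'rV[R]_d :=
  \row_i peval (a i) x.

(* Pointwise representatives: an active element containing x is selected;     *)
(* the choice only matters on the facets. It is irrelevant for volume         *)
(* integrals, and for integrals of the normal component over bdry Om if the   *)
(* vector field is in H(div).                                                 *)
Definition eval (q : bscal) (x : 'rV[R]_d) : R :=
  if [pick T in active Th Om | x \in hull T] is Some T then peval (q T) x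
  else 0.

Definition veval (v : bvec) (x : 'rV[R]_d) : 'rV[R]_d :=
  if [pick T in active Th Om | x \in hull T] is Some T then pveval (v T) x
  else 0.

Definition Qh : set bscal :=
  [set q : bscal | forall T,
    (T \in active Th Om -> (mpoly.msize (q T) <= k.+1)%N) /\
    (T \notin active Th Om -> q T = 0)].

Definition RT_local (v : 'I_d -> mpoly.mpoly d R) : Prop :=
  exists (a : 'I_d -> mpoly.mpoly d R) (b : mpoly.mpoly d R),
    [/\ forall i, (mpoly.msize (a i) <= k.+1)%N, (mpoly.msize b <= k.+1)%N &
        forall i, v i = a i + b * mpoly.mpolyX R (mpoly.mnm1 i)].

Definition Sigmah : set bvec :=
  [set v : bvec | (forall T, (T \in active Th Om -> RT_local (v T)) /\
                             (T \notin active Th Om -> v T = 0)) /\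
                  Hdiv (interior (OmT Th Om)) (veval v)].

(* For v in Sigmah, which is polynomial on each element, the weak divergence  *)
(* on the interior of OmT is the elementwise one.                             *)
Definition bdiv (v : bvec) : bscal :=
  [ffun T => \sum_(i < d) mpoly.mderiv i (v T i)].

Definition ip (S : set 'rV[R]_d) (f g : 'rV[R]_d -> R) : R :=
  \int[vol R d]_(x in S) (f x * g x).

Definition vip (S : set 'rV[R]_d) (f g : 'rV[R]_d -> 'rV[R]_d) : R :=
  \int[vol R d]_(x in S) dotr (f x) (g x).

Definition nrm (S : set 'rV[R]_d) (f : 'rV[R]_d -> R) : R := Num.sqrt (ip S f f).

Definition vnrm (S : set 'rV[R]_d) (f : 'rV[R]_d -> 'rV[R]_d) : R :=
  Num.sqrt (vip S f f).

Section ghost.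
Variables (Ch : {set {set cell Th}}) (jF : cell Th -> bvec -> bvec -> R).

Definition jh (u v : bvec) : R := \sum_(F in patch_facets Ch) jF F u v.

Definition jnrm (u : bvec) : R := Num.sqrt (jh u u).

(* cj is a common bound for the constants hidden in the estimates. *)
Definition ghost_penalty (cj : R) : Prop :=
  [/\ forall F, F \in patch_facets Ch -> forall (c : R) (u v w : bvec),
        Sigmah u -> Sigmah v -> Sigmah w ->
        jF F (c *: u + v) w = c * jF F u w + jF F v w /\
        jF F w (c *: u + v) = c * jF F w u + jF F w v,
      forall u v, Sigmah u -> Sigmah v -> jh u v = jh v u /\ 0 <= jh u u,
      forall F, F \in patch_facets Ch -> forall u v, Sigmah u -> Sigmah v ->
        `|jF F u v| <= cj * vnrm (omF Om F) (veval u) * vnrm (omF Om F) (veval v),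
      forall F, F \in patch_facets Ch -> forall r, Sigmah r ->
        inf [set vnrm (omF Om F) (fun x => pveval w x - veval r x) ^+ 2
            | w in [set w : 'I_d -> mpoly.mpoly d R |
                    forall i, (mpoly.msize (w i) <= k.+2)%N]]
        <= cj * jF F r r &
      forall r, Sigmah r ->
        vnrm Om (veval r) + jnrm r <= cj * vnrm (OmT Th Om) (veval r) /\
        vnrm (OmT Th Om) (veval r) <= cj * (vnrm Om (veval r) + jnrm r)].

Variable gamma : R.

Definition ah (u v : bvec) : R :=
  vip Om (veval u) (veval v) + gamma * jh u v.

Definition bh (v : bvec) (q : bscal) : R :=
  ip (OmT Th Om) (eval (bdiv v)) (eval q).

Definition nrmQ (q : bscal) : R := nrm (OmT Th Om) (eval q).

Definition nrmS (v : bvec) : R :=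
  Num.sqrt (vnrm (if 0 < gamma then OmT Th Om else Om) (veval v) ^+ 2
            + nrm (OmT Th Om) (eval (bdiv v)) ^+ 2).

End ghost.

(* (v . n, pD) on the boundary of Om *)
Definition bdry_load (n : 'rV[R]_d -> 'rV[R]_d) (pD : 'rV[R]_d -> R)
    (v : bvec) : R :=
  \int[Hbdry R d]_(x in bdry Om) (dotr (veval v x) (n x) * pD x).

Definition source_load (f : 'rV[R]_d -> R) (q : bscal) : R :=
  - ip (OmT Th Om) f (eval q).

End fem.

Arguments Qh {R d} k Th Om _.
Arguments Sigmah {R d} k Th Om _.

Section saddle.
Context (R : realType) (E G : lmodType R) (V : set E) (Q : set G).
Context (NV : E -> R) (NQ : G -> R) (a : E -> E -> R) (b : E -> G -> R).

Definition inf_sup : \bar R :=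
  ereal_inf [set ereal_sup [set (b u q / (NV u * NQ q))%:E
                           | u in [set u | V u /\ u <> 0]]
            | q in [set q | Q q /\ q <> 0]].

Definition saddle_solution (l : E -> R) (g : G -> R) (u : E) (p : G) : Prop :=
  [/\ V u, Q p, forall v, V v -> a u v + b v p = l v &
      forall q, Q q -> b u q = g q].

Definition dual_norm (X : Type) (W : set X) (N : X -> R) (l : X -> R) : \bar R :=
  ereal_sup [set (l v)%:E | v in [set v | W v /\ N v <= 1]].

Definition well_posed (C : R) (l : E -> R) (g : G -> R) : Prop :=
  exists u p, [/\ saddle_solution l g u p,
    forall u' p', saddle_solution l g u' p' -> u' = u /\ p' = p &
    ((NV u + NQ p)%:E <= C%:E * (dual_norm V NV l + dual_norm Q NQ g))%E].

End saddle.

(* Main.v *)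
(* The inf-sup condition follows from a right inverse of the divergence built *)
(* without any regularity theory.  For phi in Q_h let A phi in Sigma_h be the *)
(* sum of two fields.                                                         *)
(* (1) A lowest-order Raviart-Thomas field whose normal flux through a facet  *)
(* is the flux of (x_0 + B) e_0, averaged over the facet, times the mean of   *)
(* phi on the upwind element.  As div((x_0 + B) e_0) = 1, testing with the    *)
(* element means m_T of phi gives at least 1/2 sum_T |T| m_T^2: the terms on  *)
(* interior facets are squares of jumps, and the weight x_0 + B is positive.  *)
(* (2) The bubble sum_l lam_l (a_l . grad phi) (x - a_l) on each element, with *)
(* barycentric coordinates lam_l and vertices a_l; it has no flux through the *)
(* facets, and (div ., phi)_T is the integral over T of the variance of the   *)
(* slopes a_l . grad phi with weights lam_l.                                  *)
(* By pull-back to a reference simplex and equivalence of norms there, this   *)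
(* variance and the means control ||phi||, so that (div A phi, phi) >=        *)
(* c ||phi||^2 and ||A phi|| <= C ||phi||, with constants that see neither    *)
(* the mesh size nor the cut.  Lax-Milgram then gives, for q in Q_h, a field  *)
(* A phi whose divergence is q.  Well-posedness is Brezzi's argument, once    *)
(* the boundary load is known to be linear: this needs that Borel sets are    *)
(* Caratheodory measurable for the Hausdorff measure, and that a compact      *)
(* Lipschitz boundary has finite surface measure.                             *)
Require Import Defs.
From HB Require Import structures.
From mathcomp Require Import all_boot all_order all_algebra.
From mathcomp Require Import all_classical all_reals all_analysis.
From mathcomp Require Import measurable_realfun ring lra.
From mathcomp Require mpoly.
Import (canonicals, coercions) mpoly.

Set Implicit Arguments.
Unset Strict Implicit.
Unset Printing Implicit Defensive.

Import Order.TTheory GRing.Theory Num.Theory.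
Import numFieldNormedType.Exports.

Local Open Scope classical_set_scope.
Local Open Scope ring_scope.

(** * Quadratic forms and saddle-point problems *)

(** The inf-sup constant is the inverse of the norm of a right inverse of the divergence, so the
    inequality reduces to [div_lift]. There the field is sought as A phi, with A the linear map
    [transport], and it suffices that (div A phi, phi) be coercive in phi and that A be bounded
    ([transport_estimates]); [linear_system_solvable] then plays the role of the Lax-Milgram
    theorem.

    Coercivity splits into two parts. The bubble has no flux through the facets, so that on each
    element Green's formula leaves minus the integral of bubble . grad phi, which is the integral of
    the variance [cell_spread] of the slopes a_l . grad phi ([transport_cell_energy]). These slopes
    are unchanged by affine maps up to a common shift, so the variance compares with the L2 norm by
    constants of the reference simplex alone ([cell_poincare], [cell_inverse]); all that it misses
    is the mean. The means are controlled by an upwind finite volume scheme for a velocity of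
    divergence one ([upwind_energy]): interior facets contribute squares of jumps and boundary
    facets contribute with a favourable sign, whatever the shape of the active mesh. This is why the
    position of the cut does not enter the constants. The bound on A phi, [transport_bound], is
    where shape regularity and quasi-uniformity are used.

    That A phi lies in H(div) rests on [flux_neighbour]: the vectors |T| grad lam_l of the two
    elements sharing a facet are opposite. Together with the divergence theorem on one element,
    [Rintegral_hull_apex], it makes the interior fluxes cancel against every test function
    ([Sigmah_conforming_field]).

    Well-posedness is [saddle_well_posed]. Coercivity of a_h on the kernel of b_h is [ah_coercive]:
    since div Sigma_h is contained in Q_h, the kernel consists of fields of zero divergence, and the
    norm equivalence of the ghost penalty controls what is left. The loads have to be linear, hence
    their integrands integrable; for the boundary load this uses [borel_caratheodory] and
    [hausdorff_bdry_fin]. *)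

Section linear_sets.
Context (R : realType) (E : lmodType R).
Implicit Types (V : set E) (u v x : E) (s : seq E) (B N D : E -> E -> R).

Definition lspace V := V 0 /\ forall c u v, V u -> V v -> V (c *: u + v).

(** Recursion on the list turns arguments on the dimension into inductions on [s]. *)
Fixpoint inspan s v : Prop :=
  if s is x :: s' then exists c, inspan s' (v - c *: x) else v = 0.

Definition spanned V :=
  exists s, {in s, forall x, V x} /\ forall v, V v -> inspan s v.

Definition linear_on V (f : E -> R) :=
  forall c u v, V u -> V v -> f (c *: u + v) = c * f u + f v.

Lemma lspaceZ V c u : lspace V -> V u -> V (c *: u).
Proof. by move=> [V0 VD] Vu; rewrite -[_ *: _]addr0; apply: VD. Qed.

Lemma lspaceD V u v : lspace V -> V u -> V v -> V (u + v).
Proof. by move=> [V0 VD] Vu Vv; rewrite -[u]scale1r; apply: VD. Qed.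

Lemma lspaceB V u v : lspace V -> V u -> V v -> V (u - v).
Proof.
by move=> VV Vu Vv; rewrite -scaleN1r; apply: lspaceD => //; exact: lspaceZ.
Qed.

Lemma inspan_lspace s : lspace (inspan s).
Proof.
elim: s => [|x s [IH0 IHD]]; split => //=.
- by move=> c u v -> ->; rewrite scaler0 addr0.
- by exists 0; rewrite scale0r subr0.
move=> c u v [a ua] [b vb]; exists (c * a + b).
suff -> : c *: u + v - (c * a + b) *: x = c *: (u - a *: x) + (v - b *: x).
  exact: IHD.
by rewrite scalerBr scalerA scalerDl opprD addrACA.
Qed.

Lemma inspan_sub V s v : lspace V -> {in s, forall x, V x} -> inspan s v -> V v.
Proof.
move=> VV; elim: s v => [|x s IH] v sV /=; first by move=> ->; case: VV.
move=> [c /IH H]; rewrite -[v](subrK (c *: x)); apply: lspaceD => //.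
  by apply: H => y ys; apply: sV; rewrite inE ys orbT.
by apply: lspaceZ => //; apply: sV; rewrite inE eqxx.
Qed.

Lemma inspan_mem s x : x \in s -> inspan s x.
Proof.
elim: s => [//|y s IH]; rewrite inE => /orP[/eqP ->|/IH ys] /=.
  by exists 1; rewrite scale1r subrr; case: (inspan_lspace s).
by exists 0; rewrite scale0r subr0.
Qed.

(** Exchange argument. If some [v0] in [V] involves the head [x] of the list, multiples of it remove
    [x] from all other vectors of [V], and induction applies to what remains. *)
Lemma sub_inspan V s : lspace V -> (forall v, V v -> inspan s v) -> spanned V.
Proof.
elim: s V => [|x s IH] V VV Vs; first by exists [::]; split.
have [H|] := pselect (forall v, V v -> inspan s v); first exact: IH.
move=> /existsNP[v0 /not_implyP[Vv0 nv0]].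
have [c0 vc0] := Vs _ Vv0.
have c0N : c0 != 0.
  by apply/eqP => c00; move: vc0; rewrite c00 scale0r subr0.
have [|v [] //|s' [s'V Vs']] := IH (V `&` inspan s).
  have [? ?] := VV; have [? ?] := inspan_lspace s.
  by split; [split|move=> c u v [? ?] [? ?]; split; auto].
exists (v0 :: s'); split.
  by move=> y; rewrite inE => /orP[/eqP -> //|/s'V[]].
move=> v Vv /=; have [c vc] := Vs _ Vv; exists (c / c0); apply: Vs'; split.
  by apply: lspaceB => //; exact: lspaceZ.
have -> : v - (c / c0) *: v0 = (v - c *: x) - (c / c0) *: (v0 - c0 *: x).
  by rewrite scalerBr scalerA divfK// opprB addrA subrK.
by apply: lspaceB => //; [exact: inspan_lspace|apply: lspaceZ => //; exact: inspan_lspace].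
Qed.

Lemma linear_on0 V f : lspace V -> linear_on V f -> f 0 = 0.
Proof.
by move=> [V0 _] /(_ (-1) _ _ V0 V0); rewrite scaler0 addr0 mulN1r addNr.
Qed.

Lemma linear_onZ V f c u : lspace V -> linear_on V f -> V u -> f (c *: u) = c * f u.
Proof.
move=> VV lf Vu; rewrite -[c *: u]addr0 lf ?(linear_on0 VV) ?addr0//.
by case: VV.
Qed.

Lemma linear_onD V f u v : linear_on V f -> V u -> V v -> f (u + v) = f u + f v.
Proof. by move=> lf Vu Vv; rewrite -[u in LHS]scale1r lf// mul1r. Qed.

Lemma linear_onB V f u v :
  linear_on V f -> V u -> V v -> f (u - v) = f u - f v.
Proof. by move=> lf Vu Vv; rewrite -scaleN1r addrC lf// mulN1r addrC. Qed.

Lemma lspace_sum V (I : Type) (r : seq I) (c : I -> R) (e : I -> E) :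
  lspace V -> (forall i, V (e i)) -> V (\sum_(i <- r) c i *: e i).
Proof.
move=> [V0 VD] Ve; elim: r => [|i r IH]; first by rewrite big_nil.
by rewrite big_cons; apply: VD.
Qed.

Lemma linear_on_sum V f (I : Type) (r : seq I) (c : I -> R) (e : I -> E) :
  lspace V -> linear_on V f -> (forall i, V (e i)) ->
  f (\sum_(i <- r) c i *: e i) = \sum_(i <- r) c i * f (e i).
Proof.
move=> VV lf Ve; elim: r => [|i r IH]; first by rewrite !big_nil (linear_on0 VV).
by rewrite !big_cons lf// ?IH//; exact: lspace_sum.
Qed.

Lemma inspan_sum s v : inspan s v ->
  exists c : 'I_(size s) -> R, v = \sum_i c i *: s`_i.
Proof.
elim: s v => [|x s IH] v /=; first by move=> ->; exists (fun=> 0); rewrite big_ord0.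
move=> [a /IH[c Ec]]; exists (fun i => if unlift ord0 i is Some j then c j else a).
rewrite big_ord_recl unlift_none /=; under eq_bigr do rewrite liftK/=.
by rewrite -Ec addrC subrK.
Qed.

(* The square system may be singular; it is only required to be compatible. *)
Lemma linear_system_solvable V (K : E -> E -> R) (l : E -> R) :
  lspace V -> spanned V ->
  (forall v, V v -> linear_on V (K ^~ v)) -> (forall u, V u -> linear_on V (K u)) ->
  linear_on V l ->
  (forall v, V v -> (forall u, V u -> K u v = 0) -> l v = 0) ->
  exists2 u, V u & forall v, V v -> K u v = l v.
Proof.
move=> VV [s [sV Vs]] K1 K2 ll Kl.
have Ve (i : 'I_(size s)) : V s`_i by apply: sV; rewrite mem_nth.
pose G := \matrix_(i < size s, j < size s) K s`_i s`_j.
pose L := \row_(j < size s) l s`_j.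
(* Fredholm alternative: each column of the cokernel of [G] is the coordinate vector of some [w]
   with [K u w = 0] for all [u], and compatibility gives [l w = 0]. *)
have /submxP[c Lc] : (L <= G)%MS.
  rewrite submxE; apply/eqP/rowP => j; rewrite mxE [RHS]mxE.
  pose w := \sum_k (cokermx G) k j *: s`_k.
  have Vw : V w by exact: lspace_sum.
  rewrite -[RHS](Kl w) //.
    rewrite (linear_on_sum _ _ VV)//; apply: eq_bigr => k _.
    by rewrite mxE mulrC.
  move=> u /Vs/inspan_sum[d ->].
  rewrite (linear_on_sum _ _ VV (K1 _ Vw))//; apply: big1 => i _.
  rewrite (linear_on_sum _ _ VV (K2 _ (Ve i)))//.
  have := congr1 (fun M : matrix R _ _ => M i j) (mulmx_coker G).
  rewrite !mxE => /(congr1 ( *%R (d i))); rewrite mulr0 => Gij; rewrite -[RHS]Gij; congr (_ * _).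
  by apply: eq_bigr => k _; rewrite !mxE mulrC.
exists (\sum_i c 0 i *: s`_i); first exact: lspace_sum.
move=> v Vv; have [d ->] := inspan_sum (Vs _ Vv).
rewrite (linear_on_sum _ _ VV ll)// (linear_on_sum _ _ VV (K2 _ _))//; last first.
  exact: lspace_sum.
apply: eq_bigr => j _; congr (_ * _).
have := congr1 (fun M : matrix R _ _ => M 0 j) Lc; rewrite !mxE => ->.
rewrite (linear_on_sum _ _ VV (K1 _ (Ve j)))//.
by apply: eq_bigr => i _; rewrite mxE.
Qed.

Definition psdform V B :=
  [/\ forall u, V u -> linear_on V (B u), forall u v, V u -> V v -> B u v = B v u &
      forall u, V u -> 0 <= B u u].

Lemma psdform_linl V B v : lspace V -> psdform V B -> V v -> linear_on V (B ^~ v).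
Proof.
move=> [_ VD] [B1 B2 _] Vv c u w Vu Vw.
by rewrite !(B2 _ v)// ?B1//; exact: VD.
Qed.

Lemma psdform_sqrD V B u v : lspace V -> psdform V B -> V u -> V v ->
  B (u + v) (u + v) = B u u + 2 * B u v + B v v.
Proof.
move=> VV BB Vu Vv; have [B1 B2 _] := BB; have Vuv := lspaceD VV Vu Vv.
rewrite (linear_onD (B1 _ Vuv))//.
rewrite (linear_onD (psdform_linl VV BB Vu))//.
by rewrite (linear_onD (psdform_linl VV BB Vv))// (B2 v u)//; ring.
Qed.

Lemma psdform_sqrZ V B c u : lspace V -> psdform V B -> V u ->
  B (c *: u) (c *: u) = c ^+ 2 * B u u.
Proof.
move=> VV BB Vu; have [B1 _ _] := BB.
rewrite (linear_onZ _ VV (B1 _ (lspaceZ c VV Vu)))//.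
by rewrite (linear_onZ _ VV (psdform_linl VV BB Vu))//; ring.
Qed.

Lemma psdform_CauchySchwarz_sqr V B u v : lspace V -> psdform V B -> V u -> V v ->
  B u v ^+ 2 <= B u u * B v v.
Proof.
move=> VV BB Vu Vv; have [B1 B2 B0] := BB.
have H (t : R) : 0 <= t ^+ 2 * B u u + 2 * t * B u v + B v v.
  have Vtu := lspaceZ t VV Vu.
  have := B0 _ (lspaceD VV Vtu Vv); rewrite (psdform_sqrD VV)//.
  rewrite (psdform_sqrZ _ VV)// (linear_onZ _ VV (psdform_linl VV BB Vv))//.
  by rewrite mulrA.
(* If [B u u = 0] the polynomial in [t] is affine, and a nonzero slope would make it take the value
   -1. Otherwise it is evaluated at its minimiser. *)
have [u0|u0] := eqVneq (B u u) 0.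
  rewrite u0 mul0r; have [->|uv0] := eqVneq (B u v) 0; first by rewrite expr0n.
  have := H (- (B v v + 1) / (2 * B u v)); rewrite u0 mulr0 add0r.
  rewrite (_ : 2 * (- (B v v + 1) / (2 * B u v)) * B u v + B v v = -1).
    by rewrite ler0N1.
  by field.
have := H (- B u v / B u u).
have up : 0 < B u u by rewrite lt_def u0 B0.
rewrite (_ : _ + B v v = (B u u * B v v - B u v ^+ 2) / B u u); last by field.
by rewrite pmulr_lge0 ?invr_gt0// subr_ge0.
Qed.

Lemma psdform_CauchySchwarz V B u v : lspace V -> psdform V B -> V u -> V v ->
  `|B u v| <= Num.sqrt (B u u) * Num.sqrt (B v v).
Proof.
move=> VV BB Vu Vv; have [_ _ B0] := BB.
rewrite -sqrtrM ?B0// -sqrtr_sqr ler_sqrt ?mulr_ge0 ?B0//.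
exact: (psdform_CauchySchwarz_sqr VV).
Qed.

Lemma psdform_triangle V B u v : lspace V -> psdform V B -> V u -> V v ->
  Num.sqrt (B (u + v) (u + v)) <= Num.sqrt (B u u) + Num.sqrt (B v v).
Proof.
move=> VV BB Vu Vv; have [_ _ B0] := BB.
rewrite -[leRHS]ger0_norm ?addr_ge0 ?sqrtr_ge0// -sqrtr_sqr ler_wsqrtr//.
rewrite (psdform_sqrD VV)// sqrrD !sqr_sqrtr ?B0//.
have := psdform_CauchySchwarz VV BB Vu Vv.
move: (Num.sqrt (B u u) * _) => z /(le_trans (ler_norm _)) ?.
by rewrite -mulr_natl; lra.
Qed.

Lemma psdform_sqrD_le V B u v : lspace V -> psdform V B -> V u -> V v ->
  B (u + v) (u + v) <= 2 * B u u + 2 * B v v.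
Proof.
move=> VV BB Vu Vv; have [B1 B2 B0] := BB.
have Vv' := lspaceZ (-1) VV Vv.
have := B0 _ (lspaceD VV Vu Vv'); rewrite !(psdform_sqrD VV)//.
rewrite (psdform_sqrZ _ VV)// (linear_onZ _ VV (B1 _ Vu))//; lra.
Qed.

Lemma psdform0 V B u v : lspace V -> psdform V B -> V u -> V v ->
  B u u = 0 -> B u v = 0.
Proof.
move=> VV BB Vu Vv u0; have := psdform_CauchySchwarz_sqr VV BB Vu Vv.
by rewrite u0 mul0r => h; apply/eqP; rewrite -sqrf_eq0 eq_le h sqr_ge0.
Qed.

(** Equivalence of norms in finite dimension, for semidefinite forms and without compactness:
    Gram-Schmidt with respect to [D], by induction on a spanning list. It provides all constants on
    the reference simplex. *)
Lemma psdform_dominated V N D : lspace V -> spanned V ->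
  psdform V N -> psdform V D ->
  (forall v, V v -> D v v = 0 -> N v v = 0) ->
  exists2 C, 0 <= C & forall v, V v -> N v v <= C * D v v.
Proof.
move=> VV [s [sV Vs]] NN DD DN; have [D1 D2 D0] := DD; have [N1 N2 N0] := NN.
suff [C C0 HC] : exists2 C, 0 <= C & forall v, inspan s v -> N v v <= C * D v v.
  by exists C => // v /Vs; exact: HC.
move=> {Vs}; elim: s sV => [|x s IH] sV.
  exists 0 => // v -> /=; rewrite mul0r; have [V0 _] := VV.
  by rewrite (linear_on0 VV (N1 _ V0)).
have [|C C0 HC] := IH; first by move=> y ys; apply: sV; rewrite inE ys orbT.
have Vx : V x by apply: sV; rewrite inE eqxx.
have sV' v : inspan s v -> V v.
  by apply: inspan_sub => // y ys; apply: sV; rewrite inE ys orbT.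
have SS := inspan_lspace s.
(* [p] is a [D]-orthogonal projection of [x] onto the span of [s]. It exists even when [D] is
   degenerate there, because vectors with [D v v = 0] are [D]-orthogonal to everything. *)
have [|||||p sp Hp] := @linear_system_solvable (inspan s) D (D x) SS.
- by exists s; split => // y; exact: inspan_mem.
- by move=> v /sV' Vv c u w /sV' Vu /sV' Vw; exact: (psdform_linl VV DD).
- by move=> v /sV' Vv c u w /sV' Vu /sV' Vw; exact: D1.
- by move=> c u w /sV' Vu /sV' Vw; exact: D1.
- move=> v sv /(_ _ sv) vv0; rewrite D2//; last exact: sV'.
  by apply: (psdform0 VV DD) => //; exact: sV'.
have Vp := sV' _ sp.
have Vxp : V (x - p) by exact: lspaceB.
pose C1 := N (x - p) (x - p) / D (x - p) (x - p).
have HC1 : N (x - p) (x - p) <= C1 * D (x - p) (x - p).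
  rewrite /C1; have [d0|d0] := eqVneq (D (x - p) (x - p)) 0.
    by rewrite d0 mulr0 DN.
  by rewrite divfK.
have C10 : 0 <= C1 by rewrite divr_ge0 ?N0 ?D0.
exists (2 * C1 + 2 * C); first by rewrite addr_ge0// mulr_ge0.
move=> v /= [c vc].
have sw : inspan s (v - c *: (x - p)).
  rewrite scalerBr opprB addrCA addrC; apply: lspaceD => //.
  exact: lspaceZ.
set w := v - _ in sw.
have -> : v = c *: (x - p) + w by rewrite /w addrC subrK.
have Vw := sV' _ sw; have Vc := lspaceZ c VV Vxp.
apply: (le_trans (psdform_sqrD_le VV NN Vc Vw)).
rewrite (psdform_sqrD VV DD)// !(psdform_sqrZ _ VV)//.
have -> : D (c *: (x - p)) w = 0.
  rewrite (linear_onZ _ VV (psdform_linl VV DD Vw))//.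
  by rewrite (linear_onB (psdform_linl VV DD Vw))// Hp// subrr mulr0.
have := HC _ sw; have := D0 _ Vxp; have := D0 _ Vw; have := sqr_ge0 c.
set cc := c ^+ 2; set d := D _ _; set d' := D _ _; set m := N _ _; set m' := N _ _.
move=> cc0 d'0 d0 h.
have H1 : cc * m' <= cc * (C1 * d') by apply: ler_wpM2l => //; exact: HC1.
have H2 : 0 <= C1 * d by exact: mulr_ge0.
have H3 : 0 <= C * (cc * d') by rewrite mulr_ge0 // mulr_ge0.
rewrite mulr0 addr0.
have -> : (2 * C1 + 2 * C) * (cc * d' + d) =
  2 * (cc * (C1 * d')) + 2 * (C1 * d) + 2 * (C * (cc * d')) + 2 * (C * d) by ring.
lra.
Qed.

End linear_sets.

(** * Brezzi's theory of abstract saddle-point problems *)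

Section saddle_point.
Context (R : realType) (E G : lmodType R) (V : set E) (Q : set G).
Context (nV : E -> E -> R) (ipQ : G -> G -> R) (a : E -> E -> R) (b : E -> G -> R).
Hypotheses (VV : lspace V) (QQ : lspace Q) (sV : spanned V) (sQ : spanned Q).
Hypotheses (nV_psd : psdform V nV) (ipQ_psd : psdform Q ipQ).
Hypothesis nV_def : forall v, V v -> nV v v = 0 -> v = 0.
Hypothesis ipQ_def : forall q, Q q -> ipQ q q = 0 -> q = 0.
Hypotheses (al : forall v, V v -> linear_on V (a ^~ v))
  (ar : forall u, V u -> linear_on V (a u)).
Hypotheses (bl : forall q, Q q -> linear_on V (b ^~ q))
  (br : forall u, V u -> linear_on Q (b u)).

Let NV v := Num.sqrt (nV v v).
Let NQ q := Num.sqrt (ipQ q q).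

Variable C0 : R.
Hypothesis C0_gt0 : 0 < C0.
Hypothesis lift : forall r, Q r ->
  exists u, [/\ V u, forall q, Q q -> b u q = ipQ r q & NV u <= C0 * NQ r].

Let NV_ge0 v : 0 <= NV v. Proof. exact: sqrtr_ge0. Qed.
Let NQ_ge0 q : 0 <= NQ q. Proof. exact: sqrtr_ge0. Qed.

Let NV_sqr v : V v -> NV v ^+ 2 = nV v v.
Proof. by move=> Vv; rewrite sqr_sqrtr//; case: nV_psd => _ _ ->. Qed.

Let NQ_sqr q : Q q -> NQ q ^+ 2 = ipQ q q.
Proof. by move=> Qq; rewrite sqr_sqrtr//; case: ipQ_psd => _ _ ->. Qed.

Let NV0 v : V v -> NV v = 0 -> v = 0.
Proof. by move=> Vv v0; apply: nV_def => //; rewrite -NV_sqr// v0 expr0n. Qed.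

Let NQ0 q : Q q -> NQ q = 0 -> q = 0.
Proof. by move=> Qq q0; apply: ipQ_def => //; rewrite -NQ_sqr// q0 expr0n. Qed.

Let NV00 : NV 0 = 0.
Proof.
have [B1 _ _] := nV_psd; have [V0 _] := VV.
by rewrite /NV (linear_on0 VV (B1 _ V0)) sqrtr0.
Qed.

Let NVZ c v : V v -> NV (c *: v) = `|c| * NV v.
Proof.
by move=> Vv; rewrite /NV (psdform_sqrZ _ VV)// sqrtrM ?sqr_ge0// sqrtr_sqr.
Qed.

Let NQZ c v : Q v -> NQ (c *: v) = `|c| * NQ v.
Proof.
by move=> Vv; rewrite /NQ (psdform_sqrZ _ QQ)// sqrtrM ?sqr_ge0// sqrtr_sqr.
Qed.

(** Tested with the lift [u] of [q] itself, the quotient is |q| / |u|, and [lift] bounds |u| by [C0]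
    |q|. *)
Lemma inf_sup_ge : (C0^-1%:E <= inf_sup V Q NV NQ b)%E.
Proof.
apply: le_ereal_inf_tmp => _ [q [Qq q0] <-].
have [u [Vu bu uq]] := lift Qq.
have Nq : 0 < NQ q by rewrite lt_def NQ_ge0 andbT; apply/eqP => /(NQ0 Qq).
have Nu : 0 < NV u.
  rewrite lt_def NV_ge0 andbT; apply/eqP => /(NV0 Vu) u0.
  have : b u q = 0 by rewrite u0; exact: (linear_on0 VV (bl Qq)).
  by rewrite bu// -NQ_sqr// => /eqP; rewrite expf_eq0/= gt_eqF.
apply: (@le_trans _ _ (b u q / (NV u * NQ q))%:E).
  rewrite lee_fin bu// -NQ_sqr// ler_pdivlMr ?mulr_gt0// mulrA.
  rewrite expr2 ler_wpM2r// ler_pdivrMl//.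
apply: ereal_sup_ubound; exists u => //; split => //.
by move=> u0; move: Nu; rewrite u0 NV00 ltxx.
Qed.

Variables (alpha M : R).
Hypotheses (alpha_gt0 : 0 < alpha) (M_ge0 : 0 <= M).
Hypothesis a_bounded : forall u v, V u -> V v -> `|a u v| <= M * NV u * NV v.
Hypothesis a_coercive : forall u, V u -> (forall q, Q q -> b u q = 0) ->
  alpha * NV u ^+ 2 <= a u u.

(** Scaling to the unit ball of [N]. Where [N v = 0] no scaling is possible, and definiteness gives
    [v = 0]. *)
Let dual_bound (T : lmodType R) (W : set T) (N : T -> R) (l : T -> R) (A : R) :
  lspace W -> linear_on W l -> (forall v, 0 <= N v) ->
  (forall c v, W v -> N (c *: v) = `|c| * N v) -> (forall v, W v -> N v = 0 -> v = 0) ->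
  (dual_norm W N l <= A%:E)%E -> forall v, W v -> `|l v| <= A * N v.
Proof.
move=> WW ll N0 NZ Nd HA.
have H v : W v -> l v <= A * N v.
  move=> Wv; have [v0|v0] := eqVneq (N v) 0.
    by rewrite v0 mulr0 (Nd _ Wv v0) (linear_on0 WW).
  have Np : 0 < N v by rewrite lt_def v0 N0.
  have Wv' := lspaceZ (N v)^-1 WW Wv.
  have : ((l ((N v)^-1 *: v))%:E <= A%:E)%E.
    apply: le_trans HA; apply: ereal_sup_ubound; eexists; last reflexivity.
    by split => //; rewrite NZ// ger0_norm ?invr_ge0// mulVf.
  by rewrite lee_fin (linear_onZ _ WW ll)// ler_pdivrMl// mulrC.
move=> v Wv; rewrite ler_norml H// andbT.
have := H _ (lspaceZ (-1) WW Wv); rewrite (linear_onZ _ WW ll)// NZ// normrN1; lra.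
Qed.

Let dual_norm_ge0 (T : lmodType R) (W : set T) (N : T -> R) (l : T -> R) :
  lspace W -> linear_on W l -> N 0 = 0 -> (0 <= dual_norm W N l)%E.
Proof.
move=> WW ll N0; apply: ereal_sup_ubound; exists 0; last by rewrite (linear_on0 WW).
by split; [case: WW|rewrite N0].
Qed.

Let NQ00 : NQ 0 = 0.
Proof.
have [B1 _ _] := ipQ_psd; have [V0 _] := QQ.
by rewrite /NQ (linear_on0 QQ (B1 _ V0)) sqrtr0.
Qed.

(** The difference of the first components lies in the kernel of [b], where coercivity kills it; the
    difference of the second ones is then tested with its own lift. *)
Lemma saddle_unique l g u p u' p' :
  saddle_solution V Q a b l g u p -> saddle_solution V Q a b l g u' p' ->
  u' = u /\ p' = p.
Proof.
move=> [Vu Qp ul ug] [Vu' Qp' u'l u'g].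
have Vd := lspaceB VV Vu' Vu; have Qd := lspaceB QQ Qp' Qp.
have bd q : Q q -> b (u' - u) q = 0.
  by move=> Qq; rewrite (linear_onB (bl Qq))// u'g// ug// subrr.
have ad v : V v -> a (u' - u) v + b v (p' - p) = 0.
  move=> Vv; rewrite (linear_onB (al Vv))// (linear_onB (br Vv))//.
  by have := ul _ Vv; have := u'l _ Vv; lra.
have u0 : u' - u = 0.
  apply: NV0 => //; have := a_coercive Vd bd.
  have := ad _ Vd; rewrite bd// addr0 => -> h; apply/eqP.
  by rewrite -sqrf_eq0 eq_le sqr_ge0 andbT -(pmulr_rle0 _ alpha_gt0).
split; first exact: subr0_eq.
apply: subr0_eq; have [v [Vv bv _]] := lift Qd; apply: ipQ_def => //.
have := ad _ Vv; rewrite u0 bv// (linear_on0 VV (al Vv)) add0r//.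
Qed.

Lemma saddle_exists l g : linear_on V l -> linear_on Q g ->
  exists u p, saddle_solution V Q a b l g u p.
Proof.
move=> ll lg.
(* Solving [a u v + b v p = l v] and [b u q = g q] amounts to inverting a form
   on [V x Q]. *)
pose W : set (E * G)%type := V `*` Q.
pose K (x y : (E * G)%type) := a x.1 y.1 + b y.1 x.2 + b x.1 y.2.
have [V0 VD] := VV; have [Q0 QD] := QQ.
have WW : lspace W.
  by split => // c x y [? ?] [? ?]; split => /=; [exact: VD|exact: QD].
have [s [ssV sVs]] := sV; have [t [ttQ tQt]] := sQ.
have sW : spanned W.
  apply: (@sub_inspan _ _ _ ([seq (x, 0) | x <- s] ++ [seq (0, y) | y <- t])) => //.
  move=> [v q] [/= /sVs Vv /tQt Qq].
  elim: s {sVs ssV} v Vv => [|x s IH] v /=.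
    move=> ->; elim: t {ttQ tQt} q Qq => [|y t IH] q /=; first by move=> ->.
    by move=> [c /IH]; exists c; rewrite -[(0, q) - _]/(0 - c *: 0, q - c *: y) scaler0 subr0.
  by move=> [c /IH h]; exists c; rewrite -[(v, q) - _]/(v - c *: x, q - c *: 0) scaler0 subr0.
have [||||[u p] [/= Vu Qp] H] := @linear_system_solvable _ _ W K
    (fun x => l x.1 + g x.2) WW sW.
- move=> [v q] [/= Vv Qq] c [u p] [u' p'] [/= Vu Qp] [/= Vu' Qp'].
  by rewrite /K/= al// bl// br//; ring.
- move=> [v q] [/= Vv Qq] c [u p] [u' p'] [/= Vu Qp] [/= Vu' Qp'].
  by rewrite /K/= ar// bl// br//; ring.
- by move=> c [u p] [u' p'] [/= Vu Qp] [/= Vu' Qp']; rewrite ll// lg//; ring.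
(* Compatibility of the system: a pair annihilated from the left is zero, by the uniqueness argument
   for the transposed problem. *)
- move=> [v q] [/= Vv Qq] h.
  have bv r : Q r -> b v r = 0.
    move=> Qr; have := h (0, r); rewrite /K/= (linear_on0 VV (al Vv)) add0r.
    by rewrite (linear_on0 VV (bl Qq)) addr0; exact.
  have av u : V u -> a u v + b u q = 0.
    move=> Vu; have := h (u, 0); rewrite /K/= bv// addr0; exact.
  have v0 : v = 0.
    apply: NV0 => //; have := a_coercive Vv bv.
    have := av _ Vv; rewrite bv// addr0 => -> h'; apply/eqP.
    by rewrite -sqrf_eq0 eq_le sqr_ge0 andbT -(pmulr_rle0 _ alpha_gt0).
  have q0 : q = 0.
    have [u [Vu bu _]] := lift Qq; apply: ipQ_def => //.
    by have := av _ Vu; rewrite v0 bu// (linear_on0 VV (ar Vu)) add0r.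
  by rewrite v0 q0 (linear_on0 VV) ?(linear_on0 QQ)// addr0.
exists u, p; split => //.
  move=> v Vv; have := H (v, 0); rewrite /K/= (linear_on0 QQ lg) addr0.
  by rewrite (linear_on0 QQ (br Vu)) addr0; exact.
move=> q Qq; have := H (0, q); rewrite /K/= (linear_on0 VV ll) add0r.
by rewrite (linear_on0 VV (ar Vu)) (linear_on0 VV (bl Qp)) !add0r; exact.
Qed.

(** With [w] a lift of the Riesz representative of [g], the difference [u - w] lies in the kernel of
    [b] and is bounded by coercivity. The bound on [p] comes from testing the first equation with a
    lift of [p]. *)
Lemma saddle_well_posed l g : linear_on V l -> linear_on Q g ->
  let K := alpha^-1 + (1 + M / alpha) * C0 in
  well_posed V Q NV NQ a b (1 + K + C0 * (1 + M * K)) l g.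
Proof.
move=> ll lg K.
have Ka : 0 < alpha^-1 by rewrite invr_gt0.
have K0 : 0 < K.
  by rewrite ltr_wpDr// mulr_ge0 ?addr_ge0// ?divr_ge0// ltW.
have CK : 0 < 1 + K + C0 * (1 + M * K).
  have : 0 <= C0 * (1 + M * K) by rewrite mulr_ge0 ?addr_ge0 ?mulr_ge0// ltW.
  lra.
have [u [p sol]] := saddle_exists ll lg.
exists u, p; split => //; first by move=> u' p'; exact: saddle_unique.
have l0 := dual_norm_ge0 VV ll NV00; have g0 := dual_norm_ge0 QQ lg NQ00.
(* An infinite dual norm makes the stability bound trivial, since its constant is positive. *)
case Dl : (dual_norm V NV l) l0 => [A| |] // A0; last first.
  by rewrite addye ?gt0_muley ?leey// gt_eqF// (lt_le_trans _ g0)// ltNy0.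
case Dg : (dual_norm Q NQ g) g0 => [B| |] // B0; last first.
  by rewrite addey// gt0_muley ?leey.
rewrite lee_fin in A0; rewrite lee_fin in B0.
rewrite -EFinD -EFinM lee_fin.
have lA : forall v, V v -> `|l v| <= A * NV v.
  by apply: (dual_bound VV ll) => //; rewrite Dl.
have gB : forall q, Q q -> `|g q| <= B * NQ q.
  by apply: (dual_bound QQ lg) => //; rewrite Dg.
have [Vu Qp ul ug] := sol.
(* [r] is the Riesz representative of [g] in [Q]. *)
have [||||r Qr rg] := @linear_system_solvable _ _ Q ipQ g QQ sQ.
- by move=> v Qv; exact: psdform_linl QQ ipQ_psd Qv.
- by case: ipQ_psd.
- exact: lg.
- by move=> v Qv /(_ _ Qv) /(ipQ_def Qv) ->; rewrite (linear_on0 QQ).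
have rB : NQ r <= B.
  have := le_trans (ler_norm _) (gB _ Qr); rewrite -rg// -NQ_sqr// expr2.
  have [->//|r0] := eqVneq (NQ r) 0.
  by rewrite ler_pM2r// lt_def r0 NQ_ge0.
have [w [Vw bw Hw]] := lift Qr.
have wB : NV w <= C0 * B.
  by apply: (le_trans Hw); rewrite ler_pM2l.
have Vd := lspaceB VV Vu Vw.
have bd q : Q q -> b (u - w) q = 0.
  by move=> Qq; rewrite (linear_onB (bl Qq))// ug// bw// rg// subrr.
have dA : NV (u - w) <= alpha^-1 * (A + M * (C0 * B)).
  have [->|d0] := eqVneq (NV (u - w)) 0.
    by rewrite mulr_ge0 ?addr_ge0 ?mulr_ge0// ltW.
  have dp : 0 < NV (u - w) by rewrite lt_def d0 NV_ge0.
  rewrite ler_pdivlMl// -(ler_pM2r dp) -mulrA -expr2.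
  apply: (le_trans (a_coercive Vd bd)).
  rewrite (linear_onB (al Vd))//.
  have -> : a u (u - w) = l (u - w) by have := ul _ Vd; rewrite bd//; lra.
  apply: (le_trans (ler_norm _)); apply: (le_trans (ler_normB _ _)).
  rewrite mulrDl; apply: lerD; first exact: lA.
  apply: (le_trans (a_bounded Vw Vd)); apply: ler_wpM2r => //.
  by apply: ler_wpM2l.
have uK : NV u <= K * (A + B).
  have -> : u = (u - w) + w by rewrite subrK.
  apply: (le_trans (psdform_triangle VV nV_psd Vd Vw)).
  apply: (le_trans (lerD dA wB)); rewrite /K.
  have Ka' := ltW Ka; have C0' := ltW C0_gt0.
  have h1 : 0 <= alpha^-1 * B by exact: mulr_ge0.
  have h2 : 0 <= C0 * A by exact: mulr_ge0.
  have h3 : 0 <= M * alpha^-1 * (C0 * A) by rewrite mulr_ge0// mulr_ge0.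
  lra.
have pK : NQ p <= C0 * (A + M * NV u).
  have [->|p0] := eqVneq (NQ p) 0.
    by rewrite mulr_ge0 ?addr_ge0 ?mulr_ge0// ltW.
  have pp : 0 < NQ p by rewrite lt_def p0 NQ_ge0.
  have [v [Vv bv Hv]] := lift Qp.
  rewrite -(ler_pM2r pp) -expr2 NQ_sqr// -bv//.
  have -> : b v p = l v - a u v by have := ul _ Vv; lra.
  apply: (le_trans (ler_norm _)); apply: (le_trans (ler_normB _ _)).
  apply: (@le_trans _ _ ((A + M * NV u) * NV v)).
    by rewrite mulrDl; apply: lerD; [exact: lA|exact: a_bounded].
  rewrite mulrAC [leRHS]mulrC; apply: ler_wpM2l => //.
  by rewrite addr_ge0// mulr_ge0.
have h1 : C0 * (M * NV u) <= C0 * (M * (K * (A + B))).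
  by apply: ler_wpM2l; [exact: ltW|exact: ler_wpM2l].
have h2 : 0 <= C0 * B by rewrite mulr_ge0// ltW.
lra.
Qed.

End saddle_point.

(** * Lebesgue measure on row vectors *)

Section measurability.
Context (R : realType) (d : nat).
Implicit Types (A B U : set 'rV[R]_d) (x y : 'rV[R]_d).

Lemma rV_ballE x (e : R) y : 0 < e ->
  ball x e y <-> forall i : 'I_d, `|x ord0 i - y ord0 i| < e.
Proof.
move=> e0; split=> [[_ xy] i|xy]; first exact: (xy ord0 i).
by split => // i j; rewrite (ord1 i); exact: xy.
Qed.

Lemma measurable_rV_ball x (e : R) : 0 < e -> measurable (ball x e : set 'rV[R]_d).
Proof.
move=> e0.
rewrite (_ : ball x e = \bigcap_(i in [set: 'I_d]) (coords i @^-1` ball (x ord0 i) e)).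
  apply: fin_bigcap_measurable; first exact: finite_finset.
  move=> i _; rewrite -[X in measurable X]setTI; apply: measurable_coords => //.
  by apply: open_measurable; exact: ball_open.
apply/seteqP; split => y; first by move=> /rV_ballE -/(_ e0) xy i _; exact: xy.
by move=> xy; apply/rV_ballE => // i; exact: xy.
Qed.

(** Links the topology of the maximum norm with the sigma-algebra generated by the coordinates: an
    open set is a countable union of balls with rational centres and radii 1 / (n + 1), each a
    finite intersection of preimages of intervals. *)
Lemma open_measurable_rV U : open U -> measurable U.
Proof.
move=> oU.
pose F (p : 'rV[rat]_d * nat) : set 'rV[R]_d :=
  if `[< ball (map_mx ratr p.1 : 'rV[R]_d) p.2.+1%:R^-1 `<=` U >]
  then ball (map_mx ratr p.1 : 'rV[R]_d) p.2.+1%:R^-1 else set0.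
suff -> : U = \bigcup_p F p.
  apply: countable_bigcupT_measurable; first exact: countableP.
  move=> p; rewrite /F; case: ifP => // _; exact: measurable_rV_ball.
apply/seteqP; split => [x Ux|x [p _]]; last first.
  by rewrite /F; case: asboolP => // H; exact: H.
have /nbhs_ballP[e /= e0 xe] : nbhs x U by apply: open_nbhs_nbhs; split.
have [n ne] : exists n : nat, n.+1%:R^-1 < e / 2.
  exists (Num.truncn (e / 2)^-1); rewrite invf_plt ?posrE ?divr_gt0//.
  exact: truncnS_gt.
have n0 : 0 < n.+1%:R^-1 :> R by rewrite invr_gt0 ltr0n.
have [q qx] : {q : 'I_d -> rat & forall i, `|ratr (q i) - x ord0 i| < n.+1%:R^-1}.
  apply: (@choice _ _ (fun i q => `|ratr q - x ord0 i| < n.+1%:R^-1)) => i.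
  have [z [xz [q _ qz]]] := @dense_rat R (ball (x ord0 i) n.+1%:R^-1)
    (ex_intro _ _ (ballxx _ n0)) (ball_open _ _).
  by exists q; rewrite qz distrC.
exists (\row_i q i, n) => //; rewrite /F/=; case: asboolP => [_|[]].
  by apply/rV_ballE => // i; rewrite !mxE.
move=> y /rV_ballE -/(_ n0) qy; apply: xe; apply/rV_ballE => // i.
have := qy i; rewrite !mxE => h; have h' := qx i.
rewrite (splitr e) -(subrK (ratr (q i)) (x ord0 i)) -addrA.
apply: (le_lt_trans (ler_normD _ _)); rewrite distrC.
by apply: ltrD; [exact: lt_trans h' ne|exact: lt_trans h ne].
Qed.

Lemma closed_measurable_rV A : closed A -> measurable A.
Proof.
by move=> cA; rewrite -[A]setCK; apply: measurableC; apply: open_measurable_rV;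
   exact: closed_openC.
Qed.

Lemma continuous_measurable_rV (f : 'rV[R]_d -> R) :
  continuous f -> measurable_fun [set: 'rV[R]_d] f.
Proof.
move=> cf; apply: (measurability _ (RGenOpens.measurableE R)).
move=> _ [_ [a [b ->] <-]]; rewrite setTI; apply: open_measurable_rV.
by apply: open_comp => [x _|]; [exact: cf|exact: interval_open].
Qed.

End measurability.

Section volume.
Context (R : realType).
Local Notation lam := (@lebesgue_measure R).

Lemma lebesgue_measure_translation (a : R) (A : set R) :
  measurable A -> lam ((fun x => x + a) @^-1` A) = lam A.
Proof.
move=> mA.
have mf : measurable_fun setT ((fun x => x + a) : R -> measurableTypeR R).
  by apply: measurable_funD => //; exact: measurable_cst.
pose f : {mfun R >-> measurableTypeR R} := HB.pack
  ((fun x => x + a) : R -> measurableTypeR R) (isMeasurableFun.Build _ _ _ _ _ mf).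
apply/esym.
apply: (@lebesgue_measure_unique R (pushforward lam f)) => //= _ [[b c]] _ <-.
rewrite /pushforward /= (_ : _ @^-1` _ = `]b - a, c - a]%classic).
  rewrite !lebesgue_measure_itv/= !lte_fin ltrD2r -!EFinB.
  by rewrite (_ : c - a - (b - a) = c - b)//; ring.
by apply/seteqP; split => x /=; rewrite !in_itv/= ltrBlDr lerBrDr.
Qed.

Lemma vol_consrow n (A : set 'rV[R]_n.+1) :
  vol R n.+1 A = (lam \x vol R n)%E (@consrow R n @^-1` A).
Proof. by []. Qed.

Lemma consrowD n (p : measurableTypeR R * 'rV[R]_n) (a : 'rV[R]_n.+1) :
  consrow p + a = consrow (p.1 + a ord0 ord0, p.2 + \row_j a ord0 (lift ord0 j)).
Proof.
apply/rowP => i; rewrite !mxE; have [j ->|->] := unliftP ord0 i.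
  by rewrite /= !mxE.
by [].
Qed.

Lemma measurable_translation d (a : 'rV[R]_d) :
  measurable_fun setT (fun x : 'rV[R]_d => x + a).
Proof.
apply: measurable_fun_rVP => i.
rewrite (_ : _ \o _ = (fun x => coords i x + a ord0 i)).
  by apply: measurable_funD; [exact: measurable_coords|exact: measurable_cst].
by apply/funext => x; rewrite /coords/= mxE.
Qed.

Lemma vol_translation d (a : 'rV[R]_d) (A : set 'rV[R]_d) : measurable A ->
  vol R d ((fun x => x + a) @^-1` A) = vol R d A.
Proof.
elim: d a A => [|n IH] a A mA.
  by congr (_ _); apply/seteqP; split => x /=; rewrite (_ : x + a = x)//;
     apply/rowP => -[].
rewrite !vol_consrow.
pose f (p : measurableTypeR R * 'rV[R]_n) : measurableTypeR R * 'rV[R]_n :=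
  (p.1 + a ord0 ord0, p.2 + \row_j a ord0 (lift ord0 j)).
have mf : measurable_fun setT f.
  apply: measurable_fun_pair.
    by apply: measurable_funD; [exact: measurable_fst|exact: measurable_cst].
  by apply: (measurableT_comp (measurable_translation _)); exact: measurable_snd.
pose mfF : {mfun _ >-> _} := HB.pack f (isMeasurableFun.Build _ _ _ _ _ mf).
have mcA : measurable (@consrow R n @^-1` A).
  by rewrite -[X in measurable X]setTI; exact: measurable_consrow.
rewrite [RHS](@product_measure_unique _ _ _ _ _ lam (vol R n)
  (pushforward (lam \x vol R n)%E mfF))//.
  congr ((lam \x vol R n)%E _); apply/funext => p.
  by rewrite /preimage/= consrowD.
move=> B C mB mC.
transitivity ((lam \x vol R n)%E (((fun x => x + a ord0 ord0) @^-1` B) `*`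
  ((fun x => x + \row_j a ord0 (lift ord0 j)) @^-1` C))).
  by congr ((lam \x vol R n)%E _); apply/seteqP; split => -[x y].
rewrite product_measure1E.
- by congr (_ * _)%E; [exact: lebesgue_measure_translation|exact: IH].
- rewrite -[X in measurable X]setTI.
  by apply: measurable_funD => //; exact: measurable_cst.
- by rewrite -[X in measurable X]setTI; exact: measurable_translation.
Qed.

Definition cube d (M : R) : set 'rV[R]_d := [set x | forall i, `|x ord0 i| <= M].
Arguments cube : clear implicits.

Lemma measurable_cube d M : measurable (cube d M).
Proof.
rewrite (_ : cube d M = \bigcap_(i in [set: 'I_d]) (coords i @^-1` `[- M, M])).
  apply: fin_bigcap_measurable; first exact: finite_finset.
  by move=> i _; rewrite -[X in measurable X]setTI; apply: measurable_coords.
apply/seteqP; split => x H i; last by have /= := H i I; rewrite in_itv/= -ler_norml.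
by move=> _ /=; rewrite in_itv/= -ler_norml; exact: H.
Qed.

Lemma vol_cube d (M : R) : 0 <= M -> vol R d (cube d M) = ((2 * M) ^+ d)%:E.
Proof.
move=> M0; elim: d => [|n IH].
  by rewrite /= diracE mem_set// => -[].
rewrite vol_consrow (_ : _ @^-1` _ = `[- M, M] `*` cube n M).
  rewrite product_measure1E//; last exact: measurable_cube.
  transitivity ((2 * M)%:E * ((2 * M) ^+ n)%:E)%E; last by rewrite -EFinM exprS.
  congr (_ * _)%E; last exact: IH.
  rewrite [LHS]lebesgue_measure_itv/= lte_fin; case: ltP => [_|MM].
    by rewrite -EFinD; congr (_%:E); ring.
  by congr (_%:E); lra.
apply/seteqP; split => -[x y] /=.
  rewrite in_itv/= -ler_norml => H; split.
    by have := H ord0; rewrite mxE unlift_none.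
  by move=> i; have := H (lift ord0 i); rewrite mxE liftK.
rewrite in_itv/= -ler_norml => -[H1 H2] i; rewrite mxE.
by case: unliftP => [j _|_]; [exact: H2|exact: H1].
Qed.

Lemma bounded_sub_cube d (A : set 'rV[R]_d) : bounded_set A ->
  exists2 M, 0 <= M & A `<=` cube d M.
Proof.
move=> [M [_ HM]]; exists (`|M| + 1); first by rewrite addr_ge0.
move=> x Ax i; have := HM (`|M| + 1); rewrite ltr_pwDr// ?ler_norm// => /(_ isT x Ax).
apply: le_trans; rewrite /Num.norm/= mx_normrE.
by apply: (le_bigmax_seq _ (ord0, i)) => //=; rewrite mem_index_enum.
Qed.

Lemma vol_bounded d (A : set 'rV[R]_d) : measurable A -> bounded_set A ->
  (vol R d A < +oo)%E.
Proof.
move=> mA /bounded_sub_cube[M M0 AM].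
apply: (@le_lt_trans _ _ (vol R d (cube d M))); last by rewrite vol_cube ?ltry.
by apply: le_measure; rewrite ?inE//; exact: measurable_cube.
Qed.

End volume.
Arguments cube {R} d M _.

(** * Changes of variables by linear and affine maps *)

Section linear_change_of_variables.
Context (R : realType) (d : nat) (M : 'M[R]_d).
Hypothesis uM : M \in unitmx.
Local Notation m := (vol R d).
Implicit Types A B : set 'rV[R]_d.

Lemma measurable_mulmx (N : 'M[R]_d) : measurable_fun setT (fun x : 'rV[R]_d => x *m N).
Proof.
apply: measurable_fun_rVP => i.
rewrite (_ : _ \o _ = (fun x => \sum_j coords j x * N j i)); last first.
  by apply/funext => x; rewrite /coords/= mxE.
apply: measurable_sum => j.
by apply: measurable_funM; [exact: measurable_coords|exact: measurable_cst].
Qed.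

Let nu A := m ((fun x => x *m M) @^-1` A).

Let measurable_pre A : measurable A -> measurable ((fun x : 'rV[R]_d => x *m M) @^-1` A).
Proof. by move=> mA; rewrite -[X in measurable X]setTI; exact: measurable_mulmx. Qed.

Let nuE A (x : 'rV[R]_d) : measurable A -> m [set y | A (y *m M + x)] = nu A.
Proof.
move=> mA; rewrite /nu -(vol_translation (x *m invmx M) (measurable_pre mA)).
by congr (m _); apply/funext => y; rewrite /preimage/= mulmxDl mulmxKV.
Qed.

(** The argument for uniqueness of Haar measure: the set of pairs (x, y) with x in [A] and x + yM in
    [B] is measured by Fubini's theorem in both orders. It shows that [nu] is proportional to the
    volume without any computation of determinants. *)
Let nu_exchange A B : measurable A -> measurable B -> -%R @^-1` A = A ->
  (m A * nu B = m B * nu A)%E.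
Proof.
move=> mA mB A_sym.
pose P1 := [set p : 'rV[R]_d * 'rV[R]_d | A p.1 /\ B (p.2 *m M + p.1)].
pose P2 := [set p : 'rV[R]_d * 'rV[R]_d | A (p.1 - p.2 *m M) /\ B p.1].
have mlin (s : R) : measurable_fun setT
    (fun p : 'rV[R]_d * 'rV[R]_d => p.1 + s *: (p.2 *m M)).
  apply: measurable_fun_rVP => i.
  rewrite (_ : _ \o _ = (fun p => coords i p.1 + s * coords i (p.2 *m M))); last first.
    by apply/funext => p; rewrite /coords/= !mxE.
  apply: measurable_funD.
    by apply: (measurableT_comp (measurable_coords i)); exact: measurable_fst.
  apply: measurable_funM; first exact: measurable_cst.
  apply: (measurableT_comp (measurable_coords i)).
  by apply: (measurableT_comp (measurable_mulmx M)); exact: measurable_snd.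
have mfst C : measurable C ->
    measurable ((@fst 'rV[R]_d 'rV[R]_d) @^-1` C).
  by move=> mC; rewrite -[X in measurable X]setTI; exact: measurable_fst.
have mP1 : measurable P1.
  apply: measurableI; first exact: mfst.
  have := mlin 1 measurableT _ mB; rewrite setTI.
  by congr measurable; apply/funext => p; rewrite /preimage/= scale1r addrC.
have mP2 : measurable P2.
  apply: measurableI; last exact: mfst.
  have := mlin (-1) measurableT _ mA; rewrite setTI.
  by congr measurable; apply/funext => p; rewrite /preimage/= scaleN1r.
have prodE P : measurable P -> (m \x m)%E P = (m \x^ m)%E P.
  by apply: product_measure_unique => *; exact: product_measure2E.
have nu0 C : (0 <= nu C)%E by exact: measure_ge0.
have <- : (m \x m)%E P1 = (m A * nu B)%E.
  transitivity (\int[m]_x ((\1_A x)%:E * nu B))%E.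
    apply: eq_integral => x _ /=; have [Ax|nAx] := pselect (A x).
      rewrite indicE mem_set// mul1e -(nuE x mB); congr (m _); apply/seteqP.
      by split => y; rewrite /xsection/= inE; [case|split].
    rewrite indicE memNset// mul0e (_ : xsection _ _ = set0) ?measure0//.
    by apply/seteqP; split => y //; rewrite /xsection/= inE => -[].
  rewrite ge0_integralZr//.
  - by rewrite integral_indic// setIT.
  - by apply/measurable_EFinP; exact: measurable_indic.
have <- : (m \x m)%E P2 = (m B * nu A)%E.
  transitivity (\int[m]_x ((\1_B x)%:E * nu A))%E.
    apply: eq_integral => x _ /=; have [Bx|nBx] := pselect (B x).
      rewrite indicE mem_set// mul1e -(nuE (- x) mA); congr (m _); apply/seteqP.
      have AN z : A z <-> A (- z) by rewrite -{2}A_sym /= opprK.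
      split => y; rewrite /xsection/= inE.
        by case; rewrite /= AN opprB.
      by split => //=; rewrite AN opprB.
    rewrite indicE memNset// mul0e (_ : xsection _ _ = set0) ?measure0//.
    by apply/seteqP; split => y //; rewrite /xsection/= inE => -[].
  rewrite ge0_integralZr//.
  - by rewrite integral_indic// setIT.
  - by apply/measurable_EFinP; exact: measurable_indic.
(* For fixed [y] the sections of [P1] and [P2] are translates of each other by [y *m M]. *)
rewrite !prodE//; apply: eq_integral => y _ /=.
rewrite -(vol_translation (- (y *m M)) (measurable_ysection y mP1)).
congr (m _); apply/funext => x; rewrite /ysection/preimage/=.
by apply/propext; split; rewrite !inE /P1/P2/= [y *m M + _]addrC subrK.
Qed.

(** The factor is read off from the unit cube, which is symmetric and has positive finite volume, by
    [nu_exchange]. *)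
Lemma vol_mulmx : exists2 c : R, 0 < c & forall A, measurable A ->
  vol R d ((fun x => x *m M) @^-1` A) = (c%:E * vol R d A)%E.
Proof.
have c1_gt0 : 0 < (2 * 1) ^+ d :> R by rewrite exprn_gt0.
have mc : m (cube d 1) = ((2 * 1) ^+ d)%:E by rewrite vol_cube.
have csym : -%R @^-1` (cube d 1) = cube d (1 : R).
  by apply/seteqP; split => x /= H i; have := H i; rewrite mxE normrN.
have H A (mA : measurable A) := nu_exchange (@measurable_cube R d 1) mA csym.
have nufin : (nu (cube d 1) < +oo)%E.
  pose K : R := \sum_i \sum_j `|invmx M i j|.
  apply: (@le_lt_trans _ _ (m (cube d K))).
    apply: le_measure; rewrite ?inE//; [|exact: measurable_cube|].
      by apply: measurable_pre; exact: measurable_cube.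
    move=> x /= Hx i; rewrite -[x](mulmxK uM) mxE.
    apply: (le_trans (ler_norm_sum _ _ _)); apply: ler_sum => j _.
    rewrite normrM -[leRHS]mul1r; apply: ler_pM => //.
    by rewrite (bigD1 i)//= lerDl sumr_ge0.
  rewrite vol_cube ?ltry//; by apply: sumr_ge0 => i _; apply: sumr_ge0.
pose k := fine (nu (cube d 1)).
have nuE' : nu (cube d 1) = k%:E.
  by rewrite fineK// ge0_fin_numE//; exact: measure_ge0.
have HE A : measurable A -> nu A = ((k / (2 * 1) ^+ d)%:E * m A)%E.
  move=> mA; have := H A mA; rewrite mc nuE' => E.
  transitivity ((((2 * 1) ^+ d)^-1 * (2 * 1) ^+ d : R)%:E * nu A)%E.
    by rewrite mulVf ?gt_eqF// mul1e.
  rewrite EFinM -muleA E.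
  by rewrite [(m A * _)%E]muleC muleA -EFinM mulrC.
exists (k / (2 * 1) ^+ d); last exact: HE.
rewrite lt_def divr_ge0 ?fine_ge0 ?measure_ge0// ?ltW// andbT.
(* A zero factor would give the whole space volume zero, as it is its own preimage. *)
apply/eqP => c0; have := HE setT measurableT; rewrite c0 mul0e /nu preimage_setT.
have : (m (cube d 1) <= m setT)%E.
  by apply: le_measure; rewrite ?inE//; exact: measurable_cube.
by rewrite mc => h h0; move: h; rewrite h0 lee_fin leNgt c1_gt0.
Qed.

End linear_change_of_variables.

Section continuity_real.
Context (R : realType) (T : topologicalType).
Implicit Types f g : T -> R.

Lemma continuous_add f g :
  continuous f -> continuous g -> continuous (fun x => f x + g x).
Proof. by move=> cf cg x; exact: continuousD (cf x) (cg x). Qed.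

Lemma continuous_mul f g :
  continuous f -> continuous g -> continuous (fun x => f x * g x).
Proof. by move=> cf cg x; exact: continuousM (cf x) (cg x). Qed.

Lemma continuous_const (c : R) : continuous (fun _ : T => c).
Proof. by move=> x; exact: cvg_cst. Qed.

Lemma continuous_big_sum (I : Type) (r : seq I) (P : pred I) (F : I -> T -> R) :
  (forall i, P i -> continuous (F i)) ->
  continuous (fun x => \sum_(i <- r | P i) F i x).
Proof.
move=> cF; elim: r => [|i r IH].
  by under eq_fun do rewrite big_nil; exact: continuous_const.
under eq_fun do rewrite big_cons.
have := cF i; case: (P i) => //= /(_ isT) cFi.
by apply: continuous_add; [exact: cFi|exact: IH].
Qed.

End continuity_real.

Section continuity_rV.
Context (R : realType).

Lemma continuous_rVP (T : topologicalType) d (f : T -> 'rV[R]_d) :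
  (forall i, continuous (fun x => f x ord0 i)) -> continuous f.
Proof.
move=> cf x; apply/cvg_ballP => e e0.
have : \forall y \near x, forall i : 'I_d, ball (f x ord0 i) e (f y ord0 i).
  apply: filter_forall => i; move/cvg_ballP : (cf i x); exact.
by apply: filterS => y Hy; apply/rV_ballE.
Qed.

Lemma continuous_affine n d (a : 'rV[R]_d) (M : 'M[R]_(n, d)) :
  continuous (fun t : 'rV[R]_n => a + t *m M).
Proof.
apply: continuous_rVP => i.
rewrite (_ : (fun _ => _) = (fun t : 'rV[R]_n => a ord0 i + \sum_j t ord0 j * M j i)).
  apply: continuous_add; first exact: continuous_const.
  apply: continuous_big_sum => j _; apply: continuous_mul.
    exact: coord_continuous.
  exact: continuous_const.
by apply/funext => t; rewrite !mxE.
Qed.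

Lemma consrowE n (s : R) (y : 'rV[R]_n) :
  consrow (s, y) = s *: delta_mx ord0 ord0 + consrow (0, y).
Proof.
apply/rowP => i; rewrite !mxE; have [j ->|->] := unliftP ord0 i.
  by rewrite /= mulr0 add0r.
by rewrite /= mulr1 addr0.
Qed.

Lemma continuous_consrow_l n (y : 'rV[R]_n) :
  continuous (fun s : R => consrow (s, y) : 'rV[R]_n.+1).
Proof.
move=> s; under eq_fun do rewrite consrowE; rewrite consrowE.
by apply: cvgD; [exact: scalel_continuous|exact: cvg_cst].
Qed.

Lemma compact_cube d (M : R) : compact (cube d M).
Proof.
rewrite (_ : cube d M = [set v : 'rV[R]_d | forall i, `[- M, M]%classic (v ord0 i)]).
  apply: (@rV_compact R d (fun=> `[- M, M]%classic)) => i.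
  exact: segment_compact.
by apply/seteqP; split => v H i; have := H i; rewrite /= in_itv/= -ler_norml.
Qed.

Lemma continuous_bounded_on_cube d (M : R) (f : 'rV[R]_d -> R) : continuous f ->
  exists2 K, 0 <= K & forall x, cube d M x -> `|f x| <= K.
Proof.
move=> cf; have [M0|M0] := ltP M 0.
  case: d f cf => [|d] f cf.
    by exists `|f 0| => // x _; rewrite (_ : x = 0)//; apply/rowP => -[].
  exists 0 => // x /(_ ord0) h; have := le_lt_trans h M0.
  by rewrite ltNge normr_ge0.
have [||c _ Hc] := @EVT_max_rV R d (fun x => `|f x|) (cube d M) _ (@compact_cube d M).
- by exists 0 => i; rewrite mxE normr0.
- apply: continuous_subspaceT => x; apply: continuous_comp; first exact: cf.
  exact: norm_continuous.
by exists `|f c| => // x Mx; apply: Hc; rewrite inE.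
Qed.

Lemma integrable_continuous d (f : 'rV[R]_d -> R) (D : set 'rV[R]_d) :
  continuous f -> measurable D -> bounded_set D ->
  (vol R d).-integrable D (EFin \o f).
Proof.
move=> cf mD bD; have [M M0 DM] := bounded_sub_cube bD.
have [K K0 HK] := continuous_bounded_on_cube M cf.
apply: measurable_bounded_integrable => //.
- exact: vol_bounded.
- by apply: measurable_funTS; exact: continuous_measurable_rV.
exists K; split; first exact: num_real.
by move=> x Kx y Dy /=; apply: (le_trans (HK _ (DM _ Dy))); exact: ltW.
Qed.

Lemma bounded_cube d (M : R) : bounded_set (cube d M).
Proof. by apply: compact_bounded; exact: compact_cube. Qed.

Lemma sub_bounded d (A B : set 'rV[R]_d) : A `<=` B -> bounded_set B -> bounded_set A.
Proof. by move=> AB [M [Mr HM]]; exists M; split => // x Mx y /AB; exact: HM. Qed.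

End continuity_rV.

Section affine_change_of_variables.
Context (R : realType) (d : nat) (a : 'rV[R]_d) (M : 'M[R]_d).
Hypothesis uM : M \in unitmx.
Local Notation m := (vol R d).
Let A (t : 'rV[R]_d) : 'rV[R]_d := a + t *m M.

(** The push-forward of the volume by [A] is a multiple of the volume. Boundedness of the sets and
    continuity of [f] supply integrability. *)
Lemma Rintegral_affine : exists2 c : R, 0 < c &
  forall (D : set 'rV[R]_d) (f : 'rV[R]_d -> R), measurable D -> bounded_set D ->
    bounded_set (A @^-1` D) ->
    continuous f ->
  \int[m]_(t in A @^-1` D) f (A t) = c * \int[m]_(x in D) f x.
Proof.
have [c c0 Hc] := vol_mulmx uM; exists c => // D f mD bD bAD cf.
have mA : measurable_fun setT A.
  rewrite (_ : A = (fun x => x + a) \o (fun t => t *m M)).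
    by apply: measurableT_comp; [exact: measurable_translation|exact: measurable_mulmx].
  by apply/funext => t; rewrite /A/= addrC.
pose mAF : {mfun _ >-> _} := HB.pack A (isMeasurableFun.Build _ _ _ _ _ mA).
have mpre B : measurable B -> measurable (A @^-1` B).
  by move=> mB; rewrite -[X in measurable X]setTI; exact: (mA measurableT).
have pushE B : measurable B -> pushforward m mAF B = mscale (NngNum (ltW c0)) m B.
  move=> mB; rewrite /pushforward /mscale/= -(vol_translation a mB) -Hc.
    by congr (m _); apply/funext => t; rewrite /preimage/=/A addrC.
  by rewrite -[X in measurable X]setTI; exact: measurable_translation.
have cA : continuous A by exact: continuous_affine.
have cfA : continuous (f \o A) by move=> t; apply: continuous_comp; [exact: cA|exact: cf].
have mf : measurable_fun setT (EFin \o f).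
  by apply/measurable_EFinP; exact: continuous_measurable_rV.
rewrite /Rintegral -[c in RHS]/(fine c%:E) -fineM//; last first.
  by apply: integrable_fin_num => //; exact: integrable_continuous.
congr fine.
have := @integral_pushforward _ _ _ _ R A mA m D (EFin \o f) mf _ mD.
rewrite /= => <-; last by apply: integrable_continuous => //; exact: mpre.
rewrite (eq_measure_integral (mscale (NngNum (ltW c0)) m)); last first.
  by move=> B mB _; exact: pushE.
rewrite integralE [in RHS]integralE ge0_integral_mscale//; last first.
  by apply: measurable_funTS; exact: measurable_funepos.
rewrite ge0_integral_mscale//; last first.
  by apply: measurable_funTS; exact: measurable_funeneg.
rewrite /= -muleBr//; apply: fin_num_adde_defl.
rewrite fin_numN; apply: integrable_neg_fin_num => //.
exact: integrable_continuous.
Qed.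

End affine_change_of_variables.

(** * Integration over the reference simplex *)

Section reference_simplex.
Context (R : realType).
Local Notation lam := (@lebesgue_measure R).

Definition refsimp n : set 'rV[R]_n :=
  [set t | (forall i, 0 <= t ord0 i) /\ \sum_i t ord0 i <= 1].

Lemma refsimp_consrow n (s : R) (y : 'rV[R]_n) :
  refsimp (consrow (s, y)) <-> refsimp y /\ 0 <= s <= 1 - \sum_i y ord0 i.
Proof.
have E : \sum_(i < n.+1) (consrow (s, y)) ord0 i = s + \sum_i y ord0 i.
  rewrite big_ord_recl mxE unlift_none; congr (_ + _).
  by apply: eq_bigr => i _; rewrite mxE liftK.
rewrite /refsimp/= E; split=> [[H1 H2]|[[H1 H2] /andP[s0 s1]]].
  have s0 : 0 <= s by have := H1 ord0; rewrite mxE unlift_none.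
  split; last by rewrite s0/= lerBrDr.
  split; last by apply: le_trans H2; rewrite lerDr.
  by move=> i; have := H1 (lift ord0 i); rewrite mxE liftK.
split; last by rewrite -lerBrDr.
by move=> i; rewrite mxE; case: unliftP.
Qed.

Lemma refsimp_sub_cube n : refsimp (n:=n) `<=` cube n 1.
Proof.
move=> t [t0 t1] i; rewrite ger0_norm//; apply: le_trans t1.
by rewrite (bigD1 i)//= lerDl sumr_ge0.
Qed.

Lemma measurable_refsimp n : measurable (refsimp (n:=n)).
Proof.
rewrite (_ : refsimp (n:=n) = \bigcap_(i in [set: 'I_n]) (coords i @^-1` `[0, +oo[) `&`
    ((fun t : 'rV[R]_n => \sum_i coords i t) @^-1` `]-oo, 1])).
  apply: measurableI.
    apply: fin_bigcap_measurable; first exact: finite_finset.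
    by move=> i _; rewrite -[X in measurable X]setTI; apply: measurable_coords.
  rewrite -[X in measurable X]setTI; apply: measurable_sum => // i.
  exact: measurable_coords.
apply/seteqP; split => t; rewrite /refsimp/=.
  move=> [t0 t1]; split; last by rewrite in_itv.
  by move=> i _ /=; rewrite in_itv/= andbT; exact: t0.
move=> [H1]; rewrite in_itv/= => t1; split => // i.
by have := H1 i I; rewrite /= in_itv/= andbT.
Qed.

Lemma bounded_refsimp n : bounded_set (refsimp (n:=n)).
Proof. exact: (sub_bounded (@refsimp_sub_cube n) (@bounded_cube R n 1)). Qed.

Lemma Rintegral_vol_consrow n (D : set 'rV[R]_n.+1) (f : 'rV[R]_n.+1 -> R) :
  measurable D -> bounded_set D -> continuous f ->
  \int[vol R n.+1]_(x in D) f x =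
  \int[vol R n]_y (\int[lam]_(s in [set s | D (consrow (s, y))]) f (consrow (s, y))).
Proof.
move=> mD bD cf.
have mf : measurable_fun setT (EFin \o f \_ D).
  apply/measurable_EFinP; apply/(measurable_restrictT _ _).1 => //.
  by apply: measurable_funTS; exact: continuous_measurable_rV.
have iD := integrable_continuous cf mD bD.
have ifD : (vol R n.+1).-integrable setT (EFin \o f \_ D).
  by rewrite -restrict_EFin; apply/integrable_restrict => //; rewrite setTI.
pose cr : {mfun _ >-> _} := HB.pack (@consrow R n)
  (isMeasurableFun.Build _ _ _ _ _ (@measurable_consrow R n)).
have icr : (lam \x vol R n)%E.-integrable setT ((EFin \o f \_ D) \o @consrow R n).
  apply/integrableP; split; first by apply: measurableT_comp => //; exact: measurable_consrow.
  move/integrableP : ifD => [_]; apply: le_lt_trans.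
  rewrite (eq_measure_integral (pushforward (lam \x vol R n)%E cr)); last by [].
  have := @ge0_integral_pushforward _ _ _ _ R _ (@measurable_consrow R n)
    (lam \x vol R n)%E setT (abse \o (EFin \o f \_ D)) measurableT.
  rewrite /= => -> //; apply: measurableT_comp => //; exact: mf.
rewrite Rintegral_mkcond {1}/Rintegral.
rewrite (eq_measure_integral (pushforward (lam \x vol R n)%E cr)); last by [].
have := @integral_pushforward _ _ _ _ R _ (@measurable_consrow R n)
  (lam \x vol R n)%E setT (EFin \o f \_ D) mf icr measurableT.
rewrite /= => ->; rewrite preimage_setT -integral21_prod_meas1//.
rewrite /Rintegral; congr fine; apply: eq_integral => y _.
rewrite /fubini_G /=.
have E : (\int[lam]_x ((f \_ D) (consrow (x, y)))%:E =
   \int[lam]_(s in [set s | D (consrow (s, y))]) (f (consrow (s, y)))%:E)%E.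
  rewrite [RHS]integral_mkcond; apply: eq_integral => s _.
  rewrite !patchE; case: ifPn; rewrite ?notin_setE ?inE => Ds.
    by rewrite mem_set.
  by rewrite memNset.
have mcr : measurable_fun setT (fun s : measurableTypeR R => consrow (s, y)).
  apply: (measurableT_comp (@measurable_consrow R n)).
  exact: measurable_pair2.
have mS : measurable [set s : R | D (consrow (s, y))].
  by have := mcr measurableT _ mD; rewrite setTI.
have [K K0 DK] := bounded_sub_cube bD.
have SK : [set s : R | D (consrow (s, y))] `<=` `[- K, K].
  by move=> s /DK/(_ ord0); rewrite mxE unlift_none/= in_itv/= ler_norml.
rewrite E fineK//; apply: integrable_fin_num => //.
have : lam.-integrable `[- K, K]%classic (EFin \o (fun s : R => f (consrow (s, y)))).
  apply: continuous_compact_integrable; first exact: segment_compact.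
  apply: continuous_subspaceT => s.
  apply: (@continuous_comp _ _ _ (fun s => consrow (s, y)) f); last exact: cf.
  exact: continuous_consrow_l.
move=> iK; apply: integrableS iK => //.
Qed.

(** Fubini's theorem and the fundamental theorem of calculus along the first axis, whose fibres in
    the simplex are the segments from 0 to 1 - sum y. Every integration by parts on an element comes
    from this one. *)
Lemma Rintegral_refsimp_derive n (G G' : 'rV[R]_n.+1 -> R) :
  continuous G' ->
  (forall x, is_derive x (delta_mx ord0 ord0) G (G' x)) ->
  \int[vol R n.+1]_(t in refsimp (n:=n.+1)) G' t =
  \int[vol R n]_(y in refsimp (n:=n))
     (G (consrow (1 - \sum_i y ord0 i, y)) - G (consrow (0, y))).
Proof.
move=> cG' dG.
rewrite Rintegral_vol_consrow//; [|exact: measurable_refsimp|exact: bounded_refsimp].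
rewrite [RHS]Rintegral_mkcond; apply: eq_Rintegral => y _.
rewrite patchE; case: ifPn => [/set_mem Dy|ny]; last first.
  rewrite (_ : [set _ | _] = set0) ?Rintegral_set0//.
  apply/seteqP; split => // s /refsimp_consrow[Dy _].
  by move: ny; rewrite notin_setE.
have -> : [set s | refsimp (consrow (s, y))] = `[0, 1 - \sum_i y ord0 i]%classic.
  apply/seteqP; split => s /=; rewrite in_itv/=; first by move=> /refsimp_consrow[].
  by move=> ?; apply/refsimp_consrow.
set b := 1 - _; have : 0 <= b by rewrite subr_ge0; case: Dy.
rewrite le_eqVlt => /predU1P[<-|b0].
  by rewrite set_itv1 Rintegral_set1 subrr.
pose g s := G (consrow (s, y)).
have dg (s : R) : is_derive s 1 g (G' (consrow (s, y))).
  have [dGs <-] := dG (consrow (s, y)).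
  have E : (fun h : R => h^-1 *: ((g \o shift s) (h *: 1) - g s)) =
      (fun h : R => h^-1 *: ((G \o shift (consrow (s, y))) (h *: delta_mx ord0 ord0) - G (consrow (s, y)))).
    apply/funext => h; congr (_ *: (_ - _)); rewrite /g/=; congr G.
    by rewrite [LHS]consrowE [in RHS]consrowE scalerDl addrA -[h%:A]/(h * 1) mulr1.
  split; last by rewrite /derive E.
  by rewrite /derivable E.
rewrite /Rintegral (@continuous_FTC2 R (fun s => G' (consrow (s, y))) g 0 b)//.
- apply: continuous_subspaceT => s.
  apply: (@continuous_comp _ _ _ (fun s => consrow (s, y)) G'); last exact: cG'.
  exact: continuous_consrow_l.
- have cg : continuous g.
    by move=> s; apply/differentiable_continuous/derivable1_diffP; case: (dg s).
  split.
  + by move=> s _; case: (dg s).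
  + by apply: cvg_at_right_filter; exact: cg.
  + by apply: cvg_at_left_filter; exact: cg.
- by move=> s _; rewrite derive1E; case: (dg s).
Qed.

End reference_simplex.

(** * Polynomials and C^1 functions *)

Notation deg_le k p := (mpoly.msize p <= k.+1)%N.

Section polynomial_degree.
Context (R : realType) (d : nat).
Implicit Types (p q : mpoly.mpoly d R) (i : 'I_d) (k l : nat).

Lemma deg_le_mul k l p q : deg_le k p -> deg_le l q -> deg_le (k + l) (p * q).
Proof.
move=> pk ql; have [->|p0] := eqVneq p 0; first by rewrite mul0r mpoly.msize0.
have [->|q0] := eqVneq q 0; first by rewrite mulr0 mpoly.msize0.
rewrite mpoly.msizeM// -subn1 leq_subLR add1n -addnS -addSn.
exact: leq_add.
Qed.

Lemma deg_le_sum k (I : Type) (r : seq I) (P : pred I) (F : I -> mpoly.mpoly d R) :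
  (forall j, P j -> deg_le k (F j)) -> deg_le k (\sum_(i <- r | P i) F i).
Proof.
move=> Fk; elim/big_rec: _ => [|i p Pi pk]; first by rewrite mpoly.msize0.
by apply: (leq_trans (mpoly.msizeD_le _ _)); rewrite geq_max Fk.
Qed.

Lemma deg_leD k p q : deg_le k p -> deg_le k q -> deg_le k (p + q).
Proof. by move=> pk qk; apply: (leq_trans (mpoly.msizeD_le _ _)); rewrite geq_max pk. Qed.

Lemma deg_leZ k c p : deg_le k p -> deg_le k (c *: p).
Proof. exact: leq_trans (mpoly.msizeZ_le _ _). Qed.

Lemma deg_leC k c : deg_le k (mpoly.mpolyC d c : mpoly.mpoly d R).
Proof. by rewrite mpoly.mmeasureC; apply: (leq_trans (leq_b1 _)). Qed.

Lemma deg_leX i : deg_le 1 (mpoly.mpolyX R (mpoly.mnm1 i)).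
Proof. by rewrite mpoly.msizeX mpoly.mdeg1. Qed.

Lemma msize_leP k p :
  reflect (forall m, (k <= mpoly.mdeg m)%N -> mpoly.mcoeff m p = 0) (mpoly.msize p <= k)%N.
Proof.
apply: (iffP idP) => [pk m km|H].
  by apply/eqP; rewrite mpoly.mcoeff_eq0 mpoly.msize_mdeg_ge// (leq_trans pk).
rewrite mpoly.msizeE big_seq; elim/big_ind: _ => // [x y xk yk|m mp].
  by rewrite geq_max xk.
by rewrite ltnNge; apply/negP => /H/eqP; rewrite mpoly.mcoeff_eq0 mp.
Qed.

Lemma msize_mderiv k i p : (mpoly.msize p <= k.+1)%N ->
  (mpoly.msize (mpoly.mderiv i p) <= k)%N.
Proof.
move=> /msize_leP pk; apply/msize_leP => m km.
by rewrite mpoly.mcoeff_mderiv pk ?mul0rn// mpoly.mdegD mpoly.mdeg1 addn1.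
Qed.

Lemma deg_le_mderiv k i p : deg_le k p -> deg_le k (mpoly.mderiv i p).
Proof. by move=> pk; apply: leqW; exact: msize_mderiv. Qed.

Lemma mderiv_eq0 p : (forall i, mpoly.mderiv i p = 0) ->
  exists c, p = mpoly.mpolyC d c.
Proof.
move=> p0; exists (mpoly.mcoeff mpoly.mnm0 p); apply: mpoly.msize1_polyC.
apply/msize_leP => m; rewrite lt0n mpoly.mdegE sum_nat_eq0 negb_forall.
move=> /existsP[i /=]; rewrite -lt0n => mi.
have := congr1 (mpoly.mcoeff (mpoly.mnm_sub m (mpoly.mnm1 i))) (p0 i).
rewrite mpoly.mcoeff_mderiv mpoly.mcoeff0 mpoly.submK; last first.
  by apply/mpoly.mnm_lepP => j; rewrite mpoly.mnm1E; case: eqP => // <-.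
by move=> /eqP; rewrite mulrn_eq0/= => /eqP.
Qed.

End polynomial_degree.

Section C1_functions.
Context (R : realType) (d : nat).
Implicit Types (f g : 'rV[R]_d -> R) (p q : mpoly.mpoly d R) (x v : 'rV[R]_d).

Definition C1 f := (forall x, differentiable f x) /\ forall i : 'I_d, continuous (partial i f).

Lemma dotrC x v : dotr x v = dotr v x.
Proof. by apply: eq_bigr => i _; rewrite mulrC. Qed.

Lemma dotrDl u v x : dotr (u + v) x = dotr u x + dotr v x :> R.
Proof. by rewrite -big_split/=; apply: eq_bigr => i _; rewrite mxE mulrDl. Qed.

Lemma dotrZl c v x : dotr (c *: v) x = c * dotr v x :> R.
Proof. by rewrite mulr_sumr; apply: eq_bigr => i _; rewrite mxE mulrA. Qed.

Lemma dotrDr u v x : dotr x (u + v) = dotr x u + dotr x v :> R.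
Proof. by rewrite !(dotrC x) dotrDl. Qed.

Lemma dotrZr c v x : dotr x (c *: v) = c * dotr x v :> R.
Proof. by rewrite !(dotrC x) dotrZl. Qed.

Lemma dotr0l x : dotr 0 x = 0 :> R.
Proof. by apply: big1 => i _; rewrite mxE mul0r. Qed.

Lemma dotr0r x : dotr x 0 = 0 :> R.
Proof. by rewrite dotrC dotr0l. Qed.

Lemma dotrNl v x : dotr (- v) x = - dotr v x :> R.
Proof. by rewrite -scaleN1r dotrZl mulN1r. Qed.

Lemma dotrBl u v x : dotr (u - v) x = dotr u x - dotr v x :> R.
Proof. by rewrite dotrDl dotrNl. Qed.

Lemma dotrBr u v x : dotr x (u - v) = dotr x u - dotr x v :> R.
Proof. by rewrite !(dotrC x) dotrBl. Qed.

Lemma dotr_suml (I : Type) (r : seq I) (P : pred I) (F : I -> 'rV[R]_d) x :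
  dotr (\sum_(i <- r | P i) F i) x = \sum_(i <- r | P i) dotr (F i) x.
Proof.
apply: (big_morph (fun u => dotr u x)) => [u v|]; first exact: dotrDl.
exact: dotr0l.
Qed.

Lemma dotr_delta i x : dotr (delta_mx ord0 i) x = x ord0 i.
Proof.
rewrite /dotr (bigD1 i)//= mxE !eqxx mul1r big1 ?addr0// => j ji.
by rewrite mxE (negbTE ji) andbF mul0r.
Qed.

Lemma C1_continuous f : C1 f -> continuous f.
Proof. by move=> [df _] x; exact: differentiable_continuous. Qed.

Lemma differentiable_is_derive f x v : differentiable f x ->
  is_derive x v f (dotr v (grad f x)).
Proof.
move=> df; apply: DeriveDef; first exact: diff_derivable.
rewrite deriveE// [in LHS](row_sum_delta v) linear_sum; apply: eq_bigr => i _.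
by rewrite linearZ mxE/= /partial deriveE// (ord1 0).
Qed.

Lemma C1_is_derive f x v : C1 f -> is_derive x v f (dotr v (grad f x)).
Proof. by move=> [df _]; exact: differentiable_is_derive. Qed.

Lemma continuous_grad f v : C1 f -> continuous (fun x => dotr v (grad f x)).
Proof.
move=> [_ cf]; apply: continuous_big_sum => i _.
apply: continuous_mul; first exact: continuous_const.
by under eq_fun do rewrite mxE; exact: cf.
Qed.

Lemma partialM f g i x : differentiable f x -> differentiable g x ->
  partial i (fun y => f y * g y) x = f x * partial i g x + g x * partial i f x.
Proof.
move=> df dg; rewrite /partial.
rewrite -[X in 'D__ X _]/(f * g) deriveM//; exact: diff_derivable.
Qed.

Lemma gradM f g x : differentiable f x -> differentiable g x ->
  grad (fun y => f y * g y) x = f x *: grad g x + g x *: grad f x.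
Proof. by move=> df dg; apply/rowP => i; rewrite !mxE partialM. Qed.

Lemma C1M f g : C1 f -> C1 g -> C1 (fun x => f x * g x).
Proof.
move=> Cf Cg; split=> [x|i].
  by have [df _] := Cf; have [dg _] := Cg; exact: (@differentiableM _ _ f g).
rewrite (_ : partial i _ = fun x => f x * partial i g x + g x * partial i f x).
  apply: continuous_add; apply: continuous_mul; try exact: C1_continuous.
    by case: Cg.
  by case: Cf.
by apply/funext => x; rewrite partialM//; [case: Cf|case: Cg].
Qed.

Lemma smooth_C1 f : smooth f -> C1 f.
Proof.
move=> sf; split; first exact: (sf [::]).
by move=> i x; apply: differentiable_continuous; exact: (sf [:: i]).
Qed.

Lemma pevalD p q x : peval (p + q) x = peval p x + peval q x.
Proof. exact: mpoly.mevalD. Qed.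
Lemma pevalB p q x : peval (p - q) x = peval p x - peval q x.
Proof. exact: mpoly.mevalB. Qed.
Lemma pevalM p q x : peval (p * q) x = peval p x * peval q x.
Proof. exact: mpoly.mevalM. Qed.
Lemma pevalZ c p x : peval (c *: p) x = c * peval p x.
Proof. exact: mpoly.mevalZ. Qed.
Lemma pevalC c x : peval (mpoly.mpolyC d c) x = c.
Proof. exact: mpoly.mevalC. Qed.
Lemma pevalX i x : peval (mpoly.mpolyX R (mpoly.mnm1 i)) x = x ord0 i.
Proof. exact: mpoly.mevalXU. Qed.
Lemma peval0 x : peval (0 : mpoly.mpoly d R) x = 0.
Proof. exact: mpoly.meval0. Qed.
Lemma peval_sum (I : Type) (r : seq I) (P : pred I) (F : I -> mpoly.mpoly d R) x :
  peval (\sum_(i <- r | P i) F i) x = \sum_(i <- r | P i) peval (F i) x.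
Proof.
apply: (big_morph (fun p => peval p x)) => [p q|]; first exact: pevalD.
exact: peval0.
Qed.

(** Differentiability and agreement of the formal with the analytic derivative are proved jointly,
    so that they pass through products and hence to monomials. *)
Let good p := (forall x, differentiable (peval p) x) /\
  forall i x, partial i (peval p) x = peval (mpoly.mderiv i p) x.

Let goodC c : good (mpoly.mpolyC d c).
Proof.
have E : peval (mpoly.mpolyC d c) = cst c by apply/funext => x; rewrite pevalC.
split=> [x|i x]; first by rewrite E; exact: differentiable_cst.
by rewrite /partial E derive_cst mpoly.mderivC peval0.
Qed.

Let goodX i : good (mpoly.mpolyX R (mpoly.mnm1 i)).
Proof.
have E : peval (mpoly.mpolyX R (mpoly.mnm1 i)) = fun x => x ord0 i.
  by apply/funext => x; rewrite pevalX.
split=> [x|j x]; first by rewrite E; exact: differentiable_coord.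
rewrite /partial E; apply/esym; rewrite mpoly.mderivX pevalZ mpoly.mnm1E.
rewrite -[RHS]/('D_(delta_mx ord0 j) (fun x : 'rV[R]_d => x ord0 i) x).
have : is_derive x (delta_mx ord0 j) (fun x : 'rV[R]_d => x ord0 i) (i == j)%:R.
  apply: DeriveDef; first exact/diff_derivable/differentiable_coord.
  rewrite /derive; apply/cvg_lim => //; apply: cvg_near_cst.
  near=> h; rewrite /= !mxE eqxx/= addrK eq_sym.
  have h0 : h != 0 by near: h; exact: nbhs_dnbhs_neq.
  by rewrite -[_ *: _]/(_ * _) mulrA mulVf// mul1r.
move=> [_ ->]; case: eqP => [->|_]; last by rewrite mul0r.
rewrite (_ : mpoly.mnm_sub _ _ = mpoly.mnm0).
  by rewrite mul1r /peval mpoly.mpolyX0 mpoly.meval1.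
by apply/mpoly.mnmP => k; rewrite mpoly.mnmBE subnn mpoly.mnm0E.
Unshelve. all: by end_near. Qed.

Let goodD p q : good p -> good q -> good (p + q).
Proof.
move=> [dp Dp] [dq Dq].
have E : peval (p + q) = (fun x => peval p x + peval q x).
  by apply/funext => x; rewrite pevalD.
split=> [x|i x]; first by rewrite E; exact: differentiableD.
rewrite mpoly.mderivD pevalD -Dp -Dq /partial E.
by rewrite [LHS]deriveD//; exact: diff_derivable.
Qed.

Let goodM p q : good p -> good q -> good (p * q).
Proof.
move=> [dp Dp] [dq Dq].
have E : peval (p * q) = (fun x => peval p x * peval q x).
  by apply/funext => x; rewrite pevalM.
split=> [x|i x]; first by rewrite E; exact: differentiableM.
by rewrite mpoly.mderivM pevalD !pevalM -Dp -Dq E partialM// addrC mulrC.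
Qed.

Let goodP p : good p.
Proof.
have goodXm m : good (mpoly.mpolyX R m).
  rewrite mpoly.mpolyXE_id; elim/big_ind: _ => //.
    by rewrite -mpoly.mpolyC1; exact: goodC.
  move=> i _; elim: (mpoly.fun_of_multinom m i) => [|k IH].
    by rewrite expr0 -mpoly.mpolyC1; exact: goodC.
  by rewrite exprS; exact: goodM.
elim/mpoly.mpolyind: p => [|c m p _ _ IH].
  by rewrite -(mpoly.mpolyC0 d R); exact: goodC.
by apply: goodD => //; rewrite -mpoly.mul_mpolyC; apply: goodM.
Qed.

Lemma partial_peval i p : partial i (peval p) = peval (mpoly.mderiv i p).
Proof. by apply/funext => x; have [_ ->] := goodP p. Qed.

Lemma differentiable_peval p x : differentiable (peval p) x.
Proof. by have [] := goodP p. Qed.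

Lemma continuous_peval p : continuous (peval p).
Proof. by move=> x; apply: differentiable_continuous; exact: differentiable_peval. Qed.

Lemma C1_peval p : C1 (peval p).
Proof.
split; first exact: differentiable_peval.
by move=> i; rewrite partial_peval; exact: continuous_peval.
Qed.

(** Induction on the degree: the partial derivatives vanish on [U] too, hence identically, and the
    polynomial is a constant. *)
Lemma peval_open_eq0 (U : set 'rV[R]_d) p : open U -> U !=set0 ->
  (forall x, U x -> peval p x = 0) -> p = 0.
Proof.
move=> oU [x0 Ux0].
have [k] : exists k, (mpoly.msize p <= k)%N by exists (mpoly.msize p).
elim: k p => [|k IH] p pk Up.
  by apply/eqP; rewrite -mpoly.msize_poly_eq0 -leqn0.
have [c pc] : exists c, p = mpoly.mpolyC d c.
  apply: mderiv_eq0 => i; apply: IH; first exact: msize_mderiv.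
  move=> x Ux; rewrite -partial_peval /partial.
  rewrite (@near_eq_derive _ _ _ _ (cst 0)) ?derive_cst//.
  by near=> y; rewrite Up//; near: y; exact: open_nbhs_nbhs.
by have := Up _ Ux0; rewrite pc pevalC => ->; rewrite mpoly.mpolyC0.
Unshelve. all: by end_near. Qed.

End C1_functions.

(** * Simplices *)

Section barycentric_coordinates.
Context (R : realType) (d : nat) (Th : mesh R d).
Implicit Types (T F : cell Th) (i j l m : 'I_(nv Th)) (x : 'rV[R]_d).

Definition affine (g : 'rV[R]_d * R) x := dotr g.1 x + g.2.

Lemma affine_comb g (I : finType) (w : I -> R) (p : I -> 'rV[R]_d) :
  \sum_i w i = 1 -> affine g (\sum_i w i *: p i) = \sum_i w i * affine g (p i).
Proof.
move=> w1; rewrite /affine dotrC dotr_suml.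
rewrite [X in _ + X](_ : g.2 = \sum_i w i * g.2); last by rewrite -mulr_suml w1 mul1r.
by rewrite -big_split/=; apply: eq_bigr => i _; rewrite dotrZl dotrC mulrDr.
Qed.

Lemma affineD g x v : affine g (x + v) = affine g x + dotr g.1 v.
Proof. by rewrite /affine dotrDr addrAC. Qed.

(** The coordinates are indexed by all vertices of the mesh and are zero off [T], so that sums run
    over one index type for all elements. *)
Definition is_bary T (L : 'I_(nv Th) -> 'rV[R]_d * R) : Prop :=
  [/\ forall i, i \notin T -> L i = 0, forall x, \sum_i affine (L i) x = 1,
      forall x, \sum_i affine (L i) x *: vert i = x &
      forall i j, i \in T -> j \in T -> affine (L i) (vert j) = (i == j)%:R].

Lemma bary_exists T : Defs.nondegenerate T -> exists L, is_bary T L.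
Proof.
move=> [cT nd].
pose e (k : 'I_(1 + d)) := enum_val (cast_ord (esym cT) k).
have e_inj : injective e by move=> k k' /enum_val_inj/cast_ord_inj.
have eT k : e k \in T by exact: enum_valP.
have e_surj i : i \in T -> exists k, e k = i.
  move=> iT; exists (cast_ord cT (enum_rank_in iT i)).
  by rewrite /e cast_ordK enum_rankK_in.
(* The rows of [N] are the vectors (1, a_k). They are independent by nondegeneracy, and the
   coordinates of x are the entries of (1, x) times the inverse of [N]; [sel] extends them by zero
   to all vertices. *)
pose N : 'M[R]_(1 + d) := \matrix_k row_mx (const_mx 1 : 'rV_1) (vert (e k)).
pose sel (v : 'I_(1 + d) -> R) i := \sum_k (e k == i)%:R * v k.
have selE v k : sel v (e k) = v k.
  rewrite /sel (bigD1 k)//= eqxx mul1r big1 ?addr0// => k' k'k.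
  by rewrite (inj_eq e_inj) (negbTE k'k) mul0r.
have sel0 v i : i \notin T -> sel v i = 0.
  move=> iT; apply: big1 => k _; case: eqP => [ki|_]; last by rewrite mul0r.
  by move: iT; rewrite -ki eT.
have sel_sum v : \sum_i sel v i = \sum_k v k.
  rewrite exchange_big/=; apply: eq_bigr => k _.
  by rewrite (bigD1 (e k))//= eqxx mul1r big1 ?addr0// => i /negbTE; rewrite eq_sym => ->; rewrite mul0r.
have sel_vert v : \sum_i sel v i *: vert i = \sum_k v k *: vert (e k) :> 'rV[R]_d.
  under eq_bigr do rewrite scaler_suml.
  rewrite exchange_big/=; apply: eq_bigr => k _.
  rewrite (bigD1 (e k))//= eqxx mul1r big1 ?addr0// => i /negbTE.
  by rewrite eq_sym => ->; rewrite mul0r scale0r.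
have mulN (v : 'rV[R]_(1 + d)) : v *m N =
    row_mx (const_mx (\sum_k v ord0 k)) (\sum_k v ord0 k *: vert (e k)).
  rewrite mulmx_sum_row; apply/rowP => j; rewrite summxE mxE.
  case: splitP => j' jj'; rewrite ?mxE ?summxE; apply: eq_bigr => k _; rewrite !mxE;
    case: splitP => j'' ; rewrite jj'.
  - by rewrite mxE mulr1.
  - by move=> E; have := ltn_ord j'; rewrite E ltnNge leq_addr.
  - by move=> E; have := ltn_ord j''; rewrite -E ltnNge leq_addr.
  - by move=> /addnI E; rewrite (val_inj E).
have uN : N \in unitmx.
  rewrite -row_free_unit; apply: inj_row_free => v; rewrite mulN => vN.
  have [/rowP/(_ ord0)] := eq_row_mx (etrans vN (esym (row_mx0 _ 1 1 d))).
  rewrite !mxE => v1 v2.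
  apply/rowP => k; rewrite mxE -(selE (v ord0)); apply: nd.
  - exact: sel0.
  - by rewrite sel_sum.
  - by rewrite sel_vert.
pose mu x := row_mx (const_mx 1 : 'rV_1) x *m invmx N.
exists (fun i => (\row_j sel (fun k => invmx N (rshift 1 j) k) i,
                  sel (fun k => invmx N (lshift d ord0) k) i)).
have aE i x : affine (\row_j sel (fun k => invmx N (rshift 1 j) k) i,
    sel (fun k => invmx N (lshift d ord0) k) i) x = sel (mu x ord0) i.
  rewrite /affine /dotr/= /sel; under eq_bigr do rewrite mxE mulr_suml.
  rewrite exchange_big/= -big_split/=; apply: eq_bigr => k _.
  rewrite /mu mxE big_split_ord/= big_ord1 mulrDr addrC; congr (_ + _).
    by rewrite row_mxEl mxE mul1r.
  rewrite mulr_sumr; apply: eq_bigr => j _.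
  by rewrite row_mxEr -mulrA; congr (_ * _); rewrite mulrC.
have muN x : mu x *m N = row_mx (const_mx 1 : 'rV_1) x by rewrite mulmxKV.
have muE x : \sum_k mu x ord0 k = 1 /\ \sum_k mu x ord0 k *: vert (e k) = x.
  have := muN x; rewrite mulN => /eq_row_mx[/rowP/(_ ord0)].
  by rewrite !mxE => -> ->.
split.
- move=> i iT; congr pair; last exact: sel0.
  by apply/rowP => j; rewrite !mxE sel0.
- by move=> x; under eq_bigr do rewrite aE; rewrite sel_sum; case: (muE x).
- by move=> x; under eq_bigr do rewrite aE; rewrite sel_vert; case: (muE x).
move=> i j /e_surj[k <-] /e_surj[k' <-]; rewrite aE selE (inj_eq e_inj).
suff -> : mu (vert (e k')) = row k' 1%:M by rewrite !mxE eq_sym.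
rewrite /mu; have -> : row_mx (const_mx 1 : 'rV_1) (vert (e k')) = row k' N by rewrite rowK.
by rewrite -row_mul mulmxV.
Qed.

Definition bary T : 'I_(nv Th) -> 'rV[R]_d * R := xget (fun=> 0) [set L | is_bary T L].

Lemma baryP T : Defs.nondegenerate T -> is_bary T (bary T).
Proof. by move=> /bary_exists[L HL]; exact: (@xgetPex _ _ [set L | is_bary T L] (ex_intro _ L HL)). Qed.

Definition lam T i x := affine (bary T i) x.
Definition lamg T i : 'rV[R]_d := (bary T i).1.
Definition lamp T i : mpoly.mpoly d R :=
  \sum_k lamg T i ord0 k *: mpoly.mpolyX R (mpoly.mnm1 k) + mpoly.mpolyC d (bary T i).2.

Lemma lamD T i x v : lam T i (x + v) = lam T i x + dotr (lamg T i) v.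
Proof. exact: affineD. Qed.

Lemma peval_lamp T i x : peval (lamp T i) x = lam T i x.
Proof.
rewrite pevalD pevalC peval_sum /lam /affine; congr (_ + _).
by apply: eq_bigr => k _; rewrite pevalZ pevalX.
Qed.

Lemma deg_lamp T i : deg_le 1 (lamp T i).
Proof.
apply: deg_leD; last exact: deg_leC.
by apply: deg_le_sum => k _; apply: deg_leZ; exact: deg_leX.
Qed.

Lemma mderiv_lamp T i k : mpoly.mderiv k (lamp T i) = mpoly.mpolyC d (lamg T i ord0 k).
Proof.
rewrite mpoly.mderivD mpoly.mderivC addr0 linear_sum/= (bigD1 k)//= big1 => [|j jk].
  rewrite mpoly.mderivZ mpoly.mderivX mpoly.mnm1E eqxx scale1r addr0.
  rewrite (_ : mpoly.mnm_sub _ _ = mpoly.mnm0).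
    by rewrite mpoly.mpolyX0 -mpoly.mul_mpolyC mulr1.
  by apply/mpoly.mnmP => j; rewrite mpoly.mnmBE subnn mpoly.mnm0E.
by rewrite mpoly.mderivZ mpoly.mderivX mpoly.mnm1E (negbTE jk) scale0r scaler0.
Qed.

Lemma grad_lam T i x : grad (lam T i) x = lamg T i.
Proof.
rewrite (_ : lam T i = peval (lamp T i)); last by apply/funext => y; rewrite peval_lamp.
by apply/rowP => k; rewrite mxE partial_peval mderiv_lamp pevalC.
Qed.

Lemma C1_lam T i : C1 (lam T i).
Proof.
rewrite (_ : lam T i = peval (lamp T i)); last by apply/funext => y; rewrite peval_lamp.
exact: C1_peval.
Qed.

Section one_cell.
Variable T : cell Th.
Hypothesis nT : Defs.nondegenerate T.

Lemma lam_notin i x : i \notin T -> lam T i x = 0.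
Proof.
move=> iT; have [b0 _ _ _] := baryP nT.
by rewrite /lam b0// /affine dotr0l addr0.
Qed.

Lemma lamg_notin i : i \notin T -> lamg T i = 0.
Proof. by move=> iT; have [b0 _ _ _] := baryP nT; rewrite /lamg b0. Qed.

Lemma lam_sum x : \sum_i lam T i x = 1.
Proof. by have [_ + _ _] := baryP nT; exact. Qed.

Lemma lam_vert_sum x : \sum_i lam T i x *: vert i = x.
Proof. by have [_ _ + _] := baryP nT; exact. Qed.

Lemma lam_vert i j : i \in T -> j \in T -> lam T i (vert j) = (i == j)%:R.
Proof. by have [_ _ _ +] := baryP nT; exact. Qed.

Lemma lamg_sum : \sum_i lamg T i = 0.
Proof.
apply/rowP => k; rewrite mxE -dotr_delta dotrC dotr_suml.
have := lam_sum (0 + delta_mx ord0 k); under eq_bigr do rewrite lamD.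
by rewrite big_split/= lam_sum => /(canRL (addKr _)) ->; rewrite addNr.
Qed.

Lemma lamg_vert_sum v : \sum_i dotr (lamg T i) v *: vert i = v.
Proof.
have := lam_vert_sum (0 + v); under eq_bigr do rewrite lamD scalerDl.
by rewrite big_split/= lam_vert_sum !add0r.
Qed.

Lemma lam_comb i (w : 'I_(nv Th) -> R) : i \in T ->
  (forall j, j \notin T -> w j = 0) -> \sum_j w j = 1 ->
  lam T i (\sum_j w j *: vert j) = w i.
Proof.
move=> iT w0 w1; rewrite /lam affine_comb// (bigD1 i)//= -/(lam T i _) lam_vert// eqxx mulr1.
rewrite big1 ?addr0// => j ji; have [jT|jT] := boolP (j \in T).
  by rewrite -/(lam T i _) lam_vert// eq_sym (negbTE ji) mulr0.
by rewrite w0// mul0r.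
Qed.

Lemma hullE F : F \subset T ->
  hull F = [set x | (forall i, 0 <= lam T i x) /\ forall i, i \notin F -> lam T i x = 0].
Proof.
move=> FT; apply/seteqP; split => x /=.
  move=> [w [w0 wF w1 ->]].
  have wT j : j \notin T -> w j = 0.
    by move=> jT; apply: wF; apply: contra jT; apply/fintype.subsetP.
  have E i : lam T i (\sum_i w i *: vert i) = w i.
    have [iT|iT] := boolP (i \in T); first exact: lam_comb.
    by rewrite lam_notin// wT.
  by split => [i|i iF]; rewrite E//; exact: wF.
move=> [l0 lF]; exists (fun i => lam T i x); split => //; first exact: lam_sum.
by rewrite lam_vert_sum.
Qed.

Lemma hull_cellE : hull T = [set x | forall i, 0 <= lam T i x].
Proof.
rewrite (hullE (fintype.subxx _)); apply/seteqP; split => x /=; first by case.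
by move=> H; split => // i; exact: lam_notin.
Qed.

Lemma hull_vert i : i \in T -> hull T (vert i).
Proof.
move=> iT; rewrite hull_cellE => j /=; have [jT|jT] := boolP (j \in T).
  by rewrite lam_vert// ler0n.
by rewrite lam_notin.
Qed.

End one_cell.

End barycentric_coordinates.

(** * Affine charts of an element *)

Section chart.
Context (R : realType) (d : nat) (a : 'rV[R]_d) (y : 'I_d -> 'rV[R]_d).

Definition chartM : 'M[R]_d := \matrix_j (y j - a).
Definition chart (t : 'rV[R]_d) : 'rV[R]_d := a + t *m chartM.

Lemma chartE t : chart t = a + \sum_j t ord0 j *: (y j - a).
Proof. by rewrite /chart mulmx_sum_row; under eq_bigr do rewrite rowK. Qed.

End chart.

Lemma consrowS (R : realType) n (s : R) (y : 'rV[R]_n) i :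
  consrow (s, y) ord0 (lift ord0 i) = y ord0 i.
Proof. by rewrite mxE liftK. Qed.

Section refsimp_volume.
Context (R : realType) (d : nat).

Definition refvol : R := fine (vol R d (refsimp (n:=d))).

Lemma refvol_fin : vol R d (refsimp (n:=d)) = refvol%:E.
Proof.
rewrite fineK// ge0_fin_numE; last exact: measure_ge0.
by apply: vol_bounded; [exact: measurable_refsimp|exact: bounded_refsimp].
Qed.

Lemma refvol_gt0 : (0 < d)%N -> 0 < refvol.
Proof.
(* The cube with edges 1 / d and a corner at the origin fits into the simplex. *)
move=> d0; pose c : R := (2 * d%:R)^-1.
have c0 : 0 < c by rewrite invr_gt0 mulr_gt0// ltr0n.
rewrite -lte_fin -refvol_fin.
apply: (@lt_le_trans _ _ (vol R d ((fun x => x + - const_mx c) @^-1` cube d c))).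
  rewrite vol_translation; last exact: measurable_cube.
  by rewrite vol_cube ?ltW// lte_fin exprn_gt0// mulr_gt0.
apply: le_measure; rewrite ?inE.
- rewrite -[X in measurable X]setTI.
  by apply: measurable_translation => //; exact: measurable_cube.
- exact: measurable_refsimp.
move=> x /= Hx.
have Hi i : 0 <= x ord0 i <= 2 * c.
  by have := Hx i; rewrite !mxE ler_norml => /andP[h1 h2]; apply/andP; split; lra.
split=> [i|]; first by case/andP: (Hi i).
apply: (@le_trans _ _ (\sum_(i < d) 2 * c)).
  by apply: ler_sum => i _; case/andP: (Hi i).
have dn : d%:R != 0 :> R by rewrite pnatr_eq0 -lt0n.
by rewrite sumr_const card_ord -mulr_natr /c [leLHS](_ : _ = 1)//; field.
Qed.

End refsimp_volume.

Section cell_integrals.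
Context (R : realType) (n : nat) (Th : mesh R n.+1).
Implicit Types (T F : cell Th) (i l m : 'I_(nv Th)) (x : 'rV[R]_n.+1).
Local Notation rvol := (@refvol R n.+1).

Lemma lam_diff T i (x y : 'rV[R]_n.+1) :
  dotr (lamg T i) (x - y) = lam T i x - lam T i y.
Proof. by rewrite dotrBr /lam /affine opprD addrACA subrr addr0. Qed.

Definition cellvol T : R := fine (vol R n.+1 (hull T)).

Section chart_of_cell.
Variables (T : cell Th) (l : 'I_(nv Th)) (e : 'I_n.+1 -> 'I_(nv Th)).
Hypotheses (nT : Defs.nondegenerate T) (lT : l \in T).
Hypotheses (e_inj : injective e) (eT : forall j, e j \in T :\ l)
  (e_surj : forall i, i \in T :\ l -> exists j, e j = i).

Let A := chart (vert l) (@vert _ _ Th \o e).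

Let eT' j : e j \in T. Proof. by have := eT j; rewrite !inE => /andP[]. Qed.
Let el j : e j != l. Proof. by have := eT j; rewrite !inE => /andP[]. Qed.

Lemma lam_chart j t : lam T (e j) (A t) = t ord0 j.
Proof.
rewrite /A chartE lamD lam_vert// (negbTE (el j)) add0r dotrC dotr_suml.
rewrite (bigD1 j)//= dotrZl dotrC lam_diff !lam_vert// eqxx (negbTE (el j)).
rewrite subr0 mulr1 big1 ?addr0// => k kj.
rewrite dotrZl dotrC lam_diff !lam_vert// (inj_eq e_inj) eq_sym (negbTE kj).
by rewrite (negbTE (el j)) subrr mulr0.
Qed.

Lemma lam_chart_apex t : lam T l (A t) = 1 - \sum_j t ord0 j.
Proof.
rewrite /A chartE lamD lam_vert// eqxx dotrC dotr_suml -sumrN; congr (_ + _).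
apply: eq_bigr => k _; rewrite dotrZl dotrC lam_diff !lam_vert// eqxx eq_sym.
by rewrite (negbTE (el k)) sub0r mulrN1.
Qed.

Lemma chart_unit : chartM (vert l) (@vert _ _ Th \o e) \in unitmx.
Proof.
rewrite -row_free_unit; apply: inj_row_free => v vM; apply/rowP => j.
rewrite -(lam_chart j v) mxE /A /chart vM addr0 lam_vert//.
by rewrite (negbTE (el j)).
Qed.

Lemma chart_hull : A @^-1` hull T = refsimp (n:=n.+1).
Proof.
rewrite hull_cellE//; apply/seteqP; split => t /= H.
  split=> [j|]; first by rewrite -lam_chart.
  by have := H l; rewrite lam_chart_apex subr_ge0.
move=> i; have [iT|iT] := boolP (i \in T); last by rewrite lam_notin.
have [->|il] := eqVneq i l; first by rewrite lam_chart_apex subr_ge0; case: H.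
have [|j <-] := e_surj (i := i); first by rewrite !inE il.
by rewrite lam_chart; case: H.
Qed.

End chart_of_cell.

Lemma measurable_lam_ge0 T i : measurable [set x | 0 <= lam T i x].
Proof.
have := continuous_measurable_rV (C1_continuous (C1_lam T i)).
move=> /(_ measurableT `[0, +oo[%classic); rewrite setTI.
move=> /(_ (measurable_itv _)); congr measurable; apply/funext => x.
by rewrite /preimage/= in_itv/= andbT.
Qed.

Lemma measurable_hull T : Defs.nondegenerate T -> measurable (hull T).
Proof.
move=> nT; rewrite hull_cellE//.
rewrite (_ : [set _ | _] = \bigcap_(i in [set: 'I_(nv Th)]) [set x | 0 <= lam T i x]).
  by apply: fin_bigcap_measurable => [|i _]; [exact: finite_finset|exact: measurable_lam_ge0].
by apply/seteqP; split => x H i; [move=> _; exact: H|exact: H].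
Qed.

Lemma closed_hull T : Defs.nondegenerate T -> closed (hull T).
Proof.
move=> nT; rewrite hull_cellE//.
rewrite (_ : [set _ | _] = \bigcap_(i in [set: 'I_(nv Th)]) [set x | 0 <= lam T i x]).
  apply: closed_bigI => i _.
  apply: (@closed_comp _ _ (lam T i) [set y | 0 <= y]); last exact: closed_ge.
  by move=> x _; exact: C1_continuous (C1_lam T i) x.
by apply/seteqP; split => x H i; [move=> _; exact: H|exact: H].
Qed.

Lemma bounded_hull T : bounded_set (hull T).
Proof.
pose M : R := \sum_(i : 'I_(nv Th)) \sum_j `|vert i ord0 j|.
apply: (sub_bounded (B := cube n.+1 M)); last exact: bounded_cube.
move=> x [w [w0 _ w1 ->]] j; rewrite summxE.
have wle i : w i <= 1 by rewrite -w1 (bigD1 i)//= lerDl sumr_ge0.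
apply: (le_trans (ler_norm_sum _ _ _)); apply: ler_sum => i _.
rewrite mxE normrM (ger0_norm (w0 i)) -[leRHS]mul1r; apply: ler_pM => //.
by rewrite (bigD1 j)//= lerDl sumr_ge0.
Qed.

Lemma integrable_hull T f : Defs.nondegenerate T -> continuous f ->
  (vol R n.+1).-integrable (hull T) (EFin \o f).
Proof.
move=> nT cf; apply: integrable_continuous => //; first exact: measurable_hull.
exact: bounded_hull.
Qed.

(** The vertices of the facet with [m] listed first: in the charts below, the first coordinate is
    then the barycentric coordinate of [m]. *)
Definition facet_enum F m (j : 'I_n.+1) : 'I_(nv Th) := nth m (m :: enum (F :\ m)) j.

Section facet_enumeration.
Variables (F : cell Th) (m : 'I_(nv Th)).
Hypotheses (cF : #|F| = n.+1) (mF : m \in F).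

Let s := m :: enum (F :\ m).
Let size_s : size s = n.+1.
Proof. by move: cF; rewrite /= -cardE (cardsD1 m) mF add1n. Qed.
Let uniq_s : uniq s. Proof. by rewrite /= mem_enum !inE eqxx enum_uniq. Qed.
Let mem_s i : (i \in s) = (i \in F).
Proof. by rewrite inE mem_enum !inE; case: eqP => [->|]//=; rewrite mF. Qed.

Lemma facet_enum_inj : injective (facet_enum F m).
Proof.
by move=> j k /eqP; rewrite nth_uniq ?size_s ?ltn_ord// => /eqP/val_inj.
Qed.

Lemma facet_enum_in j : facet_enum F m j \in F.
Proof. by rewrite -mem_s mem_nth// size_s. Qed.

Lemma facet_enum_surj i : i \in F -> exists j, facet_enum F m j = i.
Proof.
rewrite -mem_s => iS; have iS' : (index i s < n.+1)%N.
  by move: iS; rewrite -index_mem size_s.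
by exists (Ordinal iS'); rewrite /facet_enum nth_index.
Qed.

End facet_enumeration.

Lemma facet_enum0 F m : facet_enum F m ord0 = m.
Proof. by []. Qed.

(** The origin goes to the vertex [l] and the first axis to the edge from [l] to [m]; the hypotenuse
    goes to the facet opposite to [l]. *)
Definition cell_chart T l m : 'rV[R]_n.+1 -> 'rV[R]_n.+1 :=
  chart (vert l) (@vert _ _ Th \o facet_enum (T :\ l) m).

Section fixed_chart.
Variables (T : cell Th) (l m : 'I_(nv Th)).
Hypotheses (nT : Defs.nondegenerate T) (lT : l \in T) (mT : m \in T) (lm : l != m).

Let cF : #|T :\ l| = n.+1.
Proof. by case: nT => + _; rewrite (cardsD1 l) lT add1n => -[]. Qed.
Let mF : m \in T :\ l. Proof. by rewrite !inE eq_sym lm. Qed.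
Let A := cell_chart T l m.

Lemma lam_cell_chart j t : lam T (facet_enum (T :\ l) m j) (A t) = t ord0 j.
Proof. by apply: lam_chart => //; [exact: facet_enum_inj|exact: facet_enum_in]. Qed.

Lemma lam_cell_chart_apex t : lam T l (A t) = 1 - \sum_j t ord0 j.
Proof. by apply: lam_chart_apex => //; exact: facet_enum_in. Qed.

Lemma cell_chart_hull : A @^-1` hull T = refsimp (n:=n.+1).
Proof.
apply: chart_hull => //; [exact: facet_enum_inj|exact: facet_enum_in|].
exact: facet_enum_surj.
Qed.

Lemma cell_chart_unit : chartM (vert l) (@vert _ _ Th \o facet_enum (T :\ l) m) \in unitmx.
Proof.
by apply: (@chart_unit T) => //; [exact: facet_enum_inj|exact: facet_enum_in].
Qed.

Lemma cell_chart_Rintegral : 0 < cellvol T /\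
  forall (D : set 'rV[R]_n.+1) (f : 'rV[R]_n.+1 -> R),
  measurable D -> D `<=` hull T -> continuous f ->
  \int[vol R n.+1]_(x in D) f x =
  cellvol T / rvol * \int[vol R n.+1]_(t in A @^-1` D) f (A t).
Proof.
have [c c0 Hc] := Rintegral_affine (vert l) cell_chart_unit.
have HcD (D : set 'rV[R]_n.+1) (f : 'rV[R]_n.+1 -> R) : measurable D -> D `<=` hull T -> continuous f ->
    \int[vol R n.+1]_(t in A @^-1` D) f (A t) = c * \int[vol R n.+1]_(x in D) f x.
  move=> mD DT cf; apply: Hc => //; first exact: sub_bounded DT (bounded_hull T).
  apply: (sub_bounded (B := refsimp (n:=n.+1))); last exact: bounded_refsimp.
  by rewrite -cell_chart_hull => t; exact: DT.
(* The constant function on the whole element identifies the factor, and shows that the element has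
   positive volume. *)
have := HcD (hull T) (fun=> 1) (measurable_hull nT) (fun x h => h)
  (@continuous_const R _ 1).
rewrite cell_chart_hull Rintegral_cst; last exact: measurable_refsimp.
rewrite Rintegral_cst; last exact: measurable_hull.
rewrite !mul1r -/(refvol R n.+1) -/(cellvol T) => E.
have r0 : 0 < rvol by exact: refvol_gt0.
have v0 : 0 < cellvol T by rewrite -(pmulr_rgt0 _ c0) -E.
split => // D f mD DT cf; rewrite HcD// mulrA -[LHS]mul1r; congr (_ * _).
by rewrite E; field; rewrite !gt_eqF.
Qed.

Lemma Rintegral_hull f : continuous f ->
  \int[vol R n.+1]_(x in hull T) f x =
  cellvol T / rvol * \int[vol R n.+1]_(t in refsimp (n:=n.+1)) f (A t).
Proof.
move=> cf; have [_ H] := cell_chart_Rintegral; rewrite H//; last exact: measurable_hull.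
by rewrite cell_chart_hull.
Qed.

(** The two boundary terms live on the facet opposite to [l] (the hypotenuse) and on the facet
    opposite to [m] (first coordinate zero). *)
Lemma Rintegral_hull_edge f : C1 f ->
  \int[vol R n.+1]_(x in hull T) dotr (vert m - vert l) (grad f x) =
  cellvol T / rvol * \int[vol R n]_(y in refsimp (n:=n))
    (f (A (consrow (1 - \sum_i y ord0 i, y))) - f (A (consrow (0, y)))).
Proof.
move=> Cf; rewrite Rintegral_hull; last exact: continuous_grad.
congr (_ * _).
have cA : continuous A by exact: continuous_affine.
apply: (Rintegral_refsimp_derive (G := f \o A)).
  move=> t; apply: (continuous_comp (g := fun x => dotr (vert m - vert l) (grad f x))).
    exact: cA.
  exact: continuous_grad.
move=> t; have [df dfE] := C1_is_derive (A t) (vert m - vert l) Cf.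
have E : (fun h : R => h^-1 *: (((f \o A) \o shift t) (h *: delta_mx ord0 ord0) - (f \o A) t)) =
    (fun h : R => h^-1 *: ((f \o shift (A t)) (h *: (vert m - vert l)) - f (A t))).
  apply/funext => h; congr (_ *: (_ - _)); rewrite /=; congr f.
  rewrite /A /cell_chart /chart mulmxDl -scalemxAl -rowE rowK addrCA; congr (_ + _).
split; last by rewrite /derive E.
by rewrite /derivable E.
Qed.

Lemma cell_chart_hypotenuse (y : 'rV[R]_n) :
  A (consrow (1 - \sum_i y ord0 i, y)) =
  (1 - \sum_i y ord0 i) *: vert m +
  \sum_i y ord0 i *: vert (facet_enum (T :\ l) m (lift ord0 i)).
Proof.
rewrite /A /cell_chart chartE big_ord_recl mxE unlift_none /=.
under [X in _ + (_ + X)]eq_bigr do rewrite consrowS scalerBr.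
rewrite sumrB -scaler_suml facet_enum0.
by apply/rowP => j; rewrite !mxE; ring.
Qed.

End fixed_chart.

End cell_integrals.

Section positivity.
Context (R : realType) (d : nat).

Lemma Rintegral_eq0_open (D U : set 'rV[R]_d) (f : 'rV[R]_d -> R) :
  measurable D -> bounded_set D -> open U -> U `<=` D -> continuous f ->
  (forall x, D x -> 0 <= f x) -> \int[vol R d]_(x in D) f x = 0 ->
  forall x, U x -> f x = 0.
Proof.
move=> mD bD oU UD cf f0 If0 x0 Ux0.
apply/eqP; apply: contraT => fx0_neq0.
have fx0 : 0 < f x0 by rewrite lt_def fx0_neq0 f0//; exact: UD.
have /nbhs_ballP[r /= r0 Hr] : nbhs x0 (U `&` [set x | f x0 / 2 < f x]).
  apply: filterI; first exact: open_nbhs_nbhs.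
  have : f x0 / 2 < f x0 by rewrite ltr_pdivrMr// ltr_pMr// ltr1n.
  by move=> /lt_nbhsr; exact: cf.
(* A small cube around [x0] on which [f] exceeds half of its value at [x0]; it would contribute a
   positive amount to the integral. *)
pose B := (fun x => x + - x0) @^-1` cube d (r / 2).
have mB : measurable B.
  rewrite -[X in measurable X]setTI.
  by apply: measurable_translation => //; exact: measurable_cube.
have Bball : B `<=` ball x0 r.
  move=> x Bx; apply/rV_ballE => // i; have := Bx i.
  rewrite !mxE distrC => /le_lt_trans; apply.
  by rewrite ltr_pdivrMr// ltr_pMr// ltr1n.
have BD : B `<=` D by move=> x /Bball/Hr[/UD].
have iD := integrable_continuous cf mD bD.
have volB : vol R d B = ((2 * (r / 2)) ^+ d)%:E.
  rewrite /B vol_translation ?vol_cube ?divr_ge0 ?ltW//; exact: measurable_cube.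
have vB : 0 < fine (vol R d B).
  by rewrite volB/= exprn_gt0// mulr_gt0// divr_gt0.
have iB := integrableS mD mB BD iD.
have mDB : measurable (D `\` B) by exact: measurableD.
have IE : \int[vol R d]_(x in D) f x =
    \int[vol R d]_(x in B) f x + \int[vol R d]_(x in D `\` B) f x.
  rewrite -{1}(setDUK BD) Rintegral_setU// ?setDUK//.
  by apply/disj_setPS => x [Bx []].
have IDB : 0 <= \int[vol R d]_(x in D `\` B) f x by apply: Rintegral_ge0 => x [/f0].
have IB : f x0 / 2 * fine (vol R d B) <= \int[vol R d]_(x in B) f x.
  rewrite -Rintegral_cst//; apply: le_Rintegral => //.
    apply: integrable_continuous => //; first exact: continuous_const.
    exact: sub_bounded bD.
  by move=> x /Bball/Hr[_ /ltW].
have : 0 < f x0 / 2 * fine (vol R d B) by rewrite mulr_gt0// divr_gt0.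
by have := If0; rewrite IE; lra.
Qed.

Lemma Rintegral_sqr_eq0 (D U : set 'rV[R]_d) (p : mpoly.mpoly d R) :
  measurable D -> bounded_set D -> open U -> U !=set0 -> U `<=` D ->
  \int[vol R d]_(x in D) (peval p x * peval p x) = 0 -> p = 0.
Proof.
move=> mD bD oU U0 UD Ip0; apply: (peval_open_eq0 oU U0) => x Ux; apply/eqP.
rewrite -sqrf_eq0 expr2; apply/eqP; move: x Ux.
apply: (@Rintegral_eq0_open D U (fun x => peval p x * peval p x)) => //.
  by apply: continuous_mul; exact: continuous_peval.
by move=> x _; rewrite -expr2 sqr_ge0.
Qed.

End positivity.

Section shear.
Context (R : realType) (n : nat).
Local Notation lam := (@lebesgue_measure R).

(** The one determinant that has to be known: charts of two neighbouring elements differ by such a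
    map, see [cellvol_neighbour]. *)
Lemma vol_shear (N : 'M[R]_n.+1) (S : set 'rV[R]_n.+1) :
  (forall j : 'I_n, row (lift ord0 j) N = delta_mx ord0 (lift ord0 j)) ->
  N ord0 ord0 != 0 -> measurable S ->
  vol R n.+1 ((fun x => x *m N) @^-1` S) = (`|N ord0 ord0|^-1%:E * vol R n.+1 S)%E.
Proof.
set a := N ord0 ord0 => Nj a0 mS.
pose b : 'rV[R]_n := \row_j N ord0 (lift ord0 j).
have mulN (s : R) (y : 'rV[R]_n) :
    consrow (s, y) *m N = consrow (s * a, y + s *: b).
  rewrite mulmx_sum_row big_ord_recl; apply/rowP => i; rewrite !mxE unlift_none summxE.
  under eq_bigr do rewrite Nj mxE consrowS mxE eqxx/=.
  have [k ->|->] := unliftP ord0 i; rewrite /= ?mxE.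
    rewrite (bigD1 k)//= eqxx mulr1 big1 => [|j jk]; first by rewrite addr0 addrC.
    by rewrite (inj_eq lift_inj) eq_sym (negbTE jk) mulr0.
  by rewrite big1 ?addr0// => j _; rewrite mulr0.
have uN : N \in unitmx.
  rewrite -row_free_unit; apply: inj_row_free => v vN.
  pose s := v ord0 ord0; pose y : 'rV[R]_n := \row_j v ord0 (lift ord0 j).
  have vE : v = consrow (s, y).
    apply/rowP => i; rewrite mxE; have [k ->|->] := unliftP ord0 i => //=.
    by rewrite mxE.
  move: vN; rewrite vE mulN => vN.
  have s0 : s = 0.
    have /rowP/(_ ord0) := vN; rewrite !mxE unlift_none/= => /eqP.
    by rewrite mulf_eq0 (negbTE a0) orbF => /eqP.
  apply/rowP => i; rewrite !mxE; have [k _|_] := unliftP ord0 i => //=.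
  have /rowP/(_ (lift ord0 k)) := vN; rewrite s0 scale0r addr0 !mxE liftK/=.
  by rewrite /y mxE.
have [c c0 Hc] := vol_mulmx uN.
rewrite Hc//; congr (_ * _)%E; congr (_%:E).
(* The factor of [vol_mulmx] is identified on a single set: [P] is a box, the preimage of its
   sheared image [S0], and both volumes follow from Fubini's theorem. *)
pose P := [set x : 'rV[R]_n.+1 | 0 <= x ord0 ord0 * a <= 1 /\
  forall j, `|x ord0 (lift ord0 j)| <= 1].
pose S0 := [set x : 'rV[R]_n.+1 | 0 <= x ord0 ord0 <= 1 /\
  forall j, `|x ord0 (lift ord0 j) - x ord0 ord0 / a * b ord0 j| <= 1].
have PE : @consrow R n @^-1` P = [set s | 0 <= s * a <= 1] `*` cube n 1.
  apply/seteqP; split => -[s y]; rewrite /P /cube /= !mxE unlift_none/= => -[-> H];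
  by split => // j; have := H j; rewrite consrowS.
have mI : measurable ([set s | 0 <= s * a <= 1] : set (measurableTypeR R)).
  have /(_ measurableT `[0, 1]%classic) : measurable_fun setT (fun s : measurableTypeR R => s * a).
    by apply: measurable_funM; [exact: measurable_id|exact: measurable_cst].
  by rewrite setTI => /(_ (measurable_itv _)).
have mP : measurable P.
  rewrite (_ : P = @unconsrow R n @^-1` ([set s | 0 <= s * a <= 1] `*` cube n 1)).
    rewrite -[X in measurable X]setTI; apply: measurable_unconsrow => //.
    by apply: measurableX => //; exact: measurable_cube.
  rewrite -PE -comp_preimage (_ : _ \o _ = id)//; apply/funext => x.
  apply/rowP => i; rewrite mxE; have [k ->|->] := unliftP ord0 i => //=.
  by rewrite mxE.
have preS0 : (fun x => x *m N) @^-1` S0 = P.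
  have xE (x : 'rV[R]_n.+1) : x = consrow (unconsrow x).
    apply/rowP => i; rewrite mxE; have [k ->|->] := unliftP ord0 i => //=.
    by rewrite mxE.
  apply/seteqP; split => x; rewrite /S0/P/= (xE x) [unconsrow x]surjective_pairing mulN;
    set s := _.1; set y := _.2; rewrite !mxE unlift_none/= => -[-> H]; split => // j;
    have := H j; rewrite !consrowS !mxE mulfK//; congr (`|_| <= 1); ring.
have mS0 : measurable S0.
  rewrite (_ : S0 = (fun x => x *m invmx N) @^-1` P).
    by rewrite -[X in measurable X]setTI; exact: measurable_mulmx.
  by rewrite -preS0; apply/funext => x; rewrite /preimage/= mulmxKV.
have volP : vol R n.+1 P = (`|a|^-1 * (2 * 1) ^+ n)%:E.
  rewrite vol_consrow PE product_measure1E//; last exact: measurable_cube.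
  transitivity (`|a|^-1%:E * ((2 * 1) ^+ n)%:E)%E; last by rewrite -EFinM.
  congr (_ * _)%E; last by apply: vol_cube.
  have [a_gt0|a_lt0|a_eq0] := ltgtP 0 a; last by rewrite -a_eq0 eqxx in a0.
    rewrite (_ : [set _ | _] = `[0, a^-1]%classic).
      rewrite [LHS]lebesgue_measure_itv/= lte_fin invr_gt0 a_gt0 sube0.
      by rewrite gtr0_norm.
    apply/seteqP; split => s; rewrite /= in_itv/= -ler_pdivlMr// mul1r pmulr_lge0//.
  rewrite (_ : [set _ | _] = `[a^-1, 0]%classic).
    rewrite [LHS]lebesgue_measure_itv/= lte_fin invr_lt0 a_lt0 add0e.
    by rewrite ltr0_norm// invrN.
  by apply/seteqP; split => s; rewrite /= in_itv/= andbC -ler_ndivrMr// mul1r nmulr_lge0.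
have volS0 : vol R n.+1 S0 = ((2 * 1) ^+ n)%:E.
  rewrite vol_consrow.
  transitivity (\int[lam]_s ((\1_(`[0, 1]%classic : set R) s)%:E * ((2 * 1) ^+ n)%:E))%E.
    apply: eq_integral => s _ /=.
    have [s01|s01] := boolP (0 <= s <= 1).
      rewrite indicE mem_set ?mul1e; last by rewrite /= in_itv.
      rewrite -(@vol_cube R n 1)// -(vol_translation (- (s / a) *: b) (@measurable_cube R n 1)).
      congr (vol R n _); apply/seteqP; split => y; rewrite /xsection/= inE /S0/=.
        by rewrite mxE unlift_none/= => -[_ H] j; have := H j; rewrite consrowS !mxE mulNr.
      move=> H; rewrite mxE unlift_none/=; split => // j.
      by have := H j; rewrite consrowS !mxE mulNr.
    rewrite indicE memNset ?mul0e; last by rewrite /= in_itv/=; exact/negP.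
    rewrite (_ : xsection _ _ = set0) ?measure0//.
    apply/seteqP; split => y //; rewrite /xsection/= inE /S0/= mxE unlift_none/=.
    by move=> -[]; rewrite (negbTE s01).
  rewrite ge0_integralZr//; last by apply/measurable_EFinP; exact: measurable_indic.
  by rewrite integral_indic// setIT [X in (X * _)%E]lebesgue_measure_itv/= lte_fin ltr01 sube0 mul1e.
have := Hc _ mS0; rewrite preS0 volP volS0 -EFinM => -[] /mulIf ->//.
Qed.

End shear.

Lemma measure_bigsetU_null disp (X : measurableType disp) (R : realType)
    (mu : {measure set X -> \bar R}) (I : Type) (r : seq I) (Z : I -> set X) :
  (forall i, measurable (Z i)) -> (forall i, mu (Z i) = 0%E) ->
  mu (\big[setU/set0]_(i <- r) Z i) = 0%E.
Proof.
move=> mZ Z0; elim: r => [|i r IH]; first by rewrite big_nil measure0.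
rewrite big_cons measureU0//; exact: bigsetU_measurable.
Qed.

(** * Facets, fluxes and the divergence theorem on one element *)

Section cell_geometry.
Context (R : realType) (n : nat) (Th : mesh R n.+1).
Implicit Types (T F : cell Th) (i l m : 'I_(nv Th)) (x : 'rV[R]_n.+1).
Local Notation mu := (vol R n.+1).

Lemma cell_other T i : Defs.nondegenerate T -> exists2 l, l \in T & l != i.
Proof.
move=> [cT _]; have /card_gt0P[l] : (0 < #|T :\ i|)%N.
  by move: cT; rewrite (cardsD1 i); case: (i \in T); rewrite ?add1n ?add0n => -[->].
by rewrite !inE => /andP[li lT]; exists l.
Qed.

Lemma cell_nonempty T : Defs.nondegenerate T -> exists i, i \in T.
Proof. by move=> [cT _]; apply/card_gt0P; rewrite cT. Qed.

Lemma cellvol_gt0 T : Defs.nondegenerate T -> 0 < cellvol T.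
Proof.
move=> nT; have [l lT] := cell_nonempty nT; have [m mT ml] := cell_other l nT.
rewrite eq_sym in ml; by have [] := cell_chart_Rintegral nT lT mT ml.
Qed.

Lemma vol_hull T : Defs.nondegenerate T -> mu (hull T) = (cellvol T)%:E.
Proof.
move=> nT; rewrite fineK// ge0_fin_numE; last exact: measure_ge0.
by apply: vol_bounded; [exact: measurable_hull|exact: bounded_hull].
Qed.

Lemma measurable_facet T i : Defs.nondegenerate T ->
  measurable (hull T `&` [set x | lam T i x = 0]).
Proof.
move=> nT; apply: closed_measurable_rV; apply: closedI; first exact: closed_hull.
apply: (@closed_comp _ _ (lam T i) [set y | y = 0]); last exact: closed_eq.
by move=> x _; exact: C1_continuous (C1_lam T i) x.
Qed.

(** In a chart whose first coordinate is [lam T i] the facet lies in a coordinate hyperplane. *)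
Lemma vol_facet T i : Defs.nondegenerate T -> i \in T ->
  mu (hull T `&` [set x | lam T i x = 0]) = 0%E.
Proof.
move=> nT iT; have [l lT li] := cell_other i nT.
set Z := hull T `&` _; have mZ : measurable Z by exact: measurable_facet.
have [_ H] := cell_chart_Rintegral nT lT iT li.
have := H Z (fun=> 1) mZ (@subIsetl _ _ _) (@continuous_const R _ 1).
pose A := cell_chart T l i; rewrite -/A.
have cA : continuous A by exact: continuous_affine.
have mAZ : measurable (A @^-1` Z).
  rewrite -[X in measurable X]setTI.
  apply: (@measurable_fun_rVP _ _ _ _ A) => // j.
  apply: continuous_measurable_rV => t; apply: continuous_comp; first exact: cA.
  exact: coord_continuous.
rewrite !Rintegral_cst//.
rewrite !mul1r => Z0.
have AZ0 : mu (A @^-1` Z) = 0%E.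
  apply/eqP; rewrite eq_le measure_ge0 andbT.
  pose Y := [set t : 'rV[R]_n.+1 | t ord0 ord0 = 0].
  have YE : @consrow R n @^-1` Y = [set 0] `*` setT.
    by apply/seteqP; split => -[s y]; rewrite /Y/= mxE unlift_none//= => -[].
  have mY : measurable Y.
    rewrite (_ : Y = coords ord0 @^-1` [set 0])//.
    by rewrite -[X in measurable X]setTI; apply: measurable_coords.
  apply: (@le_trans _ _ (mu Y)).
    apply: le_measure; rewrite ?inE// => t [_] /=.
    by have := lam_cell_chart nT lT iT li ord0 t; rewrite facet_enum0 => ->.
  rewrite vol_consrow YE product_measure1E//.
  by rewrite [X in (X * _)%E]lebesgue_measure_set1 mul0e.
have {}Z0 : fine (mu Z) = 0.
  by rewrite [LHS]Z0; exact: etrans (congr1 (fun z => _ * fine z) AZ0) (mulr0 _).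
have Zfin : (mu Z < +oo)%E.
  by apply: vol_bounded => //; apply: sub_bounded (bounded_hull T); exact: subIsetl.
by rewrite -[LHS]fineK ?Z0// ge0_fin_numE.
Qed.

Lemma cell_diff T T' : Defs.nondegenerate T -> Defs.nondegenerate T' -> T != T' ->
  exists2 i, i \in T & i \notin T'.
Proof.
move=> [cT _] [cT' _] TT'.
have /fintype.subsetPn[i iT iT'] : ~~ (T \subset T').
  by apply: contra TT' => s; rewrite eqEcard s cT cT' leqnn.
by exists i.
Qed.

Definition conforming T T' := hull T `&` hull T' = hull (T :&: T').

Lemma vol_overlap T T' : Defs.nondegenerate T -> Defs.nondegenerate T' -> T != T' ->
  conforming T T' -> mu (hull T `&` hull T') = 0%E.
Proof.
move=> nT nT' TT' cTT'; have [i iT iT'] := cell_diff nT nT' TT'.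
apply/eqP; rewrite eq_le measure_ge0 andbT -(vol_facet nT iT).
apply: le_measure; rewrite ?inE.
- by apply: measurableI; exact: measurable_hull.
- exact: measurable_facet.
move=> x; rewrite cTT' => h; have := h; rewrite (hullE nT (finset.subsetIl T T')).
move=> [l0 lF]; split; last by apply: lF; rewrite inE (negbTE iT') andbF.
by rewrite hull_cellE.
Qed.

Lemma open_cell_interior T : open [set x | forall i, i \in T -> 0 < lam T i x].
Proof.
rewrite openE => x Hx; rewrite /interior /=.
suff : \forall y \near x, forall i, i \in T -> 0 < lam T i y by [].
apply: (@filter_forall _ _ (fun (i : 'I_(nv Th)) (y : 'rV[R]_n.+1) =>
  i \in T -> 0 < lam T i y) (nbhs x) _) => i.
have [iT|iT] := boolP (i \in T); last exact: filterE.
have : \forall y \near x, 0 < lam T i y.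
  have cl := C1_continuous (C1_lam T i).
  by move: (Hx _ iT) => /lt_nbhsr; exact: cl.
by apply: filterS.
Qed.

(** The facets are null, so a set of positive volume in [T] meets the interior. Applied to an active
    element and [Om], it yields the definiteness of the norms, however small the cut part. *)
Lemma positive_vol_interior T (V : set 'rV[R]_n.+1) : Defs.nondegenerate T -> open V ->
  (0 < mu (hull T `&` V))%E ->
  exists U, [/\ open U, U !=set0 & U `<=` hull T `&` V].
Proof.
move=> nT oV TV; exists (V `&` [set x | forall i, i \in T -> 0 < lam T i x]); split.
- by apply: openI => //; exact: open_cell_interior.
- apply/set0P/negP => /eqP U0.
  move: TV; rewrite lt_neqAle => /andP[+ _]; apply/negP; rewrite negbK eq_sym.
  rewrite eq_le measure_ge0 andbT.
  pose Z i := if i \in T then hull T `&` [set x | lam T i x = 0] else set0.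
  have mZ i : measurable (Z i).
    by rewrite /Z; case: ifP => // _; exact: measurable_facet.
  apply: (@le_trans _ _ (mu (\big[setU/set0]_i Z i))).
    apply: le_measure; rewrite ?inE.
    + by apply: measurableI; [exact: measurable_hull|exact: open_measurable_rV].
    + exact: bigsetU_measurable.
    move=> x [hx Vx]; have [i /not_implyP[iT /negP]] : exists i, ~ (i \in T -> 0 < lam T i x).
      apply/existsNP => H; have : set0 x by rewrite -U0; split.
      by [].
    rewrite -leNgt => li; rewrite -bigcup_seq; exists i; first by rewrite /= mem_index_enum.
    rewrite /Z iT; split => //; apply/eqP; rewrite eq_le li/=.
    by have := hx; rewrite hull_cellE.
  rewrite measure_bigsetU_null// => i; rewrite /Z.
  by case: ifP => [iT|_]; [exact: vol_facet|exact: measure0].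
- move=> x [Vx Ux]; split => //; rewrite hull_cellE// => i.
  have [iT|iT] := boolP (i \in T); first exact/ltW/Ux.
  by rewrite lam_notin.
Qed.

(** Up to a factor depending on the dimension only, the average of [lam_m f] over the facet, written
    on the reference simplex of one dimension less so that no surface measure is involved. *)
Definition facet_mean F m (f : 'rV[R]_n.+1 -> R) : R :=
  (refvol R n.+1)^-1 * \int[vol R n]_(y in refsimp (n:=n))
    ((1 - \sum_i y ord0 i) * f ((1 - \sum_i y ord0 i) *: vert m +
       \sum_i y ord0 i *: vert (facet_enum F m (lift ord0 i)))).

Section edges.
Variables (T : cell Th) (l m : 'I_(nv Th)).
Hypotheses (nT : Defs.nondegenerate T) (lT : l \in T) (mT : m \in T) (lm : l != m).

(** The factor [lam T m] removes the boundary term on the facet opposite to [m]. *)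
Lemma Rintegral_edge_facet f : C1 f ->
  \int[mu]_(x in hull T) dotr (vert m - vert l) (grad (fun x => lam T m x * f x) x) =
  cellvol T * facet_mean (T :\ l) m f.
Proof.
move=> Cf; rewrite (Rintegral_hull_edge nT lT mT lm); last exact: C1M (C1_lam _ _) Cf.
rewrite /facet_mean !mulrA; congr (_ * _); apply: eq_Rintegral => y _.
have lm0 t : lam T m (cell_chart T l m t) = t ord0 ord0.
  by have := lam_cell_chart nT lT mT lm ord0 t; rewrite facet_enum0.
by rewrite !lm0 cell_chart_hypotenuse// !mxE !unlift_none/= mul0r subr0.
Qed.

Lemma lamg_edge : dotr (vert m - vert l) (lamg T m) = 1.
Proof. by rewrite dotrC lam_diff !lam_vert// eqxx eq_sym (negbTE lm) subr0. Qed.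

End edges.

Lemma sub_vertE T l x : Defs.nondegenerate T -> l \in T ->
  x - vert l = \sum_(m in T :\ l) lam T m x *: (vert m - vert l).
Proof.
move=> nT lT; rewrite -{1}(lam_vert_sum nT x).
have -> : vert l = \sum_i lam T i x *: vert l :> 'rV[R]_n.+1.
  by rewrite -scaler_suml lam_sum// scale1r.
rewrite -sumrB [LHS](bigID (mem (T :\ l)))/= [X in _ + X]big1 ?addr0.
  by apply: eq_bigr => i _; rewrite scalerBr -scaler_suml lam_sum// scale1r.
move=> i; rewrite !inE negb_and negbK.
move=> /orP[/eqP ->|iT]; first by rewrite subrr.
by rewrite lam_notin// !scale0r subrr.
Qed.

(** As the [lam_m] add up to 1 on [F], this is a dimensional multiple of the average of [f] over
    [F]. It depends on [F] and [f] alone, so both elements sharing a facet see the same number. *)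
Definition facet_flux F f := \sum_(m in F) facet_mean F m f.

(** The divergence theorem for the field f (x - a_l), which is tangential to all facets through a_l.
    It is the sum of the edge formulas, since x - a_l is the combination of the edges a_m - a_l with
    weights [lam_m]. *)
Lemma Rintegral_hull_apex T l f : Defs.nondegenerate T -> l \in T -> C1 f ->
  \int[mu]_(x in hull T) (dotr (x - vert l) (grad f x) + n.+1%:R * f x) =
  cellvol T * facet_flux (T :\ l) f.
Proof.
move=> nT lT Cf; rewrite /facet_flux mulr_sumr.
have cTl : #|T :\ l| = n.+1.
  by case: nT => + _; rewrite (cardsD1 l) lT add1n => -[].
transitivity (\sum_(m in T :\ l) \int[mu]_(x in hull T)
    dotr (vert m - vert l) (grad (fun x => lam T m x * f x) x)); last first.
  apply: eq_bigr => m; rewrite !inE => /andP[ml mT].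
  by rewrite Rintegral_edge_facet// eq_sym.
have H (s : seq 'I_(nv Th)) : \sum_(m <- s | m \in T :\ l) \int[mu]_(x in hull T)
      dotr (vert m - vert l) (grad (fun x => lam T m x * f x) x) =
    \int[mu]_(x in hull T) (\sum_(m <- s | m \in T :\ l)
      dotr (vert m - vert l) (grad (fun x => lam T m x * f x) x)).
  have cg m : continuous (fun x => dotr (vert m - vert l) (grad (fun x => lam T m x * f x) x)).
    by apply: continuous_grad; apply: C1M => //; exact: C1_lam.
  elim: s => [|m s IH].
    rewrite big_nil; under eq_Rintegral do rewrite big_nil.
    by rewrite Rintegral_cst ?mul0r//; exact: measurable_hull.
  rewrite big_cons IH; under [RHS]eq_Rintegral do rewrite big_cons.
  case: ifP => // mT; rewrite RintegralD//; first exact: measurable_hull.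
    by apply: integrable_hull.
  by apply: integrable_hull => //; apply: continuous_big_sum => k _.
rewrite [RHS]H; apply: eq_Rintegral => x _.
rewrite {1}(sub_vertE x nT lT) dotr_suml.
have -> : n.+1%:R * f x = \sum_(m in T :\ l) f x.
  by rewrite sumr_const cTl mulr_natl.
rewrite -big_split/=; apply: eq_bigr => m; rewrite !inE => /andP[ml mT].
have [dl _] := C1_lam T m; have [df _] := Cf.
rewrite gradM// grad_lam dotrDr !dotrZr dotrZl lamg_edge ?mulr1// eq_sym//.
Qed.

End cell_geometry.

(** * Geometry of two elements sharing a facet *)

Section neighbours.
Context (R : realType) (n : nat) (Th : mesh R n.+1).
Variables (T T' : cell Th) (l l' : 'I_(nv Th)).
Hypotheses (nT : Defs.nondegenerate T) (nT' : Defs.nondegenerate T')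
  (lT : l \in T) (lT' : l' \in T') (TT' : T != T') (FF : T :\ l = T' :\ l')
  (cTT' : conforming T T').
Local Notation mu := (vol R n.+1).

Let alpha := lam T l (vert l').

Let FT' i : i \in T' -> i != l' -> i \in T /\ i != l.
Proof.
move=> iT' il'; have : i \in T :\ l by rewrite FF !inE il'.
by rewrite !inE => /andP[].
Qed.

(** [lam T l] vanishes at the shared vertices, so only the vertex [l'] contributes when x is
    expanded over the vertices of [T']. *)
Lemma lam_neighbour x : lam T l x = alpha * lam T' l' x.
Proof.
rewrite -{1}(lam_vert_sum nT' x) /lam affine_comb; last exact: lam_sum.
rewrite (bigD1 l')//= -/(lam T' l' x) -/(lam T l _) mulrC big1 ?addr0// => i il'.
have [iT'|iT'] := boolP (i \in T').
  have [iT il] := FT' iT' il'.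
  by rewrite -/(lam T l _) lam_vert// eq_sym (negbTE il) mulr0.
by rewrite -/(lam T' i _) lam_notin// mul0r.
Qed.

Lemma lamg_neighbour : lamg T l = alpha *: lamg T' l'.
Proof.
apply/rowP => k; rewrite mxE -!dotr_delta !(dotrC (delta_mx _ _)).
have := lam_neighbour (0 + delta_mx ord0 k); rewrite lamD [X in _ = X -> _](_ : _ =
    alpha * lam T' l' 0 + alpha * dotr (lamg T' l') (delta_mx ord0 k)).
  by rewrite lam_neighbour => /addrI.
by rewrite lamD mulrDr.
Qed.

Let alpha_neq0 : alpha != 0.
Proof.
have := lam_neighbour (vert l); rewrite lam_vert// eqxx.
by apply: contra_eq_neq => ->; rewrite mul0r oner_neq0.
Qed.

Let notin_l : l \notin T'.
Proof.
apply/negP => lT''; have [ll'|ll'] := eqVneq l l'.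
  by move: TT'; rewrite -(finset.setD1K lT) -(finset.setD1K lT') FF ll' eqxx.
by have [_] := FT' lT'' ll'; rewrite eqxx.
Qed.

Lemma lam_neighbour_lt0 : alpha < 0.
Proof.
rewrite lt_neqAle alpha_neq0/= leNgt; apply/negP => a0.
(* Otherwise both cells lie on the same side of the common facet, and a point
   of [T] close to the barycentre of that facet belongs to [T']. *)
have F_T' i : i \in T :\ l -> i \in T' by rewrite FF !inE => /andP[].
have F_T i : i \in T :\ l -> i \in T by rewrite !inE => /andP[].
have cF : #|T :\ l| = n.+1.
  by case: nT => + _; rewrite (cardsD1 l) lT add1n => -[].
(* With weight [e = K^-1] at [l] and the rest spread evenly over the facet, the positive share of
   each facet vertex outweighs the possibly negative coordinates of [vert l] with respect to
   [T']. *)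
pose K : R := 1 + n.+1%:R * (1 + \sum_i `|lam T' i (vert l)|).
have K1 : 1 <= K by rewrite lerDl mulr_ge0// addr_ge0// sumr_ge0.
have K0 : 0 < K by apply: lt_le_trans K1.
pose e := K^-1; have e0 : 0 < e by rewrite invr_gt0.
have n0 : n.+1%:R != 0 :> R by rewrite pnatr_eq0.
pose w (i : 'I_(nv Th)) : R :=
  if i == l then e else if i \in T :\ l then (1 - e) / n.+1%:R else 0.
have lF : l \notin T :\ l by rewrite !inE eqxx.
have w_sum (V : lmodType R) (f : 'I_(nv Th) -> V) :
    \sum_i w i *: f i = e *: f l + \sum_(i in T :\ l) ((1 - e) / n.+1%:R) *: f i.
  rewrite (bigD1 l)//= /w eqxx; congr (_ + _).
  rewrite [RHS]big_mkcond [RHS](bigD1 l)//= (negbTE lF) add0r; apply: eq_bigr => i il.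
  by rewrite (negbTE il); case: ifP => //; rewrite scale0r.
have w1 : \sum_i w i = 1.
  have := w_sum R^o (fun=> 1); under eq_bigr do rewrite -[_ *: _]/(_ * _) mulr1.
  move=> ->; rewrite sumr_const cF -[_ *: _]/(_ * _) !mulr1.
  have -> : ((1 - e) / n.+1%:R)%:A = (1 - e) / n.+1%:R :> R by exact: mulr1.
  by rewrite -[X in e + X]mulr_natr divfK// addrC subrK.
have e1 : e <= 1 by rewrite invf_le1.
have w0 i : 0 <= w i.
  rewrite /w; case: ifP => _; first exact: ltW.
  by case: ifP => // _; rewrite divr_ge0// subr_ge0.
have wT i : i \notin T -> w i = 0.
  move=> iT; rewrite /w; case: eqP => [il|_]; first by move: iT; rewrite il lT.
  by rewrite !inE (negbTE iT) andbF.
pose z : 'rV[R]_n.+1 := \sum_i w i *: vert i.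
have zT : hull T z by exists w.
have lamz i : lam T' i z = e * lam T' i (vert l) +
    \sum_(j in T :\ l) (1 - e) / n.+1%:R * lam T' i (vert j).
  rewrite /lam affine_comb//; have := w_sum R^o (fun j => affine (bary T' i) (vert j)).
  by [].
have zT' : hull T' z.
  rewrite hull_cellE// => i /=; have [iT'|iT'] := boolP (i \in T'); last by rewrite lam_notin.
  have [il'|il'] := eqVneq i l'.
    rewrite lamz il' big1 ?addr0 => [|j jF].
      rewrite mulr_ge0 ?ltW//; have := lam_neighbour (vert l).
      rewrite lam_vert// eqxx => /esym h; rewrite -(pmulr_rgt0 _ a0) h.
      by rewrite ltr01.
    have jT' := F_T' _ jF; rewrite lam_vert//.
    have : j \in T' :\ l' by rewrite -FF.
    by rewrite !inE eq_sym => /andP[/negbTE -> _]; rewrite mulr0.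
  have iF : i \in T :\ l by rewrite FF !inE il'.
  rewrite lamz (bigD1 i)//= (lam_vert nT' iT' iT') eqxx mulr1 big1 ?addr0 => [|j /andP[jF ji]].
    rewrite -(ler_pM2r K0) mul0r mulrDl mulrAC [e * K]mulVf ?gt_eqF// mul1r.
    have -> : (1 - e) / n.+1%:R * K = 1 + \sum_i `|lam T' i (vert l)|.
      rewrite mulrAC mulrBl mul1r [e * K]mulVf ?gt_eqF// /K addrC addKr.
      by rewrite mulrC mulKf.
    have : `|lam T' i (vert l)| <= \sum_i `|lam T' i (vert l)|.
      by rewrite [leRHS](bigD1 i)//= lerDl sumr_ge0.
    by have := ler_normlP _ _ (lexx `|lam T' i (vert l)|) => -[]; lra.
  by rewrite (lam_vert nT' iT' (F_T' _ jF)) eq_sym (negbTE ji) mulr0.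
have : (hull T `&` hull T') z by split.
rewrite cTT' (hullE nT (finset.subsetIl T T')) => -[_ /(_ l)].
rewrite inE lT (negbTE notin_l) => /(_ isT); rewrite lam_comb//.
by rewrite /w eqxx => e00; move: e0; rewrite e00 ltxx.
Qed.

Lemma vol_chart (a : 'rV[R]_n.+1) y : chartM a y \in unitmx ->
  exists2 c : R, 0 < c & forall D, measurable D ->
    mu (chart a y @^-1` D) = (c%:E * mu D)%E.
Proof.
move=> uM; have [c c0 Hc] := vol_mulmx uM; exists c => // D mD.
rewrite -(vol_translation a mD) -Hc.
  by congr (mu _); apply/funext => t; rewrite /preimage/=/chart addrC.
by rewrite -[X in measurable X]setTI; exact: measurable_translation.
Qed.

(** Charts of both elements are taken with a common origin [m] on the facet, and with [l] and [l']
    as first axes. They differ by a shear whose first entry is [alpha]. *)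
Lemma cellvol_neighbour : `|alpha| * cellvol T = cellvol T'.
Proof.
have [m mT ml] := cell_other l nT.
have mF : m \in T' :\ l' by rewrite -FF !inE ml.
have /andP[ml' mT'] : (m != l') && (m \in T') by move: mF; rewrite !inE.
pose M := chartM (vert m) (@vert _ _ Th \o facet_enum (T :\ m) l).
pose M' := chartM (vert m) (@vert _ _ Th \o facet_enum (T' :\ m) l').
have uM : M \in unitmx by exact: cell_chart_unit.
pose N := M' *m invmx M.
have NM : N *m M = M' by rewrite mulmxKV.
have EE (F : cell Th) (i : 'I_(nv Th)) : F :\ m :\ i = F :\ i :\ m.
  by apply/setP => k; rewrite !inE andbCA.
(* The remaining vertices are listed identically; only the default value of [nth] differs. *)
have rowM j : row (lift ord0 j) M' = row (lift ord0 j) M.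
  rewrite !rowK /= /facet_enum /= !EE -FF; congr (vert _ - _).
  apply: set_nth_default; rewrite -cardE -EE.
  have [cT _] := nT; move: cT; rewrite (cardsD1 m) mT add1n (cardsD1 l) !inE.
  by rewrite eq_sym ml lT add1n => -[[->]]; exact: ltn_ord.
have Nj j : row (lift ord0 j) N = delta_mx ord0 (lift ord0 j).
  by rewrite row_mul rowM -row_mul mulmxV// row1.
have N00 : N ord0 ord0 = alpha.
  have := lam_cell_chart nT mT lT ml ord0 (row ord0 N).
  rewrite facet_enum0 mxE => <-; congr (lam T l _).
  rewrite /cell_chart /chart -/M -row_mul NM rowK /= facet_enum0.
  by rewrite addrC subrK.
have [c c0 Hc] := @vol_chart (vert m) _ uM.
have mh := measurable_hull nT; have mh' := measurable_hull nT'.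
have := Hc _ mh; rewrite -/(cell_chart T m l) (cell_chart_hull nT mT lT ml).
rewrite refvol_fin vol_hull// -EFinM => -[rE].
have cA : chart (vert m) (@vert _ _ Th \o facet_enum (T' :\ m) l') =
    chart (vert m) (@vert _ _ Th \o facet_enum (T :\ m) l) \o (fun t => t *m N).
  by apply/funext => t; rewrite /chart/= -/M -/M' -mulmxA NM.
have lm' : m != l' by [].
have := cell_chart_hull nT' mT' lT' lm'; rewrite /cell_chart cA comp_preimage.
move=> /(congr1 mu); rewrite (vol_shear Nj); last 2 first.
- by rewrite N00.
- rewrite -[X in measurable X]setTI.
  have -> : chart (vert m) (@vert _ _ Th \o facet_enum (T :\ m) l) =
    (fun x => x + vert m) \o (fun t => t *m M).
    by apply/funext => t; rewrite /chart/= addrC.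
  by apply: (measurableT_comp (@measurable_translation _ _ _) (@measurable_mulmx _ _ _)).
rewrite N00 Hc// refvol_fin vol_hull// -!EFinM => -[].
rewrite rE mulrCA => /(mulfI (lt0r_neq0 c0)) <-.
by rewrite mulrA mulfV ?mul1r// normr_eq0.
Qed.

(** Up to a dimensional factor, |T| grad lam_l is the inward normal of the facet scaled by its area.
    The sign comes from [lam_neighbour_lt0]. *)
Lemma flux_neighbour : cellvol T *: lamg T l = - (cellvol T' *: lamg T' l').
Proof.
rewrite lamg_neighbour -cellvol_neighbour ltr0_norm ?lam_neighbour_lt0//.
by rewrite scalerA -scaleNr; congr (_ *: _); ring.
Qed.

End neighbours.

(** * Piecewise functions *)

Section L2_products.
Context disp (X : measurableType disp) (R : realType) (mu : {measure set X -> \bar R}).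
Variable D : set X.
Hypotheses (mD : measurable D) (Dfin : (mu D < +oo)%E).

Lemma integrable_addr (f g : X -> R) : mu.-integrable D (EFin \o f) ->
  mu.-integrable D (EFin \o g) -> mu.-integrable D (EFin \o (fun x => f x + g x)).
Proof. by move=> fi gi; exact: (integrableD mD fi gi). Qed.

Lemma integrable_mulr (c : R) (f : X -> R) : mu.-integrable D (EFin \o f) ->
  mu.-integrable D (EFin \o (fun x => c * f x)).
Proof. by move=> fi; exact: (integrableZl mD c fi). Qed.

Lemma L2_integrable_sqr (f : X -> R) : L2 mu D f -> mu.-integrable D (EFin \o (fun x => f x ^+ 2)).
Proof.
move=> [mf If]; apply/integrableP; split.
  by apply/measurable_EFinP; exact: measurable_funX.
by under eq_integral do rewrite /= ger0_norm ?sqr_ge0//.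
Qed.

(** Off the null set, the product is dominated by K^2 + f^2, which is integrable as [D] has finite
    measure. The null set accommodates the normal of a Lipschitz boundary. *)
Lemma L2_mul_integrable (f h : X -> R) (K : R) (N : set X) : L2 mu D f -> measurable_fun D h ->
  measurable N -> mu N = 0%E -> (forall x, D x -> ~ N x -> `|h x| <= K) ->
  mu.-integrable D (EFin \o (fun x => h x * f x)).
Proof.
move=> Lf mh mN N0 hK; have [mf _] := Lf.
have mhf : measurable_fun D (fun x => h x * f x) by exact: measurable_funM.
have mDN : measurable (D `\` N) by exact: measurableD.
apply/(negligible_integrable mN mD _ N0); first exact/measurable_EFinP.
have i1 : mu.-integrable D (EFin \o (fun x => K ^+ 2 + f x ^+ 2)).
  apply: integrable_addr; last exact: L2_integrable_sqr.
  apply: measurable_bounded_integrable => //.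
  by exists (K ^+ 2); split; rewrite ?num_real// => M KM x _; rewrite ger0_norm ?sqr_ge0// ltW.
have i2 := integrableS mD mDN (@subDsetl _ _ _) i1.
apply/integrableP; split.
  by apply/measurable_EFinP; apply: measurable_funS mhf => //; exact: subDsetl.
case/integrableP : i2 => mi2; apply: le_lt_trans; apply: ge0_le_integral => //.
- by apply: measurableT_comp => //; apply/measurable_EFinP; apply: measurable_funS mhf => //; exact: subDsetl.
- exact: measurableT_comp.
move=> x [Dx Nx]; rewrite /= lee_fin normrM.
rewrite [leRHS]ger0_norm ?addr_ge0 ?sqr_ge0//.
have a0 := normr_ge0 (h x); have b0 := normr_ge0 (f x); have ab := hK _ Dx Nx.
rewrite -[f x ^+ 2]real_normK ?num_real//.
have : `|h x| * `|f x| <= K * `|f x| by exact: ler_wpM2r.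
have := sqr_ge0 (K - `|f x|); have := sqr_ge0 K; have := sqr_ge0 `|f x|; nra.
Qed.

Lemma L2_comb (c : R) (f g : X -> R) : L2 mu D f -> L2 mu D g -> L2 mu D (fun x => c * f x + g x).
Proof.
move=> Lf Lg; have [mf _] := Lf; have [mg _] := Lg.
have mcfg : measurable_fun D (fun x => c * f x + g x).
  by apply: measurable_funD => //; apply: measurable_funM => //; exact: measurable_cst.
split => //.
have i1 : mu.-integrable D (EFin \o (fun x => 2 * c ^+ 2 * f x ^+ 2 + 2 * g x ^+ 2)).
  by apply: integrable_addr; apply: integrable_mulr; exact: L2_integrable_sqr.
case/integrableP : i1 => mi1; apply: le_lt_trans; apply: ge0_le_integral => //.
- by move=> x _; rewrite lee_fin sqr_ge0.
- by apply/measurable_EFinP; exact: measurable_funX.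
- exact: measurableT_comp.
move=> x Dx; rewrite /= lee_fin.
apply: le_trans (ler_norm _).
by have := sqr_ge0 (c * f x - g x); nra.
Qed.

End L2_products.

Section piecewise.
Context (R : realType) (n : nat) (Th : mesh R n.+1) (Om : set 'rV[R]_n.+1).
Hypothesis nd : forall T, T \in elts Th -> Defs.nondegenerate T.
Hypothesis conf : forall T T', T \in elts Th -> T' \in elts Th -> conforming T T'.
Local Notation mu := (vol R n.+1).
Local Notation act := (active Th Om).

Lemma active_elts T : T \in act -> T \in elts Th.
Proof. by rewrite inE => /andP[]. Qed.

Lemma active_nd T : T \in act -> Defs.nondegenerate T.
Proof. by move=> /active_elts; exact: nd. Qed.

Lemma measurable_active T : T \in act -> measurable (hull T).
Proof. by move=> /active_nd ndT; exact: measurable_hull. Qed.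

Definition pick_cell (x : 'rV[R]_n.+1) : option (cell Th) :=
  [pick T in active Th Om | x \in hull T].

Definition piecewise (F : cell Th -> 'rV[R]_n.+1 -> R) x : R :=
  if pick_cell x is Some T then F T x else 0.

(** Unlike the closed elements, these sets are disjoint by construction; [piece T] fills [hull T] up
    to a null set when [T] is active ([vol_hull_piece]). *)
Definition piece T := [set x | pick_cell x = Some T].

Lemma piece_active T x : piece T x -> T \in act /\ hull T x.
Proof.
by rewrite /piece /pick_cell /=; case: pickP => // T' /andP[aT' /set_mem hT'] [<-].
Qed.

Lemma piece_hull T : piece T `<=` hull T.
Proof. by move=> x /piece_active[]. Qed.

(** The selected element depends only on the finite set of active elements containing x, so
    [piece T] is a finite union of finite intersections of hulls and their complements. *)
Lemma measurable_piece T : measurable (piece T).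
Proof.
pose star x := [set T in act | x \in hull T]%SET.
have starE x T' : (T' \in star x) = (T' \in act) && (x \in hull T').
  by rewrite /star finset.in_set.
have pE x : pick_cell x = [pick T in star x].
  by rewrite /pick_cell; apply: eq_pick => T'; rewrite /= starE.
rewrite (_ : piece T = \bigcup_(S in [set S : {set cell Th} | [pick T' in S] = Some T])
    [set x | star x = S]).
  apply: fin_bigcup_measurable; first exact: finite_finset.
  move=> S _.
  rewrite (_ : [set x | star x = S] = \bigcap_(T' in [set: cell Th])
      (if T' \in act then if T' \in S then hull T' else ~` hull T'
       else if T' \in S then set0 else setT)).
    apply: fin_bigcap_measurable; first exact: finite_finset.
    move=> T' _; case: ifPn => [aT'|_]; last by case: ifP.
    have mT' := measurable_hull (active_nd aT').
    by case: ifP => _ //; exact: measurableC.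
  apply/seteqP; split => x /=.
    move=> <- T' _; rewrite starE; case: (boolP (T' \in act)) => //= aT'.
    by case: ifP => [xT|/negbT]; [exact: set_mem|rewrite notin_setE].
  move=> H; apply/setP => T'; rewrite starE; have := H T' I.
  case: ifP => //= aT'; case: ifP => //= TS.
    by move=> h; rewrite mem_set.
  by move=> h; rewrite memNset.
apply/seteqP; split => x; rewrite /piece/= pE; first by exists (star x).
by move=> [S /= HS SE]; rewrite SE.
Qed.

Lemma pick_cell_mem T x : T \in act -> hull T x -> exists T', pick_cell x = Some T'.
Proof.
move=> aT hT; rewrite /pick_cell; case: pickP => [T' _|/(_ T)]; first by exists T'.
by rewrite /= aT mem_set.
Qed.

Lemma vol_hull_piece T : T \in act -> mu (hull T `\` piece T) = 0%E.
Proof.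
move=> aT; apply/eqP; rewrite eq_le measure_ge0 andbT.
pose Z T' := if (T' \in act) && (T != T') then hull T `&` hull T' else set0.
have mZ T' : measurable (Z T').
  rewrite /Z; case: ifP => // /andP[aT' _].
  by apply: measurableI; apply: measurable_hull; exact: active_nd.
rewrite -(@measure_bigsetU_null _ _ _ mu _ (index_enum _) Z) => //.
  apply: le_measure; rewrite ?inE.
  - by apply: measurableD; [exact: measurable_active|exact: measurable_piece].
  - exact: bigsetU_measurable.
  move=> x [hx npx]; have [T' pT'] := pick_cell_mem aT hx.
  have [aT' hT'] := piece_active pT'.
  rewrite -bigcup_seq; exists T'; first by rewrite /= mem_index_enum.
  rewrite /Z aT'/=; case: eqP => [TT'|_] //=.
  by case: npx; rewrite /piece/= pT' TT'.
move=> T'; rewrite /Z; case: ifP => [/andP[aT' TT']|_]; last exact: measure0.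
apply: vol_overlap => //; [exact: active_nd|exact: active_nd|].
by apply: conf; exact: active_elts.
Qed.

Lemma piecewiseE F : piecewise F = (fun x => \sum_(T in act) (F T \_ (piece T)) x).
Proof.
apply/funext => x; rewrite /piecewise; case px : (pick_cell x) => [T|].
  have [aT hT] := piece_active px.
  rewrite (bigD1 T)//= patchE mem_set// big1 ?addr0// => T' /andP[_ TT'].
  rewrite patchE memNset//; rewrite /piece/= px => -[E].
  by rewrite E eqxx in TT'.
rewrite big1// => T _; rewrite patchE memNset//; by rewrite /piece/= px.
Qed.

Lemma integrable_piecewise S F : measurable S ->
  (forall T, T \in act -> continuous (F T)) ->
  mu.-integrable S (EFin \o piecewise F) /\
  \int[mu]_(x in S) piecewise F x = \sum_(T in act) \int[mu]_(x in S `&` hull T) F T x.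
Proof.
move=> mS cF.
have bSh (T : cell Th) : bounded_set (S `&` hull T).
  by apply: sub_bounded (bounded_hull T); exact: subIsetr.
have mSh T : T \in act -> measurable (S `&` hull T).
  by move=> aT; apply: measurableI => //; exact: measurable_active.
have mSp T : measurable (S `&` piece T).
  by apply: measurableI => //; exact: measurable_piece.
have SpSh T : S `&` piece T `<=` S `&` hull T by apply: setIS; exact: piece_hull.
have iT T : T \in act -> mu.-integrable S (EFin \o (F T \_ (piece T))).
  move=> aT; rewrite -restrict_EFin; apply/integrable_restrict => //.
    exact: measurable_piece.
  apply: integrable_continuous => //; first exact: cF.
  by apply: (sub_bounded _ (bSh T)); exact: SpSh.
have IT T : T \in act ->
    \int[mu]_(x in S) (F T \_ (piece T)) x = \int[mu]_(x in S `&` hull T) F T x.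
  move=> aT; rewrite -Rintegral_mkcondr.
  have iSh := integrable_continuous (cF _ aT) (mSh _ aT) (bSh T).
  have mN : measurable ((S `&` hull T) `\` (S `&` piece T)).
    by apply: measurableD => //; exact: mSh.
  rewrite -(setDUK (SpSh T)) Rintegral_setU// ?setDUK//; last first.
    by apply/disj_setPS => x [Bx []].
  rewrite [X in _ + X](_ : _ = 0) ?addr0//; rewrite /Rintegral null_set_integral//.
    by case/integrableP : iSh => mF _; apply: measurable_funS mF; [exact: mSh|exact: subDsetl].
  apply/eqP; rewrite eq_le measure_ge0 andbT -(vol_hull_piece aT).
  apply: le_measure; rewrite ?inE//.
    by apply: measurableD; [exact: measurable_active|exact: measurable_piece].
  by move=> x [[Sx hx] np]; split => // px; exact: np.
rewrite piecewiseE.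
suff H (s : seq (cell Th)) :
    mu.-integrable S (EFin \o (fun x => \sum_(T <- s | T \in act) (F T \_ (piece T)) x)) /\
    \int[mu]_(x in S) (\sum_(T <- s | T \in act) (F T \_ (piece T)) x) =
    \sum_(T <- s | T \in act) \int[mu]_(x in S `&` hull T) F T x.
  exact: H.
elim: s => [|T s [IH1 IH2]].
  under [X in EFin \o X]eq_fun do rewrite big_nil.
  split; first exact: integrable0.
  under eq_Rintegral do rewrite big_nil.
  by rewrite big_nil /Rintegral integral0.
under [X in EFin \o X]eq_fun do rewrite big_cons.
under eq_Rintegral do rewrite big_cons.
rewrite big_cons; case: ifP => aT; last by split.
split; first by apply: integrable_addr => //; exact: iT.
rewrite RintegralD//; last exact: iT.
by rewrite IH2 IT.
Qed.

Lemma measurable_piecewise F : (forall T, T \in act -> continuous (F T)) ->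
  measurable_fun setT (piecewise F).
Proof.
move=> cF; have [/integrableP[mF _] _] := integrable_piecewise measurableT cF.
exact/measurable_EFinP.
Qed.

Lemma measurable_OmT : measurable (OmT Th Om).
Proof.
apply: fin_bigcup_measurable; first exact: finite_finset.
by move=> T aT; exact: measurable_active.
Qed.

Lemma bounded_OmT : bounded_set (OmT Th Om).
Proof.
have [M HM] : exists M, forall T : cell Th, hull T `<=` cube n.+1 M.
  have H (T : cell Th) : exists M, hull T `<=` cube n.+1 M.
    by have [M _ ?] := bounded_sub_cube (bounded_hull T); exists M.
  have [M HM] := choice H; exists (\big[Num.max/0]_T M T) => T x /HM h i.
  by apply: (le_trans (h i)); apply: le_bigmax_seq => //; rewrite mem_index_enum.
apply: (sub_bounded (B := cube n.+1 M)); last exact: bounded_cube.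
by move=> x [T _]; exact: HM.
Qed.

Lemma Rintegral_OmT F : (forall T, T \in act -> continuous (F T)) ->
  \int[mu]_(x in OmT Th Om) piecewise F x = \sum_(T in act) \int[mu]_(x in hull T) F T x.
Proof.
move=> cF; have [_ ->] := integrable_piecewise measurable_OmT cF.
apply: eq_bigr => T aT; congr (Rintegral _ _ _).
by apply/seteqP; split => x; [case|move=> hx; split => //; exists T].
Qed.

Lemma piecewise_bounded F : (forall T, T \in act -> continuous (F T)) ->
  exists2 K : R, 0 <= K & forall x, `|piecewise F x| <= K.
Proof.
move=> cF; have [M M0 HM] := bounded_sub_cube bounded_OmT.
have H T : exists K : R, 0 <= K /\ (T \in act -> forall x, cube n.+1 M x -> `|F T x| <= K).
  have [aT|aT] := boolP (T \in act); last by exists 0.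
  by have [K K0 HK] := continuous_bounded_on_cube M (cF _ aT); exists K.
have [K HK] := choice H.
have K0 : 0 <= \sum_T K T by apply: sumr_ge0 => T _; case: (HK T).
exists (\sum_T K T) => // x; rewrite /piecewise; case px : (pick_cell x) => [T|]; last by rewrite normr0.
have [aT hT] := piece_active px.
have xM : cube n.+1 M x by apply: HM; exists T.
apply: (@le_trans _ _ (K T)); first by case: (HK T) => _; exact.
by rewrite (bigD1 T)//= lerDl sumr_ge0// => T' _; case: (HK T').
Qed.

End piecewise.

(** * Estimates on the reference simplex *)

Section psdforms.
Context (R : realType) (E : lmodType R) (V : set E).

Lemma psdform_add (A B : E -> E -> R) : psdform V A -> psdform V B ->
  psdform V (fun u v => A u v + B u v).
Proof.
move=> [A1 A2 A3] [B1 B2 B3]; split.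
- move=> u Vu c v w Vv Vw.
  by rewrite (A1 _ Vu _ _ _ Vv Vw) (B1 _ Vu _ _ _ Vv Vw) mulrDr addrACA.
- by move=> u v Vu Vv; rewrite A2// B2.
- by move=> u Vu; rewrite addr_ge0 ?A3 ?B3.
Qed.

Lemma psdform_mull (f : E -> R) : linear_on V f -> psdform V (fun u v => f u * f v).
Proof.
move=> lf; split.
- by move=> u Vu c v w Vv Vw; rewrite lf// mulrDr mulrCA.
- by move=> u v _ _; rewrite mulrC.
- by move=> u _; rewrite -expr2 sqr_ge0.
Qed.

End psdforms.

Section reference_simplex.
Context (R : realType) (d : nat).
Local Notation mpol := (mpoly.mpoly d R).
Local Notation X i := (mpoly.mpolyX R (mpoly.mnm1 i) : mpol).
Implicit Types (p q r : mpol).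

Definition refint p : R := \int[vol R d]_(t in refsimp (n:=d)) peval p t.

Definition radial p : mpol := \sum_(j < d) X j * mpoly.mderiv j p.

(* At a point of the simplex, with weights given by its barycentric           *)
(* coordinates, [spread p p] is the variance of the numbers [d_j p] and of 0  *)
(* (the latter with the weight of the apex).                                  *)
Definition spread p q : mpol :=
  \sum_(j < d) X j * (mpoly.mderiv j p * mpoly.mderiv j q) - radial p * radial q.

Lemma refint_linear c p q : refint (c *: p + q) = c * refint p + refint q.
Proof.
rewrite /refint; under eq_Rintegral do rewrite pevalD pevalZ.
have mr := @measurable_refsimp R d.
have ip r := integrable_continuous (@continuous_peval _ _ r) (@measurable_refsimp R d) (bounded_refsimp R d).
rewrite RintegralD//; last exact: (integrable_mulr mr c (ip p)).
by rewrite RintegralZl.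
Qed.

Lemma radial_linear c p q : radial (c *: p + q) = c *: radial p + radial q.
Proof.
rewrite /radial scaler_sumr -big_split; apply: eq_bigr => j _.
by rewrite linearP/= -!mpoly.mul_mpolyC; ring.
Qed.

Lemma spreadC p q : spread p q = spread q p.
Proof.
rewrite /spread [radial p * _]mulrC; congr (_ - _); apply: eq_bigr => j _.
by rewrite [mpoly.mderiv j p * _]mulrC.
Qed.

Lemma spread_linear r c p q : spread r (c *: p + q) = c *: spread r p + spread r q.
Proof.
have S : \sum_(j < d) X j * (mpoly.mderiv j r * mpoly.mderiv j (c *: p + q)) =
    c *: (\sum_(j < d) X j * (mpoly.mderiv j r * mpoly.mderiv j p)) +
    \sum_(j < d) X j * (mpoly.mderiv j r * mpoly.mderiv j q).
  rewrite scaler_sumr -big_split; apply: eq_bigr => j _.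
  by rewrite linearP/= -!mpoly.mul_mpolyC; ring.
by rewrite /spread radial_linear S -!mpoly.mul_mpolyC; ring.
Qed.

Lemma sum_shift (w x : 'I_d -> R) s :
  \sum_j w j * (x j - s) = \sum_j w j * x j - s * \sum_j w j.
Proof.
rewrite -mulNr mulr_sumr -big_split; apply: eq_bigr => j _ /=; ring.
Qed.

Lemma sum_shift_sqr (w x : 'I_d -> R) s :
  \sum_j w j * (x j - s) ^+ 2 =
  \sum_j w j * x j ^+ 2 - 2 * s * (\sum_j w j * x j) + s ^+ 2 * \sum_j w j.
Proof.
rewrite -mulNr !mulr_sumr -!big_split; apply: eq_bigr => j _ /=; ring.
Qed.

(** The defect 1 - sum w is the weight of an additional value 0, here that of the apex. *)
Lemma variance_identity (w x : 'I_d -> R) (s := \sum_j w j * x j) :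
  \sum_j w j * x j ^+ 2 - s ^+ 2 =
  \sum_j w j * (x j - s) ^+ 2 + (1 - \sum_j w j) * s ^+ 2.
Proof.
rewrite sum_shift_sqr -/s; ring.
Qed.

Lemma peval_spread p t : peval (spread p p) t =
  \sum_j t ord0 j * peval (mpoly.mderiv j p) t ^+ 2 -
  (\sum_j t ord0 j * peval (mpoly.mderiv j p) t) ^+ 2.
Proof.
have re : peval (radial p) t = \sum_j t ord0 j * peval (mpoly.mderiv j p) t.
  by rewrite /radial peval_sum; apply: eq_bigr => j _; rewrite pevalM pevalX.
rewrite /spread pevalB pevalM re expr2 peval_sum; congr (_ - _).
by apply: eq_bigr => j _; rewrite !pevalM pevalX expr2.
Qed.

Lemma spread_ge0 p t : refsimp t -> 0 <= peval (spread p p) t.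
Proof.
move=> [t0 t1]; rewrite peval_spread variance_identity.
apply: addr_ge0; last by rewrite mulr_ge0 ?subr_ge0 ?sqr_ge0.
by apply: sumr_ge0 => j _; rewrite mulr_ge0 ?sqr_ge0.
Qed.

Definition refsimp_interior : set 'rV[R]_d :=
  [set t | (forall i, 0 < t ord0 i) /\ \sum_i t ord0 i < 1].

Lemma open_refsimp_interior : open refsimp_interior.
Proof.
rewrite openE => t [t0 t1]; rewrite /interior /=.
apply: filterI.
  apply: (@filter_forall _ _ (fun (i : 'I_d) (y : 'rV[R]_d) => 0 < y ord0 i) (nbhs t) _) => i.
  have ci := @coord_continuous R _ _ ord0 i t.
  by move: (t0 i) => /lt_nbhsr; exact: ci.
have cs : continuous (fun y : 'rV[R]_d => \sum_i y ord0 i).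
  by apply: continuous_big_sum => i _; exact: coord_continuous.
by move: t1 => /lt_nbhsl; exact: cs.
Qed.

Lemma refsimp_interior_neq0 : refsimp_interior !=set0.
Proof.
have h : (0 : R) < d.+1%:R^-1 by rewrite invr_gt0.
exists (const_mx d.+1%:R^-1); split => [i|]; first by rewrite mxE.
under eq_bigr do rewrite mxE.
by rewrite sumr_const card_ord -[_ *+ _]mulr_natl ltr_pdivrMr// mul1r ltr_nat.
Qed.

Lemma refsimp_interior_sub : refsimp_interior `<=` refsimp (n:=d).
Proof. by move=> t [t0 t1]; split => [i|]; exact: ltW. Qed.

Lemma refint_sqr_eq0 p : refint (p * p) = 0 -> p = 0.
Proof.
move=> p0; apply: (@Rintegral_sqr_eq0 _ _ _ refsimp_interior _ (@measurable_refsimp R d) (bounded_refsimp R d)).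
- exact: open_refsimp_interior.
- exact: refsimp_interior_neq0.
- exact: refsimp_interior_sub.
by under eq_Rintegral do rewrite -pevalM.
Qed.

(** Zero variance at an interior point makes all partial derivatives equal to their mean, and the
    apex, of positive weight and value 0, makes this mean vanish. *)
Lemma refint_spread_eq0 p : refint (spread p p) = 0 -> exists c, p = mpoly.mpolyC d c.
Proof.
move=> p0; apply: mderiv_eq0 => i.
apply: (peval_open_eq0 open_refsimp_interior refsimp_interior_neq0) => t It.
have := Rintegral_eq0_open (@measurable_refsimp R d) (bounded_refsimp R d) open_refsimp_interior
  refsimp_interior_sub (@continuous_peval _ _ (spread p p)) (@spread_ge0 p) p0 It.
rewrite peval_spread variance_identity; case: It => t0 t1.
pose s := \sum_j t ord0 j * peval (mpoly.mderiv j p) t; rewrite -/s => E.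
have A : 0 <= \sum_j t ord0 j * (peval (mpoly.mderiv j p) t - s) ^+ 2.
  by apply: sumr_ge0 => j _; rewrite mulr_ge0 ?sqr_ge0// ltW.
have B : 0 <= (1 - \sum_i t ord0 i) * s ^+ 2 by rewrite mulr_ge0 ?sqr_ge0 ?subr_ge0 ?ltW.
move/eqP : E; rewrite paddr_eq0// => /andP[A0 /eqP B0].
have s0 : s = 0.
  by move/eqP : B0; rewrite mulf_eq0 sqrf_eq0 subr_eq0 gt_eqF//= => /eqP.
move: A0; rewrite psumr_eq0; last by move=> j _; rewrite mulr_ge0 ?sqr_ge0// ltW.
move=> /allP /(_ i); rewrite mem_index_enum => /(_ isT).
by rewrite mulf_eq0 gt_eqF//= sqrf_eq0 s0 subr0 => /eqP.
Qed.

Definition polys k : set mpol := [set p | deg_le k p].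

Lemma lspace_polys k : lspace (polys k).
Proof.
split; first by rewrite /polys/= mpoly.msize0.
by move=> c p q pk qk; apply: deg_leD => //; exact: deg_leZ.
Qed.

Lemma inspan_lincomb (V : lmodType R) (I : Type) (s : seq I) (f : I -> V) (c : I -> R) :
  inspan [seq f i | i <- s] (\sum_(i <- s) c i *: f i).
Proof.
elim: s => [|i s IH] /=; first by rewrite big_nil.
by exists (c i); rewrite big_cons addrAC subrr add0r.
Qed.

Lemma spanned_polys k : spanned (polys k).
Proof.
apply: (@sub_inspan _ _ _ [seq (mpoly.mpolyX R (mpoly.bmnm m) : mpol) |
  m <- index_enum (mpoly.bmultinom d k.+1)]) (lspace_polys k) _.
move=> p pk; rewrite (mpoly.mpolywE pk).
exact: inspan_lincomb.
Qed.

Lemma psdform_refint (V : set mpol) (B : mpol -> mpol -> mpol) :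
  (forall c p q r, B p (c *: q + r) = c *: B p q + B p r) ->
  (forall p q, B p q = B q p) -> (forall p t, refsimp t -> 0 <= peval (B p p) t) ->
  psdform V (fun p q => refint (B p q)).
Proof.
move=> lB sB B0; split.
- by move=> p _ c q r _ _; rewrite lB refint_linear.
- by move=> p q _ _; rewrite sB.
by move=> p _; apply: Rintegral_ge0 => t; exact: B0.
Qed.

Lemma psdform_mul (V : set mpol) : psdform V (fun p q => refint (p * q)).
Proof.
apply: psdform_refint.
- by move=> c p q r; rewrite mulrDr scalerAr.
- exact: mulrC.
- by move=> p t _; rewrite pevalM -expr2 sqr_ge0.
Qed.

Lemma psdform_spread (V : set mpol) : psdform V (fun p q => refint (spread p q)).
Proof.
apply: psdform_refint; [by move=> c p q r; exact: spread_linear|exact: spreadC|].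
exact: spread_ge0.
Qed.

Lemma reference_inverse k : exists2 C : R, 0 <= C &
  forall p, deg_le k p -> refint (spread p p) <= C * refint (p * p).
Proof.
apply: (psdform_dominated (lspace_polys k) (spanned_polys k) (psdform_spread _) (psdform_mul _)).
move=> p _ /refint_sqr_eq0 ->.
have VV := lspace_polys k; have [D1 _ _] := psdform_spread (polys k).
exact: (linear_on0 VV (D1 _ VV.1)).
Qed.

(** The kernel of the spread consists of the constants, and on these the integral is definite. *)
Lemma reference_poincare k : exists2 C : R, 0 <= C &
  forall p, deg_le k p -> refint (p * p) <= C * (refint (spread p p) + refint p ^+ 2).
Proof.
pose M p q := refint (spread p q) + refint p * refint q.
have [D1 D2 D3] := psdform_spread (polys k).
have PM : psdform (polys k) M.
  apply: psdform_add; first exact: psdform_spread.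
  by apply: psdform_mull => c p q _ _; exact: refint_linear.
have M0 p : polys k p -> M p p = 0 -> refint (p * p) = 0.
  move=> Vp /eqP; rewrite /M paddr_eq0; [|exact: D3|by rewrite -expr2 sqr_ge0].
  rewrite -expr2 sqrf_eq0 => /andP[/eqP /refint_spread_eq0[c ->] /eqP I0].
  rewrite mpoly.mul_mpolyC.
  have := refint_linear c (mpoly.mpolyC d c) 0; rewrite addr0 I0 mulr0 add0r => ->.
  by rewrite /refint; under eq_Rintegral do rewrite peval0; rewrite /Rintegral integral0.
have [C C0 HC] := psdform_dominated (lspace_polys k) (spanned_polys k) (psdform_mul (polys k)) PM M0.
by exists C => // p pk; apply: (le_trans (HC _ pk)); rewrite /M -expr2.
Qed.

End reference_simplex.

(** * Pull-back of polynomials to the reference simplex *)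

Section pullback.
Context (R : realType) (n : nat).

Lemma deg_le_exp (d k : nat) (p : mpoly.mpoly d R) (e : nat) :
  deg_le k p -> deg_le (k * e)%N (p ^+ e).
Proof.
move=> pk; elim: e => [|e IH]; first by rewrite expr0 muln0 mpoly.msize1.
by rewrite exprS mulnS; exact: deg_le_mul.
Qed.

Lemma deg_le_affine_comp (d e k : nat) (g : 'I_d -> mpoly.mpoly e R) (q : mpoly.mpoly d R) :
  (forall i, deg_le 1 (g i)) -> deg_le k q ->
  deg_le k (mpoly.comp_mpoly (mktuple g) q).
Proof.
move=> g1 qk; rewrite (mpoly.comp_mpolywE _ qk).
apply: deg_le_sum => m _; apply: deg_leZ.
have H : deg_le (\sum_(i < d) mpoly.bmnm m i)%N
    (\prod_(i < d) tnth (mktuple g) i ^+ mpoly.bmnm m i).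
  elim/big_rec2 : _ => [|i p r _ IH]; first by rewrite mpoly.msize1.
  by apply: deg_le_mul => //; rewrite tnth_mktuple -[X in deg_le X _]mul1n; exact: deg_le_exp.
apply: (leq_trans H); rewrite ltnS -mpoly.mdegE.
by have := mpoly.bmdeg m; rewrite ltnS.
Qed.

Lemma peval_comp (d e : nat) (g : 'I_d -> mpoly.mpoly e R) (q : mpoly.mpoly d R) (t : 'rV[R]_e) :
  peval (mpoly.comp_mpoly (mktuple g) q) t = peval q (\row_i peval (g i) t).
Proof.
rewrite /peval mpoly.comp_mpoly_meval; apply: mpoly.meval_eq => i.
by rewrite tnth_mktuple mxE.
Qed.

(** The chain rule for affine maps: a directional derivative depends only on the restriction to a
    line. *)
Lemma derive_line (d e : nat) (f : 'rV[R]_d -> R) (g : 'rV[R]_e -> R) x v y w :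
  (forall h : R, f (h *: v + x) = g (h *: w + y)) -> 'D_v f x = 'D_w g y.
Proof.
move=> fg; have f0 : f x = g y by have := fg 0; rewrite !scale0r !add0r.
rewrite /derive (_ : (fun h : R => h^-1 *: (f (h *: v + x) - f x)) =
  (fun h : R => h^-1 *: (g (h *: w + y) - g y)))//.
by apply/funext => h; rewrite fg f0.
Qed.

Context (Th : mesh R n.+1) (T : cell Th) (l m : 'I_(nv Th)).
Hypotheses (nT : Defs.nondegenerate T) (lT : l \in T) (mT : m \in T) (lm : l != m).
Local Notation e := (facet_enum (T :\ l) m).
Local Notation A := (cell_chart T l m).

Lemma cell_chartE t : A t = vert l + \sum_j t ord0 j *: (vert (e j) - vert l).
Proof.
rewrite /cell_chart /chart; congr (_ + _); rewrite mulmx_sum_row; apply: eq_bigr => j _.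
by congr (_ *: _); apply/rowP => i; rewrite !mxE.
Qed.

Definition pullback (q : mpoly.mpoly n.+1 R) : mpoly.mpoly n.+1 R :=
  mpoly.comp_mpoly (mktuple (fun i => mpoly.mpolyC n.+1 (vert l ord0 i) +
    \sum_j (vert (e j) - vert l) ord0 i *: (mpoly.mpolyX R (mpoly.mnm1 j) : mpoly.mpoly n.+1 R))) q.

Lemma peval_pullback q t : peval (pullback q) t = peval q (A t).
Proof.
rewrite peval_comp; congr peval; apply/rowP => i; rewrite cell_chartE !mxE summxE pevalD pevalC.
congr (_ + _); rewrite peval_sum; apply: eq_bigr => j _.
by rewrite pevalZ pevalX !mxE mulrC.
Qed.

Lemma deg_le_pullback k q : deg_le k q -> deg_le k (pullback q).
Proof.
apply: deg_le_affine_comp => i; apply: deg_leD.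
  exact: deg_leC.
by apply: deg_le_sum => j _; apply: deg_leZ; exact: deg_leX.
Qed.

Lemma peval_mderiv_pullback q j t :
  peval (mpoly.mderiv j (pullback q)) t = dotr (vert (e j) - vert l) (grad (peval q) (A t)).
Proof.
rewrite -partial_peval /partial.
have [_ <-] := C1_is_derive (A t) (vert (e j) - vert l) (C1_peval q).
apply: derive_line => h; rewrite peval_pullback; congr (peval q _).
rewrite !cell_chartE addrCA; congr (_ + _).
rewrite (bigD1 j)//= [in RHS](bigD1 j)//= !mxE !eqxx mulr1 scalerDl -addrA; congr (_ + (_ + _)).
by apply: eq_bigr => i ij; rewrite !mxE (negbTE ij) mulr0 add0r.
Qed.

Lemma big_cell (F : 'I_(nv Th) -> R) : \sum_(i in T) F i = F l + \sum_j F (e j).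
Proof.
have [cT _] := nT.
have mTl : m \in T :\ l by rewrite !inE eq_sym lm.
have cTl : #|T :\ l| = n.+1 by move: cT; rewrite (cardsD1 l) lT => -[].
rewrite (bigD1 l)//=; congr (_ + _).
transitivity (\sum_(i in [set e j | j in 'I_n.+1]%SET) F i).
  apply: eq_bigl => i; rewrite andbC; apply/idP/imsetP => [iT|[j _ ->]].
    have [|j <-] := facet_enum_surj cTl mTl (i := i); first by rewrite !inE.
    by exists j.
  by have := facet_enum_in cTl mTl j; rewrite !inE.
by rewrite big_imset//= => x y _ _; exact: facet_enum_inj.
Qed.

End pullback.

Section cell_spread.
Context (R : realType) (n : nat) (Th : mesh R n.+1).
Implicit Types (T : cell Th) (q : mpoly.mpoly n.+1 R).

Definition vslope q (i : 'I_(nv Th)) x : R := dotr (vert i) (grad (peval q) x).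

(** The variance of the slopes, with the barycentric coordinates as weights. Single slopes depend on
    the origin; moving it shifts all of them by the same amount and leaves the variance
    unchanged. *)
Definition cell_spread T q x : R :=
  \sum_(i in T) lam T i x * vslope q i x ^+ 2 - (\sum_(i in T) lam T i x * vslope q i x) ^+ 2.

Lemma continuous_vslope q (i : 'I_(nv Th)) : continuous (vslope q i).
Proof. by apply: continuous_grad; exact: C1_peval. Qed.

Lemma continuous_cell_spread T q : continuous (cell_spread T q).
Proof.
have cl i : continuous (lam T i) by apply: C1_continuous; exact: C1_lam.
have cs : continuous (fun x => \sum_(i in T) lam T i x * vslope q i x).
  by apply: continuous_big_sum => i _; apply: continuous_mul => //; exact: continuous_vslope.
rewrite (_ : cell_spread T q = (fun x => \sum_(i in T) lam T i x * (vslope q i x * vslope q i x) +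
    (-1) * ((\sum_(i in T) lam T i x * vslope q i x) * (\sum_(i in T) lam T i x * vslope q i x)))).
  apply: continuous_add.
    apply: continuous_big_sum => i _; apply: continuous_mul => //.
    by apply: continuous_mul; exact: continuous_vslope.
  by apply: continuous_mul; [exact: continuous_const|exact: continuous_mul].
apply/funext => x; rewrite /cell_spread expr2 mulN1r; congr (_ - _).
Qed.

Definition cell_mean T q : R := (cellvol T)^-1 * \int[vol R n.+1]_(x in hull T) peval q x.

(** The derivatives of the pull-back are differences of slopes with that of the vertex [l]; this
    common shift does not change the variance and gives the apex the slope 0. *)
Lemma cell_spread_chart T l m q t : Defs.nondegenerate T -> l \in T -> m \in T -> l != m ->
  peval (spread (pullback T l m q) (pullback T l m q)) t = cell_spread T q (cell_chart T l m t).
Proof.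
move=> nT lT mT lm; rewrite peval_spread.
under eq_bigr do rewrite peval_mderiv_pullback// dotrBl -!/(vslope _ _ _) -(lam_cell_chart nT lT mT lm).
under [X in _ - X ^+ 2]eq_bigr do rewrite peval_mderiv_pullback// dotrBl -!/(vslope _ _ _)
  -(lam_cell_chart nT lT mT lm).
set x := cell_chart T l m t; set s := vslope q l x.
have S1 : lam T l x + \sum_j lam T (facet_enum (T :\ l) m j) x = 1.
  rewrite -(big_cell nT lT mT lm (fun i => lam T i x)) -[RHS](lam_sum nT x) [RHS](bigID (mem T))/=.
  by rewrite [X in _ + X]big1 ?addr0// => i iT; rewrite lam_notin.
rewrite /cell_spread !(big_cell nT lT mT lm) -/s.
set B := \sum_j lam T _ x * vslope q _ x.
set A2 := \sum_j lam T _ x * vslope q _ x ^+ 2.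
set L := \sum_j lam T _ x in S1.
rewrite sum_shift_sqr sum_shift -/A2 -/B -/L.
have -> : lam T l x = 1 - L by rewrite -S1 addrK.
ring.
Qed.

End cell_spread.

Section cell_estimates.
Context (R : realType) (n k : nat).

Lemma cell_edge (Th : mesh R n.+1) (T : cell Th) : Defs.nondegenerate T ->
  exists l m, [/\ l \in T, m \in T & l != m].
Proof.
move=> [cT _]; have : (1 < #|T|)%N by rewrite cT.
by move=> /card_gt1P[l [m [lT mT lm]]]; exists l, m.
Qed.

Lemma cell_pullback (Th : mesh R n.+1) (T : cell Th) q : Defs.nondegenerate T -> deg_le k q ->
  exists p : mpoly.mpoly n.+1 R, let c := cellvol T / refvol R n.+1 in [/\ deg_le k p,
    \int[vol R n.+1]_(x in hull T) (peval q x * peval q x) = c * refint (p * p),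
    \int[vol R n.+1]_(x in hull T) cell_spread T q x = c * refint (spread p p) &
    \int[vol R n.+1]_(x in hull T) peval q x = c * refint p].
Proof.
move=> nT qk; have [l [m [lT mT lm]]] := cell_edge nT.
have cq := @continuous_peval _ _ q.
exists (pullback T l m q); split; first exact: deg_le_pullback.
- rewrite (Rintegral_hull nT lT mT lm (continuous_mul cq cq)) /refint.
  by under [in RHS]eq_Rintegral do rewrite pevalM !peval_pullback.
- rewrite (Rintegral_hull nT lT mT lm (@continuous_cell_spread _ _ _ T q)) /refint.
  by congr (_ * _); apply: eq_Rintegral => t _; rewrite cell_spread_chart.
- rewrite (Rintegral_hull nT lT mT lm cq) /refint.
  by under [in RHS]eq_Rintegral do rewrite peval_pullback.
Qed.

(** Both integrals pull back with the same factor, so the constant is that of the reference simplex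
    for elements of any size and shape. *)
Lemma cell_inverse : exists2 C : R, 0 <= C &
  forall (Th : mesh R n.+1) (T : cell Th) q, Defs.nondegenerate T -> deg_le k q ->
  \int[vol R n.+1]_(x in hull T) cell_spread T q x <=
  C * \int[vol R n.+1]_(x in hull T) (peval q x * peval q x).
Proof.
have [C C0 HC] := @reference_inverse R n.+1 k; exists C => // Th T q nT qk.
have r0 : 0 < refvol R n.+1 by exact: refvol_gt0.
have [p [pk -> -> _]] := cell_pullback nT qk.
move: (HC _ pk); move: (refint (spread p p)) (refint (p * p)) => S I2 H.
rewrite (mulrCA C); apply: ler_wpM2l => //.
exact: divr_ge0 (ltW (cellvol_gt0 nT)) (ltW r0).
Qed.

Lemma cell_poincare : exists2 C : R, 0 <= C &
  forall (Th : mesh R n.+1) (T : cell Th) q, Defs.nondegenerate T -> deg_le k q ->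
  \int[vol R n.+1]_(x in hull T) (peval q x * peval q x) <=
  C * (\int[vol R n.+1]_(x in hull T) cell_spread T q x + cellvol T * cell_mean T q ^+ 2).
Proof.
have [C C0 HC] := @reference_poincare R n.+1 k.
have r0 : 0 < refvol R n.+1 by exact: refvol_gt0.
(* On the reference simplex the integral is [refvol] times the mean, hence the additional factor. *)
exists (C * (1 + refvol R n.+1)); first by rewrite mulr_ge0// addr_ge0// ltW.
move=> Th T q nT qk; have c0 := cellvol_gt0 nT; rewrite /cell_mean.
have [p [pk -> -> ->]] := cell_pullback nT qk.
have S0 : 0 <= refint (spread p p) by apply: Rintegral_ge0 => t; exact: spread_ge0.
move: (HC _ pk) S0; move: (refint (spread p p)) (refint (p * p)) (refint p) => S I2 I1 H S0.
move: (cellvol T) (refvol R n.+1) c0 r0 => c r c0 r0.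
have cr : 0 <= c / r by rewrite divr_ge0// ltW.
apply: (@le_trans _ _ (c / r * (C * (S + I1 ^+ 2)))); first exact: ler_wpM2l.
have -> : c * (c^-1 * (c / r * I1)) ^+ 2 = c / r * (r^-1 * I1 ^+ 2).
  by field; rewrite ?gt_eqF.
rewrite -(mulrDr (c / r)) (mulrCA (C * _)); apply: ler_wpM2l => //.
rewrite -mulrA; apply: ler_wpM2l => //.
rewrite mulrDl mul1r mulrDr mulVKf ?gt_eqF//.
have : 0 <= r^-1 * I1 ^+ 2 by rewrite mulr_ge0 ?sqr_ge0// invr_ge0 ltW.
have : 0 <= r * S by rewrite mulr_ge0// ltW.
lra.
Qed.

End cell_estimates.

(** * Neighbouring elements *)

Lemma continuous_dotr_grad (R : realType) (d : nat) (w : 'rV[R]_d -> 'rV[R]_d) (f : 'rV[R]_d -> R) :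
  (forall i, continuous (fun x => w x ord0 i)) -> C1 f ->
  continuous (fun x => dotr (w x) (grad f x)).
Proof.
move=> cw [_ cf]; apply: continuous_big_sum => i _; apply: continuous_mul; first exact: cw.
by under eq_fun do rewrite mxE; exact: cf.
Qed.

Section neighbours.
Context (R : realType) (n : nat) (Th : mesh R n.+1) (Om : set 'rV[R]_n.+1).
Hypothesis nd : forall T, T \in elts Th -> Defs.nondegenerate T.
Hypothesis conf : forall T T', T \in elts Th -> T' \in elts Th -> conforming T T'.
Local Notation act := (active Th Om).
Local Notation side := (cell Th * 'I_(nv Th))%type.
Implicit Types (s : side).

(* A facet seen from one of its elements is encoded by the element and the    *)
(* vertex opposite to the facet.                                              *)
Definition is_side s := (s.1 \in act) && (s.2 \in s.1).

Definition nbr s s' :=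
  [&& is_side s, is_side s', s.1 != s'.1 & s.1 :\ s.2 == s'.1 :\ s'.2].

Lemma nbrC s s' : nbr s s' = nbr s' s.
Proof.
by rewrite /nbr andbCA (eq_sym s.1) (eq_sym (_ :\ _)).
Qed.

Lemma nbrP s s' : nbr s s' ->
  [/\ [/\ s.1 \in act, s.2 \in s.1, s'.1 \in act & s'.2 \in s'.1], s.1 != s'.1 & s.1 :\ s.2 = s'.1 :\ s'.2].
Proof. by case/and4P => /andP[a b] /andP[c e] f /eqP g; split. Qed.

Lemma nbr_flux s s' : nbr s s' ->
  cellvol s.1 *: lamg s.1 s.2 = - (cellvol s'.1 *: lamg s'.1 s'.2).
Proof.
move=> /nbrP[[a b c e] f g].
exact: (flux_neighbour (active_nd nd a) (active_nd nd c) b e f g (conf (active_elts a) (active_elts c))).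
Qed.

Lemma lamg_neq0 (T : cell Th) l : Defs.nondegenerate T -> l \in T -> lamg T l != 0.
Proof.
move=> nT lT; have [m mT ml] := cell_other l nT.
apply/eqP => g0; have := lamg_edge nT mT lT ml.
by rewrite g0 dotr0r => /eqP; rewrite eq_sym oner_eq0.
Qed.

(** At most two elements share a facet: for three of them the vectors |T| grad lam_l would be
    pairwise opposite, hence zero. *)
Lemma nbr_uniq s s1 s2 : nbr s s1 -> nbr s s2 -> s1 = s2.
Proof.
move=> n1 n2; have [[a b c1 e1] f1 g1] := nbrP n1; have [[_ _ c2 e2] f2 g2] := nbrP n2.
have [E|NE] := eqVneq s1.1 s2.1.
  apply/eqP; rewrite -pair_eqE /pair_eq/= E eqxx/=; apply/eqP.
  have := f_equal (fun F : {set _} => s1.2 \in F) (etrans (esym g1) g2).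
  rewrite -E !inE eqxx/= e1 andbT => /esym/eqP.
  exact.
have n3 : nbr s1 s2.
  by rewrite /nbr /is_side c1 e1 c2 e2 NE -g1 -g2 eqxx.
have F1 := nbr_flux n1; have F2 := nbr_flux n2; have F3 := nbr_flux n3.
have /eqP : cellvol s.1 *: lamg s.1 s.2 = - (cellvol s.1 *: lamg s.1 s.2).
  by rewrite {1}F1 F3 opprK F2 opprK.
rewrite -addr_eq0 -mulr2n -scaler_nat scaler_eq0 pnatr_eq0/= scaler_eq0.
by rewrite (negbTE (lamg_neq0 (active_nd nd a) b)) gt_eqF// (cellvol_gt0 (active_nd nd a)).
Qed.

Lemma nbr_antisym_sum (w : side -> side -> R) :
  (forall s s', nbr s s' -> w s s' = - w s' s) ->
  \sum_s \sum_(s' | nbr s s') w s s' = 0.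
Proof.
move=> wN; set S := LHS; apply/eqP.
have : S = - S.
  rewrite {2}/S (exchange_big_dep predT)//= -sumrN; apply: eq_bigr => s _.
  by rewrite -sumrN; apply: eq_big => [s'|s' /wN //]; exact: nbrC.
by move/eqP; rewrite -addr_eq0 -mulr2n mulrn_eq0.
Qed.

(** By [nbr_uniq], a sum over the neighbours of a side means the value across the facet; for a side
    without neighbour it is 0 ([nbr_sum0]). *)
Lemma nbr_sum s (f : side -> R) s' : nbr s s' -> \sum_(s1 | nbr s s1) f s1 = f s'.
Proof.
move=> ns; rewrite (bigD1 s')//= big1 ?addr0// => s1 /andP[n1 /eqP n1s].
by case: n1s; exact: nbr_uniq n1 ns.
Qed.

Lemma nbr_sum0 s (f : side -> R) : (forall s', ~~ nbr s s') -> \sum_(s1 | nbr s s1) f s1 = 0.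
Proof. by move=> N; rewrite big1// => s1; rewrite (negbTE (N s1)). Qed.

Lemma nbr_case s : (exists s', nbr s s') \/ (forall s', ~~ nbr s s').
Proof.
case: (boolP [exists s', nbr s s']) => [/existsP|/existsPn]; first by left.
by right.
Qed.

Lemma hull_bary (T F : cell Th) x : Defs.nondegenerate T -> F \subset T -> (forall i, i \in F -> 0 <= lam T i x) ->
  (forall i, i \notin F -> lam T i x = 0) -> hull F x.
Proof.
move=> nT FT h0 h1; rewrite (hullE nT FT); split => // i.
by have [|/h1 ->] := boolP (i \in F); first exact: h0.
Qed.

(** If a further active element contains x, conformity forces it to contain the whole facet. If not,
    the active mesh coincides with [T] near x, although moving away from the vertex [l] leaves
    [T]. *)
Lemma facet_interior_nbr T l x : T \in act -> l \in T ->
  (forall i, i \in T :\ l -> 0 < lam T i x) -> lam T l x = 0 -> interior (OmT Th Om) x ->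
  exists s', nbr (T, l) s'.
Proof.
move=> aT lT xF xl Ux; have nT := active_nd nd aT; have [cT _] := nT.
have hx : hull T x.
  rewrite (hull_cellE nT) => i; have [->|il] := eqVneq i l; first by rewrite xl.
  have [iT|iT] := boolP (i \in T); last by rewrite lam_notin.
  by apply/ltW/xF; rewrite !inE il.
have [[T' [aT' TT' hT']]|] := pselect (exists T', [/\ T' \in act, T' != T & hull T' x]).
  have nT' := active_nd nd aT'; have [cT' _] := nT'.
  have sub : T :\ l \subset T'.
    have : (hull T `&` hull T') x by [].
    rewrite (conf (active_elts aT) (active_elts aT')) (hullE nT (finset.subsetIl T T')) => -[_ H].
    apply/fintype.subsetP => i iF.
    have iT : i \in T by move: iF; rewrite !inE => /andP[].
    apply/negPn/negP => iT'; have := xF _ iF.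
    by rewrite H ?ltxx// inE (negbTE iT') andbF.
  have cF : #|T :\ l| = n.+1 by move: cT; rewrite (cardsD1 l) lT => -[].
  have /fintype.subsetPn[l' lT' lF'] : ~~ (T' \subset T :\ l).
    by apply/negP => /subset_leq_card; rewrite cT' cF ltnn.
  exists (T', l'); rewrite /nbr /is_side/= aT lT aT' lT' eq_sym TT'/=.
  rewrite eqEcard; apply/andP; split.
    apply/fintype.subsetP => i iF; rewrite !inE (fintype.subsetP sub)// andbT.
    by apply: contraNneq lF' => <-.
  by rewrite cF; move: cT'; rewrite (cardsD1 l') lT' add1n => -[] ->.
move=> none; exfalso.
have near_x : \forall y \near x, hull T y.
  have Uo : \forall y \near x, OmT Th Om y by exact: Ux.
  have N : \forall y \near x, forall T', T' \in act -> T' != T -> ~ hull T' y.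
    apply: (@filter_forall _ _ (fun (T' : cell Th) (y : 'rV[R]_n.+1) =>
      T' \in act -> T' != T -> ~ hull T' y) (nbhs x) _) => T'.
    have [/andP[aT' TT']|/negP H] := boolP ((T' \in act) && (T' != T)); last first.
      by apply: filterE => y aT' TT'; case: H; rewrite aT'.
    have oC : open (~` hull T') by apply: closed_openC; apply: closed_hull; exact: active_nd aT'.
    have : \forall y \near x, (~` hull T') y.
      by apply: open_nbhs_nbhs; split => // hx'; apply: none; exists T'.
    by apply: filterS => y.
  near=> y.
  have [T' aT' hy] : OmT Th Om y by near: y.
  have [<-//|TT'] := eqVneq T' T.
  have : ~ hull T' y by apply: (near N y).
  by [].
(* Along this ray [lam T l] takes the value -s. *)
pose g (s : R) := x + s *: (x - vert l).
have g0 : g 0 = x by rewrite /g scale0r addr0.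
have cg : {for 0, continuous g}.
  apply: continuousD; first exact: cst_continuous.
  by apply: continuousZl => //; exact: id_continuous.
have : \forall s \near (0 : R), hull T (g s) by apply: cg; rewrite g0.
move=> /nbhs_ballP[e /= e0 He].
have : hull T (g (e / 2)).
  by apply: He; rewrite /ball/= sub0r normrN gtr0_norm ?divr_gt0// gtr_pMr// invf_lt1 ?ltr1n.
rewrite (hull_cellE nT) => /(_ l); rewrite /g lamD dotrZr lam_diff xl lam_vert// eqxx add0r sub0r mulrN1.
by rewrite oppr_ge0 leNgt divr_gt0.
Unshelve. all: by end_near. Qed.

(** The point is moved slightly towards the barycentre of the facet: it stays in the interior of the
    active domain, which is open, and reaches the relative interior of the facet, where
    [facet_interior_nbr] applies. *)
Lemma facet_outside T l x : T \in act -> l \in T -> (forall s', ~~ nbr (T, l) s') ->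
  hull (T :\ l) x -> ~ interior (OmT Th Om) x.
Proof.
move=> aT lT Nn hx Ux; have nT := active_nd nd aT.
move: hx; rewrite (hullE nT (subsetDl _ _)) => -[x0 xF].
have [cT _] := nT.
have cF : #|T :\ l| = n.+1 by move: cT; rewrite (cardsD1 l) lT => -[].
pose w i : R := if i \in T :\ l then n.+1%:R^-1 else 0.
pose b := \sum_i w i *: vert i : 'rV[R]_n.+1.
have w1 : \sum_i w i = 1.
  by rewrite /w -big_mkcond/= sumr_const cF -[_ *+ _]mulr_natl divff ?pnatr_eq0.
have lb i : lam T i b = w i.
  have [iT|iT] := boolP (i \in T).
    by apply: lam_comb => // j jT; rewrite /w !inE (negbTE jT) andbF.
  by rewrite lam_notin// /w !inE (negbTE iT) andbF.
pose g (s : R) := x + s *: (b - x).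
have g0 : g 0 = x by rewrite /g scale0r addr0.
have cg : {for 0, continuous g}.
  apply: continuousD; first exact: cst_continuous.
  by apply: continuousZl => //; exact: id_continuous.
have oU := @open_interior _ (OmT Th Om).
have : \forall s \near (0 : R), interior (OmT Th Om) (g s).
  by apply: cg; rewrite g0; apply: open_nbhs_nbhs.
move=> /nbhs_ballP[e /= e0 He].
pose s := Num.min (e / 2) (1 / 2).
have s0 : 0 < s by rewrite lt_min !divr_gt0.
have s1 : s <= 1 / 2 by rewrite ge_min lexx orbT.
have Us : interior (OmT Th Om) (g s).
  apply: He; rewrite /ball/= sub0r normrN gtr0_norm//.
  by apply: (@le_lt_trans _ _ (e / 2)); [rewrite ge_min lexx|rewrite gtr_pMr// invf_lt1 ?ltr1n].
have lg i : lam T i (g s) = (1 - s) * lam T i x + s * w i.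
  rewrite /g lamD dotrZr lam_diff lb; ring.
have gF i : i \in T :\ l -> 0 < lam T i (g s).
  move=> iF; rewrite lg /w iF; apply: ltr_wpDl.
    by rewrite mulr_ge0// subr_ge0; lra.
  by rewrite mulr_gt0// invr_gt0.
have gl : lam T l (g s) = 0.
  by rewrite lg xF ?/w !inE eqxx//= !mulr0 addr0.
have [s' ns'] := facet_interior_nbr aT lT gF gl Us.
by have := Nn s'; rewrite ns'.
Qed.

Lemma facet_flux_ext (T : cell Th) l f g : Defs.nondegenerate T -> l \in T ->
  (forall x, hull (T :\ l) x -> f x = g x) -> facet_flux (T :\ l) f = facet_flux (T :\ l) g.
Proof.
move=> nT lT fg; have [cT _] := nT.
have cF : #|T :\ l| = n.+1 by move: cT; rewrite (cardsD1 l) lT => -[].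
apply: eq_bigr => m mF; rewrite /facet_mean; congr (_ * _).
apply: eq_Rintegral => y yD; rewrite fg//.
move: yD; rewrite inE => -[y0 y1].
have [lm mT] : l != m /\ m \in T by move: mF; rewrite !inE eq_sym => /andP.
rewrite -(cell_chart_hypotenuse T l m).
apply: (hull_bary nT (subsetDl _ _)).
  move=> i iF; have [j <-] := facet_enum_surj cF mF iF.
  rewrite lam_cell_chart// mxE; case: unliftP => [h _|_] /=; first exact: y0.
  by rewrite subr_ge0.
move=> i; rewrite !inE negb_and negbK => /orP[/eqP ->|iT]; last by rewrite lam_notin.
rewrite lam_cell_chart_apex// big_ord_recl !mxE unlift_none/=.
under [X in _ - (_ + X)]eq_bigr do rewrite /consrow mxE liftK.
by rewrite subrK subrr.
Qed.

(** Read off from [Rintegral_hull_apex], so that homogeneity reduces to that of integrals over the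
    element. *)
Lemma facet_fluxZ (T : cell Th) l c f : Defs.nondegenerate T -> l \in T -> C1 f ->
  facet_flux (T :\ l) (fun x => c * f x) = c * facet_flux (T :\ l) f.
Proof.
move=> nT lT Cf; have cv := cellvol_gt0 nT.
have Cc : C1 (fun _ : 'rV[R]_n.+1 => c).
  by rewrite (_ : (fun=> c) = peval (mpoly.mpolyC n.+1 c)); [exact: C1_peval|apply/funext => x; rewrite pevalC].
have g0 x : grad (fun _ : 'rV[R]_n.+1 => c) x = 0.
  by apply/rowP => i; rewrite !mxE /partial derive_cst.
apply: (mulfI (lt0r_neq0 cv)).
rewrite -Rintegral_hull_apex//; last exact: C1M.
rewrite mulrCA -Rintegral_hull_apex// -RintegralZl//; last 2 first.
- exact: measurable_hull.
- apply: integrable_hull => //; apply: continuous_add; last first.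
    by apply: continuous_mul; [exact: continuous_const|exact: C1_continuous].
  apply: continuous_dotr_grad => // i; under eq_fun do rewrite !mxE.
  by apply: continuous_add; [exact: coord_continuous|exact: continuous_const].
apply: eq_Rintegral => x _; have [df _] := Cf; have [dc _] := Cc.
by rewrite gradM// g0 scaler0 addr0 dotrZr mulrDr (mulrCA c).
Qed.

End neighbours.

(** * Conforming Raviart-Thomas fields *)

Section apex_fields.
Context (R : realType) (n k : nat) (Th : mesh R n.+1).
Local Notation mpol := (mpoly.mpoly n.+1 R).
Implicit Types (T : cell Th) (r : 'I_(nv Th) -> mpol) (v : {ffun 'I_n.+1 -> mpol}).

Definition poly_div (v : 'I_n.+1 -> mpol) : mpol := \sum_i mpoly.mderiv i (v i).

Lemma mderiv_mpolyX i j :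
  mpoly.mderiv i (mpoly.mpolyX R (mpoly.mnm1 j) : mpol) = mpoly.mpolyC n.+1 (i == j)%:R.
Proof.
rewrite mpoly.mderivX mpoly.mnm1E eq_sym; have [->|ij] := eqVneq i j.
  rewrite (_ : mpoly.mnm_sub _ _ = mpoly.mnm0); first by rewrite mpoly.mpolyX0 scale1r.
  by apply/mpoly.mnmP => h; rewrite mpoly.mnmBE subnn mpoly.mnm0E.
by rewrite scale0r.
Qed.

(** The field x - a_l is, up to scaling, the lowest-order Raviart-Thomas function of the facet
    opposite to a_l. The coefficient [r l] therefore governs the normal flux through that facet
    only. *)
Definition apex_field T r : {ffun 'I_n.+1 -> mpol} :=
  [ffun i => \sum_(l in T) r l * (mpoly.mpolyX R (mpoly.mnm1 i) - mpoly.mpolyC n.+1 (vert l ord0 i))].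

Lemma RT_apex_field T r : (forall l, l \in T -> deg_le k (r l)) -> RT_local k (apex_field T r).
Proof.
move=> rk.
exists (fun i => - \sum_(l in T) (vert l ord0 i *: r l)), (\sum_(l in T) r l); split.
- move=> i; rewrite mpoly.msizeN; apply: deg_le_sum => l lT.
  by apply: deg_leZ; exact: rk.
- exact: deg_le_sum.
move=> i; rewrite ffunE mulr_suml -sumrN -big_split; apply: eq_bigr => l _ /=.
by rewrite -mpoly.mul_mpolyC; ring.
Qed.

Lemma pveval_apex_field T r x :
  pveval (apex_field T r) x = \sum_(l in T) peval (r l) x *: (x - vert l).
Proof.
apply/rowP => i; rewrite mxE summxE ffunE peval_sum; apply: eq_bigr => l _.
by rewrite pevalM pevalB pevalX pevalC !mxE.
Qed.

Lemma peval_poly_div_apex_field T r x : peval (poly_div (apex_field T r)) x =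
  \sum_(l in T) (dotr (x - vert l) (grad (peval (r l)) x) + n.+1%:R * peval (r l) x).
Proof.
rewrite /poly_div peval_sum.
transitivity (\sum_(i < n.+1) \sum_(l in T)
    ((x - vert l) ord0 i * peval (mpoly.mderiv i (r l)) x + peval (r l) x)).
  apply: eq_bigr => i _; rewrite ffunE linear_sum/= peval_sum; apply: eq_bigr => l _.
  rewrite mpoly.mderivM pevalD !pevalM mpoly.mderivB mpoly.mderivC subr0 !pevalB pevalX pevalC.
  by rewrite mderiv_mpolyX eqxx pevalC mulr1 !mxE mulrC.
rewrite exchange_big; apply: eq_bigr => l _ /=.
rewrite big_split/= sumr_const card_ord mulr_natl; congr (_ + _).
by apply: eq_bigr => i _; rewrite [grad _ _ _ _]mxE partial_peval.
Qed.

Lemma apex_field_flux T r f : Defs.nondegenerate T -> C1 f ->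
  \int[vol R n.+1]_(x in hull T) (dotr (pveval (apex_field T r) x) (grad f x) +
    peval (poly_div (apex_field T r)) x * f x) =
  \sum_(l in T) cellvol T * facet_flux (T :\ l) (fun x => peval (r l) x * f x).
Proof.
move=> nT Cf.
pose g l x := dotr (x - vert l) (grad (fun x => peval (r l) x * f x) x) +
  n.+1%:R * (peval (r l) x * f x).
have CH l : C1 (fun x => peval (r l) x * f x) by apply: C1M => //; exact: C1_peval.
have cg l : continuous (g l).
  apply: continuous_add; last first.
    by apply: continuous_mul; [exact: continuous_const|apply: C1_continuous].
  apply: continuous_dotr_grad => // i.
  under eq_fun do rewrite !mxE.
  by apply: continuous_add; [exact: coord_continuous|exact: continuous_const].
transitivity (\int[vol R n.+1]_(x in hull T) \sum_(l in T) g l x).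
  apply: eq_Rintegral => x _; rewrite pveval_apex_field peval_poly_div_apex_field.
  rewrite dotr_suml mulr_suml -big_split; apply: eq_bigr => l _ /=.
  have [df _] := Cf; rewrite /g gradM//; last exact: differentiable_peval.
  rewrite dotrDr !dotrZr dotrZl; ring.
rewrite (_ : \int[vol R n.+1]_(x in hull T) _ = \sum_(l in T) \int[vol R n.+1]_(x in hull T) g l x).
  by apply: eq_bigr => l lT; rewrite -Rintegral_hull_apex.
elim: (index_enum _) => [|l s IH].
  rewrite big_nil; under eq_Rintegral do rewrite big_nil.
  by rewrite Rintegral_cst ?mul0r//; exact: measurable_hull.
rewrite big_cons; under eq_Rintegral do rewrite big_cons.
case: ifP => // lT; rewrite RintegralD//; first by rewrite IH.
- exact: measurable_hull.
- exact: integrable_hull.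
- by apply: integrable_hull => //; apply: continuous_big_sum.
Qed.

End apex_fields.

Section spaces.
Context (R : realType) (n k : nat) (Th : mesh R n.+1) (Om : set 'rV[R]_n.+1).
Hypothesis nd : forall T, T \in elts Th -> Defs.nondegenerate T.
Hypothesis conf : forall T T', T \in elts Th -> T' \in elts Th -> conforming T T'.
Local Notation act := (active Th Om).
Local Notation mu := (vol R n.+1).
Local Notation U := (interior (OmT Th Om)).
Local Notation bscal := (bscal Th).
Local Notation bvec := (bvec Th).
Implicit Types (T : cell Th) (q : bscal) (v : bvec).

Lemma piecewise_op (op : R -> R -> R) (F G : cell Th -> 'rV[R]_n.+1 -> R) x : op 0 0 = 0 ->
  op (piecewise Om F x) (piecewise Om G x) = piecewise Om (fun T y => op (F T y) (G T y)) x.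
Proof. by move=> op0; rewrite /piecewise; case: pick_cell. Qed.

Lemma piecewiseMr (F : cell Th -> 'rV[R]_n.+1 -> R) (g : 'rV[R]_n.+1 -> R) x :
  piecewise Om F x * g x = piecewise Om (fun T y => F T y * g y) x.
Proof. by rewrite /piecewise; case: pick_cell => [T|]; rewrite ?mul0r. Qed.

Lemma evalE q : Defs.eval Om q = piecewise Om (fun T => peval (q T)).
Proof. by []. Qed.

Lemma vevalE v x i : veval Om v x ord0 i = piecewise Om (fun T => peval (v T i)) x.
Proof.
rewrite /veval /piecewise /pick_cell; case: pickP => [T _|_]; by rewrite mxE.
Qed.

Lemma veval_dotr v (w : 'rV[R]_n.+1 -> 'rV[R]_n.+1) x :
  dotr (veval Om v x) (w x) = piecewise Om (fun T y => dotr (pveval (v T) y) (w y)) x.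
Proof.
rewrite /veval /piecewise /pick_cell; case: pickP => [T _|_] //.
by rewrite dotr0l.
Qed.

Lemma veval_vdotr u v x : dotr (veval Om u x) (veval Om v x) =
  piecewise Om (fun T y => dotr (pveval (u T) y) (pveval (v T) y)) x.
Proof.
rewrite /veval /piecewise /pick_cell; case: pickP => [T _|_] //.
by rewrite dotr0l.
Qed.

Lemma eval_linear c q q' : Defs.eval Om (c *: q + q') = (fun x => c * Defs.eval Om q x + Defs.eval Om q' x).
Proof.
apply/funext => x; rewrite !evalE /piecewise.
case: pick_cell => [T|]; last by rewrite mulr0 addr0.
by rewrite !ffunE pevalD pevalZ.
Qed.

Lemma veval_linear c u v x : veval Om (c *: u + v) x = c *: veval Om u x + veval Om v x.
Proof.
rewrite /veval; case: pickP => [T _|_]; last by rewrite scaler0 addr0.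
by apply/rowP => i; rewrite !mxE !ffunE pevalD pevalZ.
Qed.

Lemma bdiv_linear c u v : bdiv (c *: u + v) = c *: bdiv u + bdiv v.
Proof.
apply/ffunP => T; rewrite !ffunE scaler_sumr -big_split; apply: eq_bigr => i _.
by rewrite !ffunE linearP.
Qed.

Lemma fin_mu_OmT S : measurable S -> S `<=` OmT Th Om -> (mu S < +oo)%E.
Proof. by move=> mS SO; apply: vol_bounded => //; apply: sub_bounded SO (bounded_OmT _ _). Qed.

Lemma L2_piecewise S (F : cell Th -> 'rV[R]_n.+1 -> R) : measurable S ->
  (forall T, T \in act -> continuous (F T)) -> L2 mu S (piecewise Om F).
Proof.
move=> mS cF; split.
  by apply: measurable_funS (measurable_piecewise nd conf cF).
have [/integrableP[_ iF] _] := @integrable_piecewise _ _ _ Om nd conf S (fun T y => F T y * F T y) mS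
  (fun T aT => continuous_mul (cF T aT) (cF T aT)).
apply: le_lt_trans iF; rewrite le_eqVlt; apply/orP; left; apply/eqP.
apply: eq_integral => x _ /=.
by rewrite -piecewise_op ?mulr0// ger0_norm -expr2 ?sqr_ge0.
Qed.

Lemma L2_eval S q : measurable S -> L2 mu S (Defs.eval Om q).
Proof. by move=> mS; apply: L2_piecewise => // T _; exact: continuous_peval. Qed.

Lemma Rintegral_support (S D : set 'rV[R]_n.+1) (f : 'rV[R]_n.+1 -> R) : S `<=` D ->
  (forall x, ~ S x -> f x = 0) -> \int[mu]_(x in S) f x = \int[mu]_(x in D) f x.
Proof.
move=> SD f0; rewrite Rintegral_mkcond [RHS]Rintegral_mkcond; apply: eq_Rintegral => x _.
rewrite !patchE; case: ifPn; case: ifPn => //.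
  by rewrite notin_setE => xD /set_mem /SD.
by move=> _; rewrite notin_setE => /f0.
Qed.

Lemma piecewise_integral_support (F : cell Th -> 'rV[R]_n.+1 -> R) :
  (forall T, T \in act -> continuous (F T)) ->
  (forall T x, ~ U x -> F T x = 0) ->
  \int[mu]_(x in U) piecewise Om F x = \sum_(T in act) \int[mu]_(x in hull T) F T x.
Proof.
move=> cF F0; rewrite (@Rintegral_support _ (OmT Th Om)).
- exact: Rintegral_OmT.
- exact: interior_subset.
by move=> x Ux; rewrite /piecewise; case: pick_cell => // T; exact: F0.
Qed.

Lemma test_function_C1 phi : test_function U phi -> C1 phi.
Proof. by move=> [/smooth_C1]. Qed.

Lemma test_function_out phi x : test_function U phi -> ~ U x -> phi x = 0 /\ grad phi x = 0.
Proof.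
move=> [sm _ sU] nU.
have nx : ~ closure [set x | phi x <> 0] x by move=> /sU.
have N : \forall y \near x, phi y = 0.
  have oC : open (~` closure [set x | phi x <> 0]) by apply: closed_openC; exact: closed_closure.
  have : \forall y \near x, (~` closure [set x | phi x <> 0]) y by apply: open_nbhs_nbhs.
  apply: filterS => y cy; apply/eqP/negPn/negP => /eqP py; apply: cy; exact: subset_closure.
split; first exact: (nbhs_singleton N).
apply/rowP => i; rewrite !mxE /partial (near_eq_derive (g := fun=> 0)) ?derive_cst//.
Qed.

(** By Green's formula each summand is the boundary flux of [v] on an element weighted by the test
    function; if they cancel, the elementwise divergence is the weak one. *)
Lemma Hdiv_criterion v :
  (forall phi, test_function U phi -> \sum_(T in act) \int[mu]_(x in hull T)
     (dotr (pveval (v T) x) (grad phi x) + peval (poly_div (v T)) x * phi x) = 0) ->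
  Hdiv U (veval Om v).
Proof.
move=> H; have mU : measurable U by apply: open_measurable_rV; exact: open_interior.
split.
  move=> i; rewrite (_ : (fun x => _) = piecewise Om (fun T => peval (v T i))).
    by apply: L2_piecewise => // T _; exact: continuous_peval.
  by apply/funext => x; rewrite vevalE.
exists (Defs.eval Om (bdiv v)); split; first exact: L2_eval.
move=> phi tphi; have Cp := test_function_C1 tphi; have p0 x := @test_function_out _ x tphi.
have cvg T : continuous (fun x => dotr (pveval (v T) x) (grad phi x)).
  by apply: continuous_dotr_grad => // i; under eq_fun do rewrite mxE; exact: continuous_peval.
have cdp T : continuous (fun x => peval (bdiv v T) x * phi x).
  by apply: continuous_mul; [exact: continuous_peval|exact: C1_continuous].
under eq_Rintegral do rewrite veval_dotr.
under [in RHS]eq_Rintegral do rewrite evalE piecewiseMr.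
rewrite !piecewise_integral_support//; last 2 first.
- by move=> T x /p0[-> _]; rewrite mulr0.
- by move=> T x /p0[_ ->]; rewrite dotr0r.
apply/eqP; rewrite -addr_eq0 -big_split/=; apply/eqP; rewrite -[RHS](H _ tphi).
apply: eq_bigr => T aT; have nT := active_nd nd aT; rewrite -RintegralD//.
- by apply: eq_Rintegral => x _; rewrite ffunE.
- exact: measurable_hull.
- exact: integrable_hull.
- exact: integrable_hull.
Qed.

Variables (c : cell Th * 'I_(nv Th) -> R) (p : cell Th -> 'I_(nv Th) -> mpoly.mpoly n.+1 R).
Hypothesis cflux : forall s s', nbr Om s s' -> cellvol s.1 * c s = - (cellvol s'.1 * c s').
Hypothesis pdeg : forall T l, T \in act -> l \in T -> deg_le k (lamp T l * p T l).

(** The constant carries the flux through the facet opposite to [l]. The other term vanishes on this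
    facet and is a bubble. [cflux] requires that the fluxes seen from both sides be opposite. *)
Let r T l := mpoly.mpolyC n.+1 (c (T, l)) + lamp T l * p T l.

Definition conforming_field : bvec := [ffun T => if T \in act then apex_field T (r T) else 0].

Lemma Sigmah_conforming_field : Sigmah k Th Om conforming_field.
Proof.
split=> [T|].
  rewrite ffunE; split=> [aT|/negbTE -> //]; rewrite aT; apply: RT_apex_field => l lT.
  by apply: deg_leD; [exact: deg_leC|exact: pdeg].
apply: Hdiv_criterion => phi tphi.
have Cp := test_function_C1 tphi; have p0 x := @test_function_out _ x tphi.
pose g (s : cell Th * 'I_(nv Th)) := cellvol s.1 * c s * facet_flux (s.1 :\ s.2) phi.
transitivity (\sum_(T in act) \sum_(l in T) g (T, l)).
  apply: eq_bigr => T aT; have nT := active_nd nd aT; rewrite ffunE aT.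
  rewrite (apex_field_flux _ nT Cp); apply: eq_bigr => l lT.
  rewrite /g -mulrA; congr (_ * _); rewrite -facet_fluxZ//; apply: facet_flux_ext => // x.
  rewrite (hullE nT (subsetDl _ _)) => -[_ /(_ l)]; rewrite !inE eqxx => /(_ isT) ll.
  by rewrite pevalD pevalM pevalC peval_lamp ll mul0r addr0.
rewrite pair_big_dep/=.
have [E1 E2] : (forall s, is_side Om s -> g s = \sum_(s' | nbr Om s s') g s) /\
    (forall s, ~~ is_side Om s -> \sum_(s' | nbr Om s s') g s = 0).
  split=> s; last first.
    by move=> ns; rewrite big1// => s'; rewrite /nbr (negbTE ns).
  move=> sd; have [[s' ns]|N] := nbr_case Om s; first by rewrite (nbr_sum nd conf (fun=> g s) ns).
  (* A side without neighbour lies outside the interior of the active domain, where the test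
     function vanishes. *)
  rewrite (nbr_sum0 (fun=> g s) N) /g.
  case: s sd N => T l /andP[/= aT lT] N; have nT := active_nd nd aT.
  rewrite (@facet_flux_ext _ _ _ _ _ _ (fun x => 0 * phi x))//.
    by rewrite facet_fluxZ// mul0r mulr0.
  by move=> x /(facet_outside nd conf aT lT N) /p0[-> _]; rewrite mul0r.
transitivity (\sum_s \sum_(s' | nbr Om s s') g s).
  rewrite [RHS](bigID (is_side Om))/= [X in _ = _ + X]big1 ?addr0; last by move=> s /E2.
  by apply: eq_big => -[T l] // sd; exact: E1.
apply: (nbr_antisym_sum (w := fun s _ => g s)) => s s' ns.
have [_ _ FF] := nbrP ns; rewrite /g FF (cflux ns); ring.
Qed.

End spaces.

(** * Linear structure and finite dimension of the discrete spaces *)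

Section finite_elements.
Context (R : realType) (n k : nat) (Th : mesh R n.+1) (Om : set 'rV[R]_n.+1).
Hypothesis nd : forall T, T \in elts Th -> Defs.nondegenerate T.
Hypothesis conf : forall T T', T \in elts Th -> T' \in elts Th -> conforming T T'.
Local Notation act := (active Th Om).
Local Notation mu := (vol R n.+1).
Local Notation U := (interior (OmT Th Om)).
Local Notation bscal := (bscal Th).
Local Notation bvec := (bvec Th).
Local Notation mpol := (mpoly.mpoly n.+1 R).

Lemma lspace_Qh : lspace (Qh k Th Om).
Proof.
split=> [T|c q q' Vq Vq' T]; first by rewrite ffunE mpoly.msize0.
have [q1 q2] := Vq T; have [q1' q2'] := Vq' T; rewrite !ffunE; split=> aT.
  by apply: deg_leD; [apply: deg_leZ; exact: q1|exact: q1'].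
by rewrite q2// q2'// scaler0 addr0.
Qed.

Lemma deg_le_RT_local (v : 'I_n.+1 -> mpol) : RT_local k v -> forall i, deg_le k.+1 (v i).
Proof.
move=> [a [b [ak bk vE]]] i; rewrite vE; apply: deg_leD; first exact: leqW (ak i).
by rewrite -[X in deg_le X _]addn1; apply: deg_le_mul => //; exact: deg_leX.
Qed.

(** The divergence of b x is x . grad b + d b, of the degree of [b]. The degree k = 0 is apart
    because one cannot lower it before multiplying by x. *)
Lemma deg_le_poly_div (v : 'I_n.+1 -> mpol) : RT_local k v -> deg_le k (poly_div v).
Proof.
move=> [a [b [ak bk vE]]]; apply: deg_le_sum => i _; rewrite vE linearD/= mpoly.mderivM.
apply: deg_leD; first by apply: deg_le_mderiv; exact: ak.
apply: deg_leD.
  case: k {a ak vE} bk => [|k'] bk.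
    have /eqP -> : mpoly.mderiv i b == 0 by rewrite -mpoly.msize_poly_eq0 -leqn0 (msize_mderiv i bk).
    by rewrite mul0r mpoly.msize0.
  rewrite -[X in deg_le X _]addn1; apply: deg_le_mul; last exact: deg_leX.
  exact: msize_mderiv bk.
rewrite mderiv_mpolyX eqxx -[X in deg_le X _]addn0; apply: deg_le_mul => //.
exact: deg_leC.
Qed.

(** The inclusion of div Sigma_h in Q_h: a field orthogonal to Q_h under b_h may be tested with its
    own divergence. *)
Lemma bdiv_Qh v : Sigmah k Th Om v -> Qh k Th Om (bdiv v).
Proof.
move=> [vT _] T; have [v1 v2] := vT T; rewrite ffunE; split=> aT.
  by apply: deg_le_poly_div; exact: v1.
by rewrite v2// big1// => i _; rewrite ffunE linear0.
Qed.

Lemma RT_localD c (u v w : 'I_n.+1 -> mpol) : (forall i, w i = c *: u i + v i) ->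
  RT_local k u -> RT_local k v -> RT_local k w.
Proof.
move=> wE [a [b [ak bk uE]]] [a' [b' [ak' bk' vE]]].
exists (fun i => c *: a i + a' i), (c *: b + b'); split.
- by move=> i; apply: deg_leD => //; exact: deg_leZ.
- by apply: deg_leD => //; exact: deg_leZ.
by move=> i; rewrite wE uE vE -!mpoly.mul_mpolyC; ring.
Qed.

Lemma RT_local0 (v : 'I_n.+1 -> mpol) : (forall i, v i = 0) -> RT_local k v.
Proof.
move=> v0; exists (fun=> 0), 0; split; first by move=> _; rewrite mpoly.msize0.
  by rewrite mpoly.msize0.
by move=> i; rewrite v0 mul0r addr0.
Qed.

Lemma measurable_U : measurable U.
Proof. by apply: open_measurable_rV; exact: open_interior. Qed.

Lemma integrable_veval_grad (v : bvec) phi : C1 phi ->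
  mu.-integrable U (EFin \o (fun x => dotr (veval Om v x) (grad phi x))).
Proof.
move=> Cp; rewrite (_ : (fun x => dotr _ _) =
    piecewise Om (fun T y => dotr (pveval (v T) y) (grad phi y))).
  apply: (integrable_piecewise nd conf measurable_U _).1 => T aT.
  by apply: continuous_dotr_grad => // i; under eq_fun do rewrite mxE; exact: continuous_peval.
by apply/funext => x; rewrite veval_dotr.
Qed.

Lemma integrable_mul_test g phi : test_function U phi -> L2 mu U g ->
  mu.-integrable U (EFin \o (fun x => phi x * g x)).
Proof.
move=> tphi Lg; have Cp := C1_continuous (test_function_C1 tphi).
have [M M0 HM] := bounded_sub_cube (bounded_OmT Th Om).
have [K K0 HK] := continuous_bounded_on_cube M Cp.
have UO : U `<=` OmT Th Om by exact: interior_subset.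
apply: (@L2_mul_integrable _ _ _ mu U measurable_U (fin_mu_OmT measurable_U UO) _ _ K set0) => //.
- have [/integrableP[mp _]] : mu.-integrable U (EFin \o phi) /\ True.
    split => //; apply: integrable_continuous => //; first exact: measurable_U.
    exact: sub_bounded UO (bounded_OmT _ _).
  by move=> _; apply/measurable_EFinP.
- by move=> x /UO /HM xM _; exact: HK.
Qed.

Lemma Hdiv0 : Hdiv U (veval Om (0 : bvec)).
Proof.
apply: (Hdiv_criterion nd conf) => phi _; apply: big1 => T aT; have nT := active_nd nd aT.
under eq_Rintegral => x _.
  rewrite (_ : dotr _ _ + _ = 0); first over.
  rewrite (_ : pveval _ x = 0) ?dotr0l ?add0r; last by apply/rowP => i; rewrite !mxE !ffunE peval0.
  rewrite /poly_div big1 ?peval0 ?mul0r// => i _; by rewrite !ffunE linear0.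
by rewrite Rintegral_cst ?mul0r//; exact: measurable_hull.
Qed.

Lemma lspace_Sigmah : lspace (Sigmah k Th Om).
Proof.
have mU := measurable_U.
split=> [|c u v [uT [uL [g [Lg gu]]]] [vT [vL [h [Lh hv]]]]].
  split=> [T|]; last exact: Hdiv0.
  by rewrite ffunE; split=> // aT; apply: RT_local0 => i; rewrite ffunE.
split=> [T|].
  have [u1 u2] := uT T; have [v1 v2] := vT T; rewrite !ffunE; split=> aT.
    apply: (RT_localD (c := c) _ (u1 aT) (v1 aT)) => i; by rewrite !ffunE.
  by rewrite u2// v2// scaler0 addr0.
split=> [i|].
  rewrite (_ : (fun x => _) = (fun x => c * veval Om u x ord0 i + veval Om v x ord0 i)).
    exact: L2_comb.
  by apply/funext => x; rewrite veval_linear !mxE.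
exists (fun x => c * g x + h x); split; first exact: L2_comb.
move=> phi tphi; have Cp := test_function_C1 tphi.
have i1 := integrable_veval_grad u Cp; have i2 := integrable_veval_grad v Cp.
have j1 := integrable_mul_test tphi Lg; have j2 := integrable_mul_test tphi Lh.
transitivity (c * \int[mu]_(x in U) dotr (veval Om u x) (grad phi x) +
    \int[mu]_(x in U) dotr (veval Om v x) (grad phi x)).
  rewrite -RintegralZl// -RintegralD//; last exact: integrable_mulr.
  by apply: eq_Rintegral => x _; rewrite veval_linear dotrDl dotrZl.
rewrite gu// hv// mulrN -opprD; congr (- _).
under eq_Rintegral do rewrite mulrC.
under [in X in _ + X]eq_Rintegral do rewrite mulrC.
under [in RHS]eq_Rintegral do rewrite mulrC mulrDr mulrCA.
rewrite -RintegralZl// -RintegralD//; exact: integrable_mulr.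
Qed.

Lemma spanned_Qh : spanned (Qh k Th Om).
Proof.
pose I := (cell Th * mpoly.bmultinom n.+1 k.+1)%type.
pose f (x : I) : bscal := [ffun T => if T == x.1 then mpoly.mpolyX R (mpoly.bmnm x.2) else 0].
apply: (@sub_inspan _ _ _ [seq f x | x <- index_enum I]) lspace_Qh _ => q Vq.
have -> : q = \sum_(x <- index_enum I) mpoly.mcoeff (mpoly.bmnm x.2) (q x.1) *: f x.
  apply/ffunP => T; rewrite sum_ffunE.
  rewrite -(pair_bigA _ (fun T1 m => (mpoly.mcoeff (mpoly.bmnm m) (q T1) *: f (T1, m)) T))/=.
  rewrite (bigD1 T)//= [X in _ + X]big1 ?addr0; last first.
    by move=> T1 T1T; rewrite big1// => m _; rewrite !ffunE/= eq_sym (negbTE T1T) scaler0.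
  have qT : deg_le k (q T).
    have [q1 q2] := Vq T; have [/q1//|/q2 ->] := boolP (T \in act).
    by rewrite mpoly.msize0.
  rewrite [LHS](mpoly.mpolywE qT); apply: eq_bigr => m _.
  by rewrite !ffunE/= eqxx.
exact: inspan_lincomb.
Qed.

Lemma spanned_Sigmah : spanned (Sigmah k Th Om).
Proof.
pose I := (cell Th * ('I_n.+1 * mpoly.bmultinom n.+1 k.+2))%type.
pose f (x : I) : bvec := [ffun T => [ffun i =>
  if (T == x.1) && (i == x.2.1) then mpoly.mpolyX R (mpoly.bmnm x.2.2) else 0]].
(* The monomial fields are broken and need not belong to the space; they span a larger one. *)
apply: (@sub_inspan _ _ _ [seq f x | x <- index_enum I]) lspace_Sigmah _ => v [vT _].
have -> : v = \sum_(x <- index_enum I) mpoly.mcoeff (mpoly.bmnm x.2.2) (v x.1 x.2.1) *: f x.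
  apply/ffunP => T; apply/ffunP => i; rewrite !sum_ffunE.
  rewrite -(pair_bigA _ (fun T1 y => (mpoly.mcoeff (mpoly.bmnm y.2) (v T1 y.1) *: f (T1, y)) T i))/=.
  rewrite (bigD1 T)//= [X in _ + X]big1 ?addr0; last first.
    by move=> T1 T1T; rewrite big1// => y _; rewrite !ffunE/= eq_sym (negbTE T1T) scaler0.
  rewrite -(pair_bigA _ (fun j m => (mpoly.mcoeff (mpoly.bmnm m) (v T j) *: f (T, (j, m))) T i))/=.
  rewrite (bigD1 i)//= [X in _ + X]big1 ?addr0; last first.
    by move=> j ji; rewrite big1// => m _; rewrite !ffunE/= eqxx/= eq_sym (negbTE ji) scaler0.
  have vTi : deg_le k.+1 (v T i).
    have [v1 v2] := vT T; have [aT|/v2 ->] := boolP (T \in act).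
      exact: deg_le_RT_local (v1 aT) i.
    by rewrite ffunE mpoly.msize0.
  rewrite [LHS](mpoly.mpolywE vTi); apply: eq_bigr => m _.
  by rewrite !ffunE/= !eqxx.
exact: inspan_lincomb.
Qed.

End finite_elements.

(** * Upwind transport *)

Section upwind.
Context (R : realType) (n : nat) (Th : mesh R n.+1) (Om : set 'rV[R]_n.+1).
Hypothesis nd : forall T, T \in elts Th -> Defs.nondegenerate T.
Hypothesis conf : forall T T', T \in elts Th -> T' \in elts Th -> conforming T T'.
Variable B : R.
Local Notation act := (active Th Om).
Local Notation side := (cell Th * 'I_(nv Th))%type.
Implicit Types (s : side) (m : cell Th -> R).

(* The average over the facet of the weight [x_0 + B], an increasing function *)
(* in the direction [e_0] of the transport.                                   *)
Definition facet_weight s : R := n.+1%:R^-1 * \sum_(i in s.1 :\ s.2) (vert i ord0 ord0 + B).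

(** The outward flux of (x_0 + B) e_0 through the facet divided by (n + 1) |T|, since minus grad
    lam_l is an outward normal of length |F| / ((n + 1) |T|). It is nonnegative where the transport
    leaves the element. *)
Definition inflow s : R := - lamg s.1 s.2 ord0 ord0 * facet_weight s.

(** The own mean where the transport leaves the element, that of the neighbour where it enters, and
    0 where it enters through the boundary, the sum being empty there. *)
Definition upwind m s : R :=
  if 0 <= inflow s then m s.1 else \sum_(s' | nbr Om s s') m s'.1.

Lemma nbr_inflow s s' : nbr Om s s' -> cellvol s.1 * inflow s = - (cellvol s'.1 * inflow s').
Proof.
move=> ns; have [_ _ FF] := nbrP ns.
have /rowP /(_ ord0) := nbr_flux nd conf ns; rewrite !mxE => E.
by rewrite /inflow /facet_weight FF mulrA mulrN E opprK [in RHS]mulrA mulrN mulNr opprK.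
Qed.

(** The divergence of (x_0 + B) e_0 is 1. The divergence theorem is algebraic here: sum lam_l a_l =
    x and sum lam_l = 1 are differentiated along e_0. *)
Lemma sum_inflow T : T \in act -> n.+1%:R * \sum_(l in T) inflow (T, l) = 1.
Proof.
move=> aT; have nT := active_nd nd aT.
pose P (i : 'I_(nv Th)) := vert i ord0 ord0 + B : R; pose S := \sum_(i in T) P i.
have S1 l : l \in T -> \sum_(i in T :\ l) P i = S - P l.
  move=> lT; rewrite /S [in RHS](bigD1 l lT)/= addrAC subrr add0r.
  by apply: eq_bigl => i; rewrite !inE andbC.
have outT (F : 'I_(nv Th) -> R) : \sum_(l in T) lamg T l ord0 ord0 * F l = \sum_l lamg T l ord0 ord0 * F l.
  rewrite [RHS](bigID (mem T))/= [X in _ = _ + X]big1 ?addr0// => i iT.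
  by rewrite lamg_notin// mxE mul0r.
have L1 : \sum_l lamg T l ord0 ord0 * vert l ord0 ord0 = 1.
  have /rowP /(_ ord0) := lamg_vert_sum nT (delta_mx ord0 ord0).
  rewrite summxE mxE !eqxx/= => E; rewrite -[RHS]E; apply: eq_bigr => l _.
  by rewrite mxE dotrC dotr_delta.
have L0 : \sum_l lamg T l ord0 ord0 = 0.
  by have /rowP /(_ ord0) := lamg_sum nT; rewrite summxE mxE.
have -> : \sum_(l in T) inflow (T, l) =
    n.+1%:R^-1 * (\sum_(l in T) lamg T l ord0 ord0 * P l - \sum_(l in T) lamg T l ord0 ord0 * S).
  rewrite -sumrB mulr_sumr; apply: eq_bigr => l lT.
  by rewrite /inflow /facet_weight/= S1//; ring.
rewrite !outT -mulr_suml L0 mul0r subr0 mulVKf ?pnatr_eq0//.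
under eq_bigr do rewrite mulrDr.
by rewrite big_split/= L1 -mulr_suml L0 mul0r addr0.
Qed.

(** Both sides of a facet select the same upwind value; where the flux is zero the selection may
    differ, but both products vanish. *)
Lemma upwind_flux m s s' : nbr Om s s' ->
  cellvol s.1 * (inflow s * upwind m s) = - (cellvol s'.1 * (inflow s' * upwind m s')).
Proof.
move=> ns; have ns' : nbr Om s' s by rewrite nbrC.
have [[a _ a' _] _ _] := nbrP ns; have E := nbr_inflow ns.
have c0 := cellvol_gt0 (active_nd nd a); have c0' := cellvol_gt0 (active_nd nd a').
rewrite /upwind (nbr_sum nd conf (fun s => m s.1) ns) (nbr_sum nd conf (fun s => m s.1) ns').
rewrite (mulrA (cellvol s.1)) E (mulrA (cellvol s'.1)) mulNr; congr (- _).
case: (ltgtP (inflow s') 0) => [s0|s0|->]; last by rewrite mulr0 !mul0r.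
- have : 0 < cellvol s.1 * inflow s by rewrite E oppr_gt0 pmulr_rlt0.
  by rewrite pmulr_rgt0// => /ltW ->.
- have : cellvol s.1 * inflow s < 0 by rewrite E oppr_lt0 mulr_gt0.
  by rewrite pmulr_rlt0// leNgt => ->.
Qed.

(** On each side, the flux term minus half of [kap s * m s.1 ^+ 2] is at least half of [kap s] times
    the squared upwind value: the excess on an interior inflow side is half of |kap| times the
    squared jump. These lower bounds cancel across interior facets and a boundary side leaves a
    nonnegative term. By [sum_inflow] the subtracted halves add up to half of |T| m_T^2. *)
Lemma upwind_energy m :
  2^-1 * \sum_(T in act) cellvol T * m T ^+ 2 <=
  \sum_(T in act) \sum_(l in T) n.+1%:R * cellvol T * (inflow (T, l) * upwind m (T, l)) * m T.
Proof.
pose kap s := n.+1%:R * cellvol s.1 * inflow s.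
pose t s := kap s * upwind m s * m s.1 - 2^-1 * kap s * m s.1 ^+ 2.
have kapN s s' : nbr Om s s' -> kap s = - kap s'.
  by move=> ns; rewrite /kap -(mulrA _ (cellvol s.1)) (nbr_inflow ns) mulrN (mulrA _ (cellvol s'.1)).
have kap_ge0 s : is_side Om s -> (0 <= kap s) = (0 <= inflow s).
  case: s => T l /andP[/= aT _].
  by rewrite /kap pmulr_rge0// mulr_gt0// (cellvol_gt0 (active_nd nd aT)).
(* [w] is antisymmetric because it always uses the value of [m] upwind of the facet *)
pose w s s' := 2^-1 * kap s * (if 0 <= inflow s then m s.1 else m s'.1) ^+ 2.
have wN s s' : nbr Om s s' -> w s s' = - w s' s.
  move=> ns; have := kapN _ _ ns; have /and4P[sd sd' _ _] := ns.
  rewrite /w -!kap_ge0// => ->; rewrite oppr_ge0.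
  case: (ltgtP (kap s') 0) => [s0|s0|->]; rewrite ?oppr0 ?mulr0 ?mul0r ?oppr0//; ring.
have tw s : is_side Om s -> \sum_(s' | nbr Om s s') w s s' <= t s.
  move=> sd; rewrite /t /upwind.
  have [k0|k0] := lerP 0 (inflow s).
    have -> : kap s * m s.1 * m s.1 - 2^-1 * kap s * m s.1 ^+ 2 = 2^-1 * kap s * m s.1 ^+ 2.
      by field.
    have [[s' ns]|N] := nbr_case Om s.
      by rewrite (nbr_sum nd conf (w s) ns) /w k0.
    by rewrite (nbr_sum0 (w s) N) mulr_ge0 ?sqr_ge0// mulr_ge0 ?invr_ge0// kap_ge0.
  have k1 : kap s < 0 by rewrite ltNge kap_ge0// -ltNge.
  have [[s' ns]|N] := nbr_case Om s.
    rewrite (nbr_sum nd conf (w s) ns) (nbr_sum nd conf (fun s => m s.1) ns) /w (lt_geF k0).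
    have := sqr_ge0 (m s.1 - m s'.1); nra.
  rewrite (nbr_sum0 (w s) N) (nbr_sum0 (fun s => m s.1) N) mulr0 mul0r sub0r oppr_ge0.
  by rewrite mulr_le0_ge0 ?sqr_ge0// pmulr_rle0 ?invr_gt0// ltW.
have H : 0 <= \sum_(s | is_side Om s) t s.
  have Z := nbr_antisym_sum wN.
  rewrite (bigID (is_side Om))/= [X in _ + X]big1 ?addr0 in Z; last first.
    by move=> s ns; rewrite big1// => s'; rewrite /nbr (negbTE ns).
  apply: le_trans (_ : \sum_(s | is_side Om s) \sum_(s' | nbr Om s s') w s s' <= _); first by rewrite Z.
  exact: ler_sum.
have E (f : side -> R) : \sum_(T in act) \sum_(l in T) f (T, l) = \sum_(s | is_side Om s) f s.
  by rewrite pair_big_dep; apply: eq_big => -[].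
have -> : \sum_(T in act) cellvol T * m T ^+ 2 = \sum_(s | is_side Om s) kap s * m s.1 ^+ 2.
  rewrite -E; apply: eq_bigr => T aT /=.
  rewrite -[LHS]mul1r -(sum_inflow aT) mulr_sumr mulr_suml; apply: eq_bigr => l _.
  rewrite /kap/=; ring.
rewrite (E (fun s => n.+1%:R * cellvol s.1 * (inflow s * upwind m s) * m s.1)).
rewrite -subr_ge0 mulr_sumr -sumrB; apply: (le_trans H).
by rewrite le_eqVlt; apply/orP; left; apply/eqP; apply: eq_bigr => s _; rewrite /t /kap; ring.
Qed.

(** An element has n + 2 sides and is seen across each of them at most once. *)
Lemma upwind_sum_le (X : cell Th -> R) : (forall T, 0 <= X T) ->
  \sum_(T in act) \sum_(l in T) (X T + \sum_(s' | nbr Om (T, l) s') X s'.1) <=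
  2 * n.+2%:R * \sum_(T in act) X T.
Proof.
move=> X0.
have E (f : side -> R) : \sum_(T in act) \sum_(l in T) f (T, l) = \sum_(s | is_side Om s) f s.
  by rewrite pair_big_dep; apply: eq_big => -[].
have S1 : \sum_(s | is_side Om s) X s.1 = n.+2%:R * \sum_(T in act) X T.
  rewrite -E mulr_sumr; apply: eq_bigr => T aT /=.
  by rewrite sumr_const; have [-> _] := active_nd nd aT; rewrite mulr_natl.
rewrite (E (fun s => X s.1 + \sum_(s' | nbr Om s s') X s'.1)) big_split/=.
have S2 : \sum_(s | is_side Om s) \sum_(s' | nbr Om s s') X s'.1 <= \sum_(s | is_side Om s) X s.1.
  rewrite (exchange_big_dep (is_side Om))/=; last by move=> s s' _ /and4P[].
  apply: ler_sum => s sd.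
  rewrite (eq_bigl (nbr Om s)); last first.
    by move=> s'; rewrite nbrC andbC /nbr; case: (is_side Om s'); rewrite ?andbT ?andbF.
  have [[s' ns]|N] := nbr_case Om s.
    by rewrite (nbr_sum nd conf (fun=> X s.1) ns).
  by rewrite (nbr_sum0 (fun=> X s.1) N).
by apply: (le_trans (lerD (lexx _) S2)); rewrite S1; lra.
Qed.

End upwind.

Section weighted_means.
Context (R : realType) (I : finType).

Lemma sum_sqr_le (P : pred I) (x : I -> R) :
  (\sum_(i | P i) x i) ^+ 2 <= #|P|%:R * \sum_(i | P i) x i ^+ 2.
Proof.
have [P0|P0] := posnP #|P|.
  rewrite P0 mul0r big_pred0 ?expr0n// => i; apply/negbTE/negP => Pi.
  by have := card0_eq P0 i; rewrite inE => /negbT; rewrite /in_mem/= Pi.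
set s := \sum_(i | P i) x i; set q := \sum_(i | P i) _; set N : R := #|P|%:R.
have N0 : 0 < N by rewrite ltr0n.
have : 0 <= \sum_(i | P i) (x i - s / N) ^+ 2 by apply: sumr_ge0 => i _; exact: sqr_ge0.
have -> : \sum_(i | P i) (x i - s / N) ^+ 2 = q - 2 * (s / N) * s + N * (s / N) ^+ 2.
  have -> : N * (s / N) ^+ 2 = \sum_(i | P i) (s / N) ^+ 2 by rewrite sumr_const mulr_natl.
  have -> : - (2 * (s / N) * s) = \sum_(i | P i) - (2 * (s / N)) * x i by rewrite -mulr_sumr mulNr.
  rewrite /q -!big_split; apply: eq_bigr => i _ /=; ring.
have -> : q - 2 * (s / N) * s + N * (s / N) ^+ 2 = q - s ^+ 2 / N by field; rewrite gt_eqF.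
by rewrite subr_ge0 ler_pdivrMr// mulrC.
Qed.

Lemma jensen_sqr (w x : I -> R) : (forall i, 0 <= w i) -> \sum_i w i = 1 ->
  (\sum_i w i * x i) ^+ 2 <= \sum_i w i * x i ^+ 2.
Proof.
move=> w0 w1; set s := \sum_i w i * x i.
have : 0 <= \sum_i w i * (x i - s) ^+ 2 by apply: sumr_ge0 => i _; rewrite mulr_ge0 ?sqr_ge0.
have -> : \sum_i w i * (x i - s) ^+ 2 = \sum_i w i * x i ^+ 2 - 2 * s * s + s ^+ 2 * \sum_i w i.
  have -> : - (2 * s * s) = \sum_i - (2 * s) * (w i * x i) by rewrite -mulr_sumr mulNr.
  have -> : s ^+ 2 * (\sum_i w i) = \sum_i s ^+ 2 * w i by exact: mulr_sumr.
  by rewrite -!big_split; apply: eq_bigr => i _ /=; ring.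
rewrite w1; lra.
Qed.

End weighted_means.

(** * The field A phi and its energy *)

Section transport.
Context (R : realType) (n k : nat) (Th : mesh R n.+1) (Om : set 'rV[R]_n.+1).
Hypothesis nd : forall T, T \in elts Th -> Defs.nondegenerate T.
Hypothesis conf : forall T T', T \in elts Th -> T' \in elts Th -> conforming T T'.
Variable B : R.
Local Notation act := (active Th Om).
Local Notation mu := (vol R n.+1).
Local Notation mpol := (mpoly.mpoly n.+1 R).
Implicit Types (T : cell Th) (q phi : bscal Th) (u v : bvec Th).

Lemma ip_evalE q q' : ip (OmT Th Om) (Defs.eval Om q) (Defs.eval Om q') =
  \sum_(T in act) \int[mu]_(x in hull T) (peval (q T) x * peval (q' T) x).
Proof.
rewrite /ip; under eq_Rintegral do rewrite !evalE (@piecewise_op _ _ _ Om *%R) ?mulr0//.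
by apply: Rintegral_OmT => // T _; apply: continuous_mul; exact: continuous_peval.
Qed.

Lemma continuous_pveval_dotr (f g : 'I_n.+1 -> mpol) :
  continuous (fun x => dotr (pveval f x) (pveval g x)).
Proof.
apply: continuous_big_sum => i _; under eq_fun do rewrite !mxE.
by apply: continuous_mul; exact: continuous_peval.
Qed.

Lemma vip_vevalE u v : vip (OmT Th Om) (veval Om u) (veval Om v) =
  \sum_(T in act) \int[mu]_(x in hull T) dotr (pveval (u T) x) (pveval (v T) x).
Proof.
rewrite /vip; under eq_Rintegral do rewrite veval_vdotr.
by apply: Rintegral_OmT => // T _; exact: continuous_pveval_dotr.
Qed.

Definition means phi T : R := cell_mean T (phi T).

Definition bubble phi T (l : 'I_(nv Th)) : mpol :=
  \sum_i vert l ord0 i *: mpoly.mderiv i (phi T).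

Definition transport phi : bvec Th :=
  conforming_field Om (fun s => inflow B s * upwind Om B (means phi) s) (bubble phi).

Lemma peval_bubble phi T l x : peval (bubble phi T l) x = vslope (phi T) l x.
Proof.
rewrite /bubble peval_sum; apply: eq_bigr => i _.
by rewrite pevalZ mxE partial_peval.
Qed.

(** Differentiation loses the degree that [lamp] brings back; for k = 0 the bubble is zero. *)
Lemma deg_bubble phi T l : deg_le k (phi T) -> deg_le k (lamp T l * bubble phi T l).
Proof.
case: k => [|k'] pk.
  rewrite /bubble big1 ?mulr0 ?mpoly.msize0// => i _.
  have /eqP -> : mpoly.mderiv i (phi T) == 0 by rewrite -mpoly.msize_poly_eq0 -leqn0 msize_mderiv.
  by rewrite scaler0.
rewrite -[X in deg_le X _]add1n; apply: deg_le_mul; first exact: deg_lamp.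
by apply: deg_le_sum => i _; apply: deg_leZ; exact: msize_mderiv.
Qed.

Lemma transport_Sigmah phi : Qh k Th Om phi -> Sigmah k Th Om (transport phi).
Proof.
move=> Vp; apply: Sigmah_conforming_field => //.
  by move=> s s'; exact: upwind_flux.
by move=> T l aT _; apply: deg_bubble; have [/(_ aT)] := Vp T.
Qed.

Lemma sum_cell_lam T (F : 'I_(nv Th) -> R) x : Defs.nondegenerate T ->
  \sum_(i in T) lam T i x * F i = \sum_i lam T i x * F i.
Proof.
move=> nT; rewrite [RHS](bigID (mem T))/= [X in _ = _ + X]big1 ?addr0// => i iT.
by rewrite lam_notin// mul0r.
Qed.

Lemma vslope_mean T (p : mpol) x : Defs.nondegenerate T ->
  \sum_(i in T) lam T i x * vslope p i x = dotr x (grad (peval p) x).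
Proof.
move=> nT; rewrite sum_cell_lam// -[in RHS](lam_vert_sum nT x) dotr_suml.
by apply: eq_bigr => i _; rewrite dotrZl (lam_vert_sum nT x).
Qed.

Lemma cell_spreadE T (p : mpol) x : Defs.nondegenerate T ->
  cell_spread T p x =
  - \sum_(l in T) lam T l x * vslope p l x * dotr (x - vert l) (grad (peval p) x).
Proof.
move=> nT; rewrite /cell_spread; set s := \sum_(i in T) lam T i x * vslope p i x.
have sE : s = dotr x (grad (peval p) x) by exact: vslope_mean.
transitivity (\sum_(i in T) lam T i x * vslope p i x ^+ 2 - s * s); first by rewrite expr2.
rewrite {1}/s mulr_suml -sumrB -sumrN; apply: eq_bigr => i _.
by rewrite dotrBl -sE -/(vslope p i x); ring.
Qed.

Lemma transport_cell_energy phi T : T \in act ->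
  \int[mu]_(x in hull T) (peval (bdiv (transport phi) T) x * peval (phi T) x) =
  \sum_(l in T) n.+1%:R * cellvol T * (inflow B (T, l) * upwind Om B (means phi) (T, l)) * means phi T +
  \int[mu]_(x in hull T) cell_spread T (phi T) x.
Proof.
move=> aT; have nT := active_nd nd aT; have cv := cellvol_gt0 nT.
rewrite ffunE -/(poly_div (transport phi T)) [transport phi T]ffunE aT.
set c := fun s => inflow B s * upwind Om B (means phi) s.
pose r l : mpol := lamp T l * bubble phi T l.
set q := phi T.
have Cq : C1 (peval q) by exact: C1_peval.
have cq : continuous (peval q) by exact: continuous_peval.
(* Green's formula for the bubble: its coefficients vanish on the facets where they would count. *)
have Z : \int[mu]_(x in hull T) (dotr (pveval (apex_field T r) x) (grad (peval q) x) +
    peval (poly_div (apex_field T r)) x * peval q x) = 0.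
  rewrite (apex_field_flux _ nT Cq) big1// => l lT.
  rewrite (@facet_flux_ext _ _ _ _ _ _ (fun x => 0 * peval q x))//.
    by rewrite facet_fluxZ// mul0r mulr0.
  move=> x; rewrite (hullE nT (subsetDl _ _)) => -[_ /(_ l)]; rewrite !inE eqxx => /(_ isT) ll.
  by rewrite pevalM peval_lamp ll !mul0r.
have cA : continuous (fun x => dotr (pveval (apex_field T r) x) (grad (peval q) x)).
  by apply: continuous_dotr_grad => // i; under eq_fun do rewrite mxE; exact: continuous_peval.
have cS := @continuous_cell_spread _ _ _ T q.
have E1 x : dotr (pveval (apex_field T r) x) (grad (peval q) x) = - cell_spread T q x.
  rewrite cell_spreadE// opprK pveval_apex_field dotr_suml; apply: eq_bigr => l _.
  by rewrite dotrZl pevalM peval_lamp peval_bubble.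
have E2 x : peval (poly_div (apex_field T (fun l => mpoly.mpolyC n.+1 (c (T, l)) + r l))) x * peval q x =
    (n.+1%:R * \sum_(l in T) c (T, l)) * peval q x + (cell_spread T q x +
    (dotr (pveval (apex_field T r) x) (grad (peval q) x) +
    peval (poly_div (apex_field T r)) x * peval q x)).
  rewrite E1 addNKr -mulrDl; congr (_ * _).
  rewrite !peval_poly_div_apex_field mulr_sumr -big_split; apply: eq_bigr => l _ /=.
  have g0 : grad (peval (mpoly.mpolyC n.+1 (c (T, l)) + r l)) x = grad (peval (r l)) x.
    apply/rowP => i; rewrite !mxE !partial_peval.
    by rewrite linearD/= mpoly.mderivC add0r.
  by rewrite g0 pevalD pevalC; ring.
have mh := measurable_hull nT.
have iq := integrable_hull nT cq.
have ih (f : 'rV[R]_n.+1 -> R) : continuous f -> mu.-integrable (hull T) (EFin \o f).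
  exact: integrable_hull.
have cD : continuous (fun x => peval (poly_div (apex_field T r)) x * peval q x).
  by apply: continuous_mul => //; exact: continuous_peval.
transitivity (\int[mu]_(x in hull T) ((n.+1%:R * \sum_(l in T) c (T, l)) * peval q x +
    (cell_spread T q x + (dotr (pveval (apex_field T r) x) (grad (peval q) x) +
    peval (poly_div (apex_field T r)) x * peval q x)))).
  by apply: eq_Rintegral => x _; exact: E2.
rewrite RintegralD//; last 2 first.
- by apply: ih; apply: continuous_mul => //; exact: continuous_const.
- by apply: ih; apply: continuous_add => //; exact: continuous_add.
rewrite RintegralD//; last 2 first.
- exact: ih.
- by apply: ih; exact: continuous_add.
rewrite Z addr0 RintegralZl//; congr (_ + _).
rewrite /means /cell_mean -/q -mulr_suml mulrA; congr (_ * _).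
rewrite -mulr_sumr -/(c _); field; by rewrite gt_eqF.
Qed.

Lemma transport_energy phi :
  2^-1 * (\sum_(T in act) cellvol T * means phi T ^+ 2) +
    \sum_(T in act) \int[mu]_(x in hull T) cell_spread T (phi T) x <=
  bh Om (transport phi) phi.
Proof.
rewrite /bh ip_evalE (eq_bigr _ (transport_cell_energy phi)) big_split/= lerD2r.
exact: upwind_energy.
Qed.

Lemma means_linear c q q' T : T \in act ->
  means (c *: q + q') T = c * means q T + means q' T.
Proof.
move=> aT; have nT := active_nd nd aT; have mh := measurable_hull nT.
have ip (p : mpol) : mu.-integrable (hull T) (EFin \o peval p).
  by apply: integrable_hull => //; exact: continuous_peval.
rewrite /means /cell_mean !ffunE; under eq_Rintegral do rewrite pevalD pevalZ.
rewrite RintegralD//; last exact: (integrable_mulr mh c (ip _)).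
by rewrite RintegralZl//; ring.
Qed.

(** The upwind direction is decided by the sign of [inflow], independently of the argument. *)
Lemma transport_linear c q q' : transport (c *: q + q') = c *: transport q + transport q'.
Proof.
apply/ffunP => T; apply/ffunP => i; rewrite !ffunE.
have [aT|aT] := boolP (T \in act); last by rewrite !ffunE scaler0 addr0.
rewrite !ffunE scaler_sumr -big_split; apply: eq_bigr => l lT /=.
have -> : upwind Om B (means (c *: q + q')) (T, l) =
    c * upwind Om B (means q) (T, l) + upwind Om B (means q') (T, l).
  rewrite /upwind; case: ifP => _; first exact: means_linear.
  rewrite mulr_sumr -big_split; apply: eq_bigr => s' /nbrP[[_ _ a _] _ _].
  exact: means_linear.
have -> : bubble (c *: q + q') T l = c *: bubble q T l + bubble q' T l.
  rewrite /bubble scaler_sumr -big_split; apply: eq_bigr => j _.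
  by rewrite !ffunE linearP scalerDr !scalerA mulrC.
move: (inflow B (T, l)) (upwind Om B (means q) (T, l)) (upwind Om B (means q') (T, l)) => e a b.
have -> : e * (c * a + b) = c * (e * a) + e * b by ring.
rewrite mpoly.mpolyCD mpoly.mpolyCM -!mpoly.mul_mpolyC; ring.
Qed.

End transport.

Section euclidean.
Context (R : realType) (d : nat).
Implicit Types (x y z : 'rV[R]_d).

Lemma dotr_ge0 x : 0 <= dotr x x.
Proof. by apply: sumr_ge0 => i _; rewrite -expr2 sqr_ge0. Qed.

Lemma enorm_sqr x : enorm x ^+ 2 = dotr x x.
Proof. by rewrite /enorm sqr_sqrtr ?dotr_ge0. Qed.

Lemma dotr_sqrD_le x y : dotr (x + y) (x + y) <= 2 * dotr x x + 2 * dotr y y.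
Proof.
have := dotr_ge0 (x - y); rewrite !dotrDl !dotrDr !dotrNl !(dotrC _ (- y)) !dotrNl (dotrC y x); lra.
Qed.

Lemma dotr_sum_le (I : finType) (P : pred I) (z : I -> 'rV[R]_d) :
  dotr (\sum_(i | P i) z i) (\sum_(i | P i) z i) <= #|P|%:R * \sum_(i | P i) dotr (z i) (z i).
Proof.
rewrite /dotr exchange_big mulr_sumr; apply: ler_sum => j _ /=.
rewrite !summxE -expr2; apply: (le_trans (sum_sqr_le _ _)).
by under [X in _ <= _ * X]eq_bigr do rewrite -expr2.
Qed.

Lemma dotr_jensen (I : finType) (w : I -> R) (z : I -> 'rV[R]_d) :
  (forall i, 0 <= w i) -> \sum_i w i = 1 ->
  dotr (\sum_i w i *: z i) (\sum_i w i *: z i) <= \sum_i w i * dotr (z i) (z i).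
Proof.
move=> w0 w1; under [leRHS]eq_bigr do rewrite /dotr mulr_sumr.
rewrite /dotr exchange_big; apply: ler_sum => j _ /=.
have -> : (\sum_i w i *: z i) ord0 j = \sum_i w i * z i ord0 j.
  by rewrite summxE; apply: eq_bigr => i _; rewrite mxE.
rewrite -expr2.
by apply: (le_trans (jensen_sqr _ w0 w1)); under [leRHS]eq_bigr do rewrite -expr2.
Qed.

End euclidean.

Section diameters.
Context (R : realType) (n : nat) (Th : mesh R n.+1).
Implicit Types (T : cell Th).

Lemma ediam_le (A : set 'rV[R]_n.+1) (D : R) : 0 <= D ->
  (forall x y, A x -> A y -> enorm (x - y) <= D) -> (ediam A <= D%:E)%E.
Proof.
move=> D0 AD; apply: ge_ereal_sup => e [->|[x [y [Ax Ay ->]]]]; first by rewrite lee_fin.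
by rewrite lee_fin AD.
Qed.

Definition cube_diam M : R := Num.sqrt n.+1%:R * (2 * M).

Lemma enorm_cube M x y : 0 <= M -> cube n.+1 M x -> cube n.+1 M y -> enorm (x - y) <= cube_diam M.
Proof.
move=> M0 xM yM; have -> : cube_diam M = Num.sqrt (n.+1%:R * (2 * M) ^+ 2).
  by rewrite /cube_diam sqrtrM ?ler0n// sqrtr_sqr ger0_norm ?mulr_ge0.
apply: ler_wsqrtr; apply: (@le_trans _ _ (\sum_(i < n.+1) (2 * M) ^+ 2)).
  apply: ler_sum => i _; rewrite -expr2 !mxE -[leLHS]real_normK ?num_real//.
  rewrite ler_sqr ?nnegrE ?mulr_ge0//; apply: (le_trans (ler_normB _ _)).
  by rewrite mulr_natl mulr2n lerD.
by rewrite sumr_const card_ord -[leLHS]mulr_natl.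
Qed.

Lemma hT_le T M : 0 <= M -> hull T `<=` cube n.+1 M -> hT T <= cube_diam M.
Proof.
move=> M0 TM; have D0 : 0 <= cube_diam M by rewrite mulr_ge0 ?sqrtr_ge0// mulr_ge0.
have le : (ediam (hull T) <= (cube_diam M)%:E)%E.
  by apply: ediam_le => // x y /TM xM /TM yM; exact: enorm_cube.
rewrite -lee_fin /hT fineK// ge0_fin_numE ?ediam_ge0//.
exact: le_lt_trans le (ltry _).
Qed.

Lemma hT_ge T x y : hull T x -> hull T y -> enorm (x - y) <= hT T.
Proof.
move=> hx hy; have [M M0 TM] := bounded_sub_cube (bounded_hull T).
have D0 : 0 <= cube_diam M by rewrite mulr_ge0 ?sqrtr_ge0// mulr_ge0.
have le : (ediam (hull T) <= (cube_diam M)%:E)%E.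
  by apply: ediam_le => // x' y' /TM xM /TM yM; exact: enorm_cube.
rewrite -lee_fin /hT fineK; last first.
  by rewrite ge0_fin_numE ?ediam_ge0//; exact: le_lt_trans le (ltry _).
by apply: ereal_sup_ubound; right; exists x, y.
Qed.

Lemma hT_ge0 T : 0 <= hT T.
Proof. by apply: fine_ge0; exact: ediam_ge0. Qed.

(* [lam T l] takes values in [[0, 1]] on the inscribed ball *)
Lemma lamg_bound sigma T l : T \in elts Th -> Defs.nondegenerate T -> l \in T ->
  shape_regular Th sigma -> `|lamg T l ord0 ord0| * hT T <= `|sigma| / 2.
Proof.
move=> eT nT lT /(_ T eT)[x [r [r0 hr Hb]]].
pose e : 'rV[R]_n.+1 := r *: delta_mx ord0 ord0.
have en : enorm e = r.
  rewrite /enorm dotrZl dotrZr dotr_delta mxE !eqxx mulr1 -expr2 sqrtr_sqr gtr0_norm//.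
have h1 : hull T (x + e) by apply: Hb; rewrite addrC addKr en.
have h2 : hull T (x - e).
  by apply: Hb; rewrite addrC addKr /enorm dotrNl dotrC dotrNl opprK -/(enorm e) en.
have lb y : hull T y -> 0 <= lam T l y <= 1.
  rewrite (hull_cellE nT) => hy; rewrite hy/= -[leRHS](lam_sum nT y) (bigD1 l)//= lerDl.
  exact: sumr_ge0.
have := lb _ h1; have := lb _ h2; rewrite !lamD dotrC dotrNl !(dotrC e) dotrZr dotrC dotr_delta.
set g := lamg T l ord0 ord0; set c := lam T l x => /andP[c1 c2] /andP[c3 c4].
have gr : `|g| * r <= 2^-1.
  rewrite -[r in leLHS]gtr0_norm// -normrM ler_norml; apply/andP; split; lra.
apply: (@le_trans _ _ (`|g| * (`|sigma| * r))).
  apply: ler_wpM2l => //; apply: (le_trans hr); rewrite ler_pM2r//; exact: ler_norm.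
by rewrite mulrCA; apply: ler_wpM2l.
Qed.

End diameters.

(** * The L2 bound on the field A phi *)

Section transport_bound.
Context (R : realType) (n k : nat) (Th : mesh R n.+1) (Om : set 'rV[R]_n.+1).
Hypothesis nd : forall T, T \in elts Th -> Defs.nondegenerate T.
Hypothesis conf : forall T T', T \in elts Th -> T' \in elts Th -> conforming T T'.
Variables (B s K D : R).
Local Notation act := (active Th Om).
Local Notation mu := (vol R n.+1).
Local Notation side := (cell Th * 'I_(nv Th))%type.
Hypotheses (B0 : 0 <= B) (s0 : 0 <= s) (K0 : 0 <= K).
Hypothesis vB : forall T l, T \in act -> l \in T -> `|vert l ord0 ord0| <= B.
Hypothesis gs : forall T l, T \in act -> l \in T -> `|lamg T l ord0 ord0| * hT T <= s.
Hypothesis hK : forall T T', T \in act -> T' \in act -> hT T <= K * hT T'.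
Hypothesis hD : forall T, T \in act -> hT T <= D.

Lemma facet_weight_bound (i : side) : is_side Om i -> `|facet_weight B i| <= 2 * B.
Proof.
case: i => T l /andP[/= aT lT]; have nT := active_nd nd aT; have [cT _] := nT.
have cF : #|T :\ l| = n.+1 by move: cT; rewrite (cardsD1 l) lT => -[].
rewrite /facet_weight normrM gtr0_norm ?invr_gt0// mulrC ler_pdivrMr//.
apply: (le_trans (ler_norm_sum _ _ _)).
apply: (@le_trans _ _ (\sum_(i in T :\ l) 2 * B)); last by rewrite sumr_const cF mulr_natr.
apply: ler_sum => i; rewrite !inE => /andP[_ iT].
by apply: (le_trans (ler_normD _ _)); rewrite (ger0_norm B0) mulr_natl mulr2n lerD// (vB aT).
Qed.

(** The gradient of [lam] is of order 1 / h_T, which the factor h_T^2 compensates. If the upwind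
    value belongs to the neighbour, the whole estimate has to be moved to that element. *)
Lemma flux_bound (m : cell Th -> R) T l : T \in act -> l \in T ->
  cellvol T * hT T ^+ 2 * (inflow B (T, l) * upwind Om B m (T, l)) ^+ 2 <=
  4 * B ^+ 2 * s ^+ 2 * (1 + K) * (cellvol T * m T ^+ 2 +
    \sum_(j | nbr Om (T, l) j) cellvol j.1 * m j.1 ^+ 2).
Proof.
move=> aT lT; have sd : is_side Om (T, l) by rewrite /is_side/= aT lT.
have cv T' : T' \in act -> 0 < cellvol T' by move=> a; exact: cellvol_gt0 (active_nd nd a).
have fw : facet_weight B (T, l) ^+ 2 <= 4 * B ^+ 2.
  rewrite -real_normK ?num_real//; have := facet_weight_bound sd.
  have := normr_ge0 (facet_weight B (T, l)); nra.
have N0 : 0 <= \sum_(j | nbr Om (T, l) j) cellvol j.1 * m j.1 ^+ 2.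
  by apply: sumr_ge0 => j /nbrP[[_ _ a _] _ _]; rewrite mulr_ge0 ?sqr_ge0// ltW// cv.
have h0 := hT_ge0 T; have g0 := gs aT lT; have G0 := normr_ge0 (lamg T l ord0 ord0).
have BB := sqr_ge0 B.
have c0 := cv _ aT.
have E u : cellvol T * hT T ^+ 2 * (inflow B (T, l) * u) ^+ 2 =
   (cellvol T * (`|lamg T l ord0 ord0| * hT T) ^+ 2) * facet_weight B (T, l) ^+ 2 * u ^+ 2.
  rewrite [(`|_| * _) ^+ 2]exprMn real_normK ?num_real// /inflow/=; ring.
rewrite E /upwind; case: ifP => _ /=.
  have gh : (`|lamg T l ord0 ord0| * hT T) ^+ 2 <= s ^+ 2.
    by rewrite ler_sqr ?nnegrE// mulr_ge0.
  apply: (@le_trans _ _ (cellvol T * s ^+ 2 * (4 * B ^+ 2) * m T ^+ 2)).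
    apply: ler_wpM2r; first exact: sqr_ge0.
    apply: ler_pM => //; [|exact: sqr_ge0|by apply: ler_wpM2l => //; exact: ltW].
    by rewrite mulr_ge0 ?sqr_ge0// ltW.
  set N := \sum_(j | _) _ in N0 *.
  have -> : cellvol T * s ^+ 2 * (4 * B ^+ 2) * m T ^+ 2 = 4 * B ^+ 2 * s ^+ 2 * (cellvol T * m T ^+ 2) by ring.
  rewrite -[leRHS]mulrA; apply: ler_wpM2l; first by rewrite mulr_ge0 ?sqr_ge0// mulr_ge0.
  have m0 : 0 <= cellvol T * m T ^+ 2 by rewrite mulr_ge0 ?sqr_ge0// ltW.
  by rewrite mulrDl mul1r; have := mulr_ge0 K0 (addr_ge0 m0 N0); lra.
have [[j ns]|Nn] := nbr_case Om (T, l); last first.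
  rewrite (nbr_sum0 (fun j => m j.1) Nn) expr0n/= mulr0.
  apply: mulr_ge0; first by rewrite mulr_ge0 ?addr_ge0// mulr_ge0 ?sqr_ge0// mulr_ge0.
  by rewrite addr_ge0// mulr_ge0 ?sqr_ge0// ltW.
rewrite !(nbr_sum nd conf _ ns).
have [[_ _ a' l'] _ _] := nbrP ns.
have c0' := cv _ a'; have h0' := hT_ge0 j.1; have g0' := gs a' l'.
have G0' := normr_ge0 (lamg j.1 j.2 ord0 ord0).
(* One factor |T| |d_0 lam_l| is carried over to the neighbour by [nbr_flux]; the remaining h_T
   costs the factor [K]. *)
have FE : cellvol T * `|lamg T l ord0 ord0| = cellvol j.1 * `|lamg j.1 j.2 ord0 ord0|.
  rewrite -[cellvol T]gtr0_norm// -[cellvol j.1]gtr0_norm// -!normrM.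
  have /rowP /(_ ord0) := nbr_flux nd conf ns; rewrite !mxE/= => ->.
  by rewrite normrN.
have KE : cellvol T * (`|lamg T l ord0 ord0| * hT T) ^+ 2 <= cellvol j.1 * (K * s ^+ 2).
  have -> : cellvol T * (`|lamg T l ord0 ord0| * hT T) ^+ 2 =
      cellvol T * `|lamg T l ord0 ord0| * (hT T * (`|lamg T l ord0 ord0| * hT T)) by ring.
  rewrite FE -mulrA; apply: ler_wpM2l; first exact: ltW.
  have -> : K * s ^+ 2 = (K * s) * s by ring.
  rewrite mulrA; apply: ler_pM => //; [exact: mulr_ge0|exact: mulr_ge0|].
  apply: (@le_trans _ _ (`|lamg j.1 j.2 ord0 ord0| * (K * hT j.1))).
    by apply: ler_wpM2l => //; exact: hK.
  by rewrite mulrCA; apply: ler_wpM2l.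
have m0 : 0 <= cellvol T * m T ^+ 2 by rewrite mulr_ge0 ?sqr_ge0// ltW.
have mj0 : 0 <= cellvol j.1 * m j.1 ^+ 2 by rewrite mulr_ge0 ?sqr_ge0// ltW.
apply: (@le_trans _ _ (cellvol j.1 * (K * s ^+ 2) * (4 * B ^+ 2) * m j.1 ^+ 2)).
  apply: ler_wpM2r; first exact: sqr_ge0.
  by apply: ler_pM => //; [rewrite mulr_ge0 ?sqr_ge0// ltW|exact: sqr_ge0].
have -> : cellvol j.1 * (K * s ^+ 2) * (4 * B ^+ 2) * m j.1 ^+ 2 =
  4 * B ^+ 2 * s ^+ 2 * (K * (cellvol j.1 * m j.1 ^+ 2)) by ring.
rewrite -[leRHS]mulrA; apply: ler_wpM2l; first by rewrite mulr_ge0 ?sqr_ge0// mulr_ge0.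
by rewrite mulrDl mul1r mulrDr; have := mulr_ge0 K0 m0; lra.
Qed.

Lemma transport_pointwise_bound (phi : bscal Th) T x : T \in act -> hull T x ->
  dotr (pveval (transport Om B phi T) x) (pveval (transport Om B phi T) x) <=
  2 * hT T ^+ 2 * (n.+2%:R *
    (\sum_(l in T) (inflow B (T, l) * upwind Om B (means phi) (T, l)) ^+ 2)) +
  2 * hT T ^+ 2 * cell_spread T (phi T) x.
Proof.
move=> aT hx; have nT := active_nd nd aT; have [cT _] := nT.
rewrite [transport _ _ _ _]ffunE aT pveval_apex_field.
set c := fun l => inflow B (T, l) * upwind Om B (means phi) (T, l).
set p : mpoly.mpoly n.+1 R := phi T; pose y (l : 'I_(nv Th)) := x - vert l : 'rV[R]_n.+1.
have yh l : l \in T -> dotr (y l) (y l) <= hT T ^+ 2.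
  move=> lT; rewrite -enorm_sqr ler_sqr ?nnegrE ?hT_ge0 ?sqrtr_ge0//.
  by apply: hT_ge => //; exact: hull_vert.
have lam0 i : 0 <= lam T i x by move: hx; rewrite (hull_cellE nT).
pose m := \sum_(i in T) lam T i x * vslope p i x.
have y0 : \sum_i lam T i x *: y i = 0.
  rewrite /y; under eq_bigr do rewrite scalerBr.
  by rewrite sumrB -scaler_suml lam_sum// lam_vert_sum// scale1r subrr.
(* The combination of the [y i] with weights [lam] is zero, so the slopes in the bubble may be
   centred at their mean [m]. Jensen's inequality then produces their variance. *)
have -> : \sum_(l in T) peval (mpoly.mpolyC n.+1 (inflow B (T, l) * upwind Om B (means phi) (T, l)) +
    lamp T l * bubble phi T l) x *: (x - vert l) =
    \sum_(l in T) c l *: y l + \sum_i lam T i x *: ((vslope p i x - m) *: y i).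
  have -> : \sum_i lam T i x *: ((vslope p i x - m) *: y i) =
      \sum_(i in T) (lam T i x * vslope p i x) *: y i.
    transitivity (\sum_i (lam T i x * vslope p i x) *: y i - m *: \sum_i lam T i x *: y i).
      by rewrite scaler_sumr -sumrB; apply: eq_bigr => i _; rewrite !scalerA -scalerBl; congr (_ *: _); ring.
    rewrite y0 scaler0 subr0 (bigID (mem T))/= [X in _ + X]big1 ?addr0// => i iT.
    by rewrite lam_notin// mul0r scale0r.
  rewrite -big_split; apply: eq_bigr => l lT /=.
  by rewrite pevalD pevalC pevalM peval_lamp peval_bubble -scalerDl.
move: (hT T ^+ 2) yh => h2 yh.
apply: (le_trans (dotr_sqrD_le _ _)); rewrite -!(mulrA 2); apply: lerD; rewrite ler_pM2l//.
- apply: (le_trans (dotr_sum_le _ _)); rewrite cT [leRHS]mulrCA; apply: ler_wpM2l => //.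
  rewrite mulr_sumr; apply: ler_sum => l lT; rewrite dotrZl dotrZr mulrA -expr2 [leRHS]mulrC.
  by apply: ler_wpM2l; [exact: sqr_ge0|exact: yh].
- apply: (le_trans (dotr_jensen _ lam0 (lam_sum nT x))).
  rewrite /cell_spread !(sum_cell_lam _ x nT).
  have mE : m = \sum_i lam T i x * vslope p i x by rewrite /m sum_cell_lam.
  rewrite -mE.
  have -> : \sum_i lam T i x * vslope p i x ^+ 2 - m ^+ 2 = \sum_i lam T i x * (vslope p i x - m) ^+ 2.
    have -> : - m ^+ 2 = \sum_i - (2 * m) * (lam T i x * vslope p i x) + \sum_i m ^+ 2 * lam T i x.
      by rewrite -!mulr_sumr -mE lam_sum//; ring.
    by rewrite -!big_split; apply: eq_bigr => i _ /=; ring.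
  rewrite mulr_sumr; apply: ler_sum => i _.
  have [iT|iT] := boolP (i \in T); last by rewrite lam_notin// !mul0r mulr0.
  rewrite mulrCA; apply: ler_wpM2l => //; rewrite dotrZl dotrZr mulrA -expr2 mulrC.
  by apply: ler_wpM2r; [exact: sqr_ge0|exact: yh].
Qed.

Lemma cell_spread_ge0 (T : cell Th) (p : mpoly.mpoly n.+1 R) x : Defs.nondegenerate T -> hull T x ->
  0 <= cell_spread T p x.
Proof.
move=> nT; rewrite (hull_cellE nT) => hx; rewrite /cell_spread !(sum_cell_lam _ x nT) subr_ge0.
exact: jensen_sqr (lam_sum nT x).
Qed.

Lemma cell_mean_le (T : cell Th) (p : mpoly.mpoly n.+1 R) : Defs.nondegenerate T ->
  cellvol T * cell_mean T p ^+ 2 <= \int[mu]_(x in hull T) (peval p x * peval p x).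
Proof.
move=> nT; have cv := cellvol_gt0 nT; have mh := measurable_hull nT.
have ih (f : 'rV[R]_n.+1 -> R) : continuous f -> mu.-integrable (hull T) (EFin \o f).
  exact: integrable_hull.
have cp := @continuous_peval _ _ p; have cpp := continuous_mul cp cp.
set m := cell_mean T p.
have I1 : \int[mu]_(x in hull T) peval p x = cellvol T * m.
  by rewrite /m /cell_mean mulVKf ?gt_eqF.
have : 0 <= \int[mu]_(x in hull T) (peval p x * peval p x + ((- (2 * m)) * peval p x + m ^+ 2)).
  apply: Rintegral_ge0 => x _.
  by have := sqr_ge0 (peval p x - m); nra.
have cc : continuous (fun _ : 'rV[R]_n.+1 => m ^+ 2) by exact: continuous_const.
have cm : continuous (fun x => - (2 * m) * peval p x).
  by apply: continuous_mul => //; exact: continuous_const.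
rewrite RintegralD//; [|exact: ih|by apply: ih; exact: continuous_add].
rewrite RintegralD//; [|exact: ih|exact: ih].
rewrite RintegralZl//; last exact: ih.
rewrite Rintegral_cst// -/(cellvol T) I1; lra.
Qed.

Lemma transport_bound (phi : bscal Th) :
  vip (OmT Th Om) (veval Om (transport Om B phi)) (veval Om (transport Om B phi)) <=
  2 * n.+2%:R * (4 * B ^+ 2 * s ^+ 2 * (1 + K)) * (2 * n.+2%:R) *
    (\sum_(T in act) cellvol T * means phi T ^+ 2) +
  2 * D ^+ 2 * (\sum_(T in act) \int[mu]_(x in hull T) cell_spread T (phi T) x).
Proof.
rewrite vip_vevalE//.
pose X T := cellvol T * means phi T ^+ 2.
pose c T l := inflow B (T, l) * upwind Om B (means phi) (T, l).
have X0 T : 0 <= X T by rewrite mulr_ge0 ?sqr_ge0// fine_ge0// measure_ge0.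
pose C := 4 * B ^+ 2 * s ^+ 2 * (1 + K).
have C0 : 0 <= C by rewrite mulr_ge0 ?addr_ge0// mulr_ge0 ?sqr_ge0// mulr_ge0// sqr_ge0.
apply: (@le_trans _ _ (\sum_(T in act) (2 * n.+2%:R * C *
    (\sum_(l in T) (X T + \sum_(j | nbr Om (T, l) j) X j.1)) +
    2 * D ^+ 2 * \int[mu]_(x in hull T) cell_spread T (phi T) x))); last first.
  rewrite big_split/= -!mulr_sumr -[2 * n.+2%:R * _ * _ * _]mulrA lerD2r; apply: ler_wpM2l.
    by rewrite mulr_ge0// mulr_ge0.
  exact: upwind_sum_le.
apply: ler_sum => T aT; have nT := active_nd nd aT; have mh := measurable_hull nT.
have ih (f : 'rV[R]_n.+1 -> R) : continuous f -> mu.-integrable (hull T) (EFin \o f).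
  exact: integrable_hull.
have cS := @continuous_cell_spread _ _ _ T (phi T).
have h0 := hT_ge0 T; have hh : hT T ^+ 2 <= D ^+ 2.
  by have hTD := hD aT; rewrite ler_sqr ?nnegrE//; exact: le_trans hTD.
pose a := 2 * hT T ^+ 2 * (n.+2%:R * \sum_(l in T) c T l ^+ 2).
have cc : continuous (fun _ : 'rV[R]_n.+1 => a) by exact: continuous_const.
have ch : continuous (fun x => 2 * hT T ^+ 2 * cell_spread T (phi T) x).
  by apply: continuous_mul => //; exact: continuous_const.
apply: (@le_trans _ _ (\int[mu]_(x in hull T) (a + 2 * hT T ^+ 2 * cell_spread T (phi T) x))).
  apply: le_Rintegral => //.
  - by apply: ih; exact: continuous_pveval_dotr.
  - by apply: ih; exact: continuous_add.
  - by move=> x hx; exact: transport_pointwise_bound.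
rewrite RintegralD//; [|exact: ih|exact: ih].
rewrite RintegralZl//; last exact: ih.
rewrite Rintegral_cst// -/(cellvol T); apply: lerD; last first.
  apply: ler_wpM2r; last by rewrite ler_pM2l.
  by apply: Rintegral_ge0 => x; exact: cell_spread_ge0.
have -> : a * cellvol T = 2 * n.+2%:R * \sum_(l in T) cellvol T * hT T ^+ 2 * c T l ^+ 2.
  by rewrite -mulr_sumr /a; ring.
rewrite -[leRHS]mulrA; apply: ler_wpM2l; first by rewrite mulr_ge0.
by rewrite mulr_sumr; apply: ler_sum => l lT; exact: flux_bound.
Qed.

End transport_bound.

(** * Norms and forms *)

Section norms.
Context (R : realType) (n k : nat) (Th : mesh R n.+1) (Om : set 'rV[R]_n.+1).
Hypothesis nd : forall T, T \in elts Th -> Defs.nondegenerate T.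
Hypothesis conf : forall T T', T \in elts Th -> T' \in elts Th -> conforming T T'.
Hypothesis oOm : open Om.
Local Notation act := (active Th Om).
Local Notation mu := (vol R n.+1).
Implicit Types (T : cell Th) (q r : bscal Th) (u v w : bvec Th).

Definition ipQ q r : R := ip (OmT Th Om) (Defs.eval Om q) (Defs.eval Om r).

Definition vipS S u v : R := vip S (veval Om u) (veval Om v).

Lemma nrmQE q : nrmQ Om q = Num.sqrt (ipQ q q).
Proof. by []. Qed.

Lemma psdform_ipQ (V : set (bscal Th)) : psdform V ipQ.
Proof.
have iq q r : mu.-integrable (OmT Th Om) (EFin \o (fun x => Defs.eval Om q x * Defs.eval Om r x)).
  rewrite (_ : (fun x => _ * _) = piecewise Om (fun T y => peval (q T) y * peval (r T) y)).
    apply: (integrable_piecewise nd conf (measurable_OmT _ nd) _).1 => T aT.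
    by apply: continuous_mul; exact: continuous_peval.
  by apply/funext => x; rewrite !evalE (@piecewise_op _ _ _ Om *%R) ?mulr0.
have mO := measurable_OmT Om nd.
split.
- move=> q _ c r s _ _; rewrite /ipQ /ip eval_linear.
  under eq_Rintegral do rewrite mulrDr mulrCA.
  rewrite RintegralD//; last exact: (integrable_mulr mO c (iq _ _)).
  by rewrite RintegralZl.
- by move=> q r _ _; rewrite /ipQ /ip; apply: eq_Rintegral => x _; rewrite mulrC.
- by move=> q _; apply: Rintegral_ge0 => x _; rewrite -expr2 sqr_ge0.
Qed.

Lemma integrable_vdotr S u v : measurable S ->
  mu.-integrable S (EFin \o (fun x => dotr (veval Om u x) (veval Om v x))).
Proof.
move=> mS; rewrite (_ : (fun x => _) = piecewise Om (fun T y => dotr (pveval (u T) y) (pveval (v T) y))).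
  by apply: (integrable_piecewise nd conf mS _).1 => T aT; exact: continuous_pveval_dotr.
by apply/funext => x; rewrite veval_vdotr.
Qed.

Lemma vipSE S u v : measurable S ->
  vipS S u v = \sum_(T in act) \int[mu]_(x in S `&` hull T) dotr (pveval (u T) x) (pveval (v T) x).
Proof.
move=> mS; rewrite /vipS /vip; under eq_Rintegral do rewrite veval_vdotr.
by apply: (integrable_piecewise nd conf mS _).2 => T aT; exact: continuous_pveval_dotr.
Qed.

Lemma psdform_vipS S (V : set (bvec Th)) : measurable S -> psdform V (vipS S).
Proof.
move=> mS; split.
- move=> u _ c v w _ _; rewrite /vipS /vip.
  under eq_Rintegral do rewrite veval_linear dotrDr dotrZr.
  rewrite RintegralD//; [|exact: (integrable_mulr mS c (integrable_vdotr _ _ mS))|exact: integrable_vdotr].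
  by rewrite RintegralZl//; exact: integrable_vdotr.
- by move=> u v _ _; rewrite /vipS /vip; apply: eq_Rintegral => x _; rewrite dotrC.
- by move=> u _; apply: Rintegral_ge0 => x _; exact: dotr_ge0.
Qed.

Lemma bh_linearr u (V : set (bscal Th)) : linear_on V (bh Om u).
Proof. by have [H _ _] := psdform_ipQ setT; move=> c q r _ _; exact: H. Qed.

Lemma bh_linearl q (V : set (bvec Th)) : linear_on V (fun u => bh Om u q).
Proof.
have [H S _] := psdform_ipQ setT; move=> c u v _ _.
rewrite /bh bdiv_linear -/(ipQ _ _) S// (H q)// /ipQ.
by rewrite -!/(ipQ _ _) (S q)// (S q).
Qed.

(** Fields vanish off the active mesh, so the integral over [Om] only sees the parts of [Om] in
    active elements. *)
Lemma vipS_le u : vipS Om u u <= vipS (OmT Th Om) u u.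
Proof.
have mOm := open_measurable_rV oOm; have mO := measurable_OmT Om nd.
rewrite !vipSE//; apply: ler_sum => T aT; have nT := active_nd nd aT.
have -> : OmT Th Om `&` hull T = hull T.
  by apply/seteqP; split => x; [case|move=> hx; split => //; exists T].
have mh := measurable_hull nT; have mI : measurable (Om `&` hull T) by exact: measurableI.
have cf := @continuous_pveval_dotr R n (u T) (u T).
have bh : bounded_set (hull T) by exact: bounded_hull.
have bI : bounded_set (Om `&` hull T) by apply: sub_bounded bh; exact: subIsetr.
have fi (S : set 'rV[R]_n.+1) : measurable S -> bounded_set S ->
    (\int[mu]_(x in S) (dotr (pveval (u T) x) (pveval (u T) x))%:E)%E \is a fin_num.
  by move=> mS bS; apply: integrable_fin_num => //; exact: (integrable_continuous cf mS bS).
rewrite -lee_fin !fineK; [|exact: fi|exact: fi].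
apply: ge0_subset_integral => //.
- by have /integrableP[] := integrable_continuous cf mh bh.
- by move=> x _; rewrite lee_fin dotr_ge0.
Qed.

(** An active element meets [Om] in a set with interior points, and a polynomial vanishing there is
    zero. This covers the case in which the norm integrates over [Om] only. *)
Lemma vipS_eq0 S v : measurable S -> (Om `<=` S \/ S = OmT Th Om) -> Sigmah k Th Om v ->
  vipS S v v = 0 -> v = 0.
Proof.
move=> mS OS [vT _]; rewrite vipSE// => /eqP; rewrite psumr_eq0; last first.
  by move=> T _; apply: Rintegral_ge0 => x _; exact: dotr_ge0.
move=> /allP H; apply/ffunP => T; have [v1 v2] := vT T.
have [aT|/v2 ->] := boolP (T \in act); last by rewrite ffunE.
have nT := active_nd nd aT; have /implyP /(_ aT) /eqP I0 := H T (mem_index_enum T).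
have [U [oU U0 sU]] : exists U, [/\ open U, U !=set0 & U `<=` hull T `&` Om].
  apply: positive_vol_interior => //.
  by move: aT; rewrite inE => /andP[_ /asboolP].
have USh : U `<=` S `&` hull T.
  move=> x /sU[hx Ox]; split => //; case: OS => [|->]; first exact.
  by exists T.
have mI : measurable (S `&` hull T) by apply: measurableI => //; exact: measurable_hull.
have bI : bounded_set (S `&` hull T) by apply: sub_bounded (bounded_hull T); exact: subIsetr.
apply/ffunP => i; rewrite !ffunE; apply: (peval_open_eq0 oU U0) => x Ux.
have := Rintegral_eq0_open mI bI oU USh (@continuous_pveval_dotr R n (v T) (v T))
  (fun x _ => dotr_ge0 _) I0 Ux.
move=> /eqP; rewrite psumr_eq0; last by move=> j _; rewrite -expr2 sqr_ge0.
move=> /allP /(_ i (mem_index_enum i)); rewrite mxE -expr2 sqrf_eq0 => /eqP.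
by [].
Qed.

Lemma ipQ_eq0 q : Qh k Th Om q -> ipQ q q = 0 -> q = 0.
Proof.
move=> Vq; rewrite /ipQ ip_evalE// => /eqP; rewrite psumr_eq0; last first.
  by move=> T _; apply: Rintegral_ge0 => x _; rewrite -expr2 sqr_ge0.
move=> /allP H; apply/ffunP => T; have [q1 q2] := Vq T.
have [aT|/q2 ->] := boolP (T \in act); last by rewrite ffunE.
have nT := active_nd nd aT.
have /implyP /(_ aT) /eqP I0 := H T (mem_index_enum T).
have [U [oU U0 sU]] : exists U, [/\ open U, U !=set0 & U `<=` hull T `&` Om].
  apply: positive_vol_interior => //.
  by move: aT; rewrite inE => /andP[_ /asboolP].
rewrite ffunE; apply: (@Rintegral_sqr_eq0 _ _ (hull T) U) => //.
- exact: measurable_hull.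
- exact: bounded_hull.
- by move=> x /sU[].
Qed.

Variable gamma : R.
Local Notation dom := (if 0 < gamma then OmT Th Om else Om).

Lemma measurable_dom : measurable dom.
Proof. by case: ifP => _; [exact: measurable_OmT|exact: open_measurable_rV]. Qed.

Definition nS u v : R := vipS dom u v + ipQ (bdiv u) (bdiv v).

Lemma nrmSE u : nrmS Om gamma u = Num.sqrt (nS u u).
Proof.
have [_ _ H1] := psdform_vipS setT measurable_dom; have [_ _ H2] := psdform_ipQ setT.
by rewrite /nrmS /nS /vnrm /nrm !sqr_sqrtr ?H1 ?H2.
Qed.

Lemma psdform_nS (V : set (bvec Th)) : psdform V nS.
Proof.
apply: psdform_add; first exact: psdform_vipS measurable_dom.
have [H1 H2 H3] := psdform_ipQ setT; split.
- by move=> u _ c v w _ _; rewrite bdiv_linear H1.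
- by move=> u v _ _; rewrite H2.
- by move=> u _; rewrite H3.
Qed.

Lemma nS_eq0 u : Sigmah k Th Om u -> nS u u = 0 -> u = 0.
Proof.
move=> Vu; have [_ _ H1] := psdform_vipS setT measurable_dom; have [_ _ H2] := psdform_ipQ setT.
move=> /eqP; rewrite /nS paddr_eq0 ?H1 ?H2// => /andP[/eqP u0 _].
apply: vipS_eq0 u0 => //; first exact: measurable_dom.
by case: ifP => _; [right|left].
Qed.

Lemma vipS_dom_le u : vipS dom u u <= vipS (OmT Th Om) u u.
Proof. by case: ifP => _ //; exact: vipS_le. Qed.

Variables (Ch : {set {set cell Th}}) (jF : cell Th -> bvec Th -> bvec Th -> R) (cj : R).
Hypothesis (gamma_ge0 : 0 <= gamma) (gp : ghost_penalty k Om Ch jF cj).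

Lemma psdform_jh : psdform (Sigmah k Th Om) (jh Ch jF).
Proof.
have [j1 j2 _ _ _] := gp; split.
- move=> u Vu c v w Vv Vw; rewrite /jh mulr_sumr -big_split; apply: eq_bigr => F PF.
  by have [_ ->] := j1 _ PF c v w u Vv Vw Vu.
- by move=> u v Vu Vv; have [] := j2 _ _ Vu Vv.
- by move=> u Vu; have [] := j2 _ _ Vu Vu.
Qed.

Lemma ah_linearr u : Sigmah k Th Om u -> linear_on (Sigmah k Th Om) (ah Om Ch jF gamma u).
Proof.
move=> Vu c v w Vv Vw; have [H1 _ _] := psdform_vipS setT (open_measurable_rV oOm).
have [J1 _ _] := psdform_jh.
rewrite /ah (J1 _ Vu c v w Vv Vw) -!/(vipS _ _ _) (H1 u)//; ring.
Qed.

Lemma ah_sym u v : Sigmah k Th Om u -> Sigmah k Th Om v ->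
  ah Om Ch jF gamma u v = ah Om Ch jF gamma v u.
Proof.
move=> Vu Vv; have [_ H1 _] := psdform_vipS setT (open_measurable_rV oOm).
by have [_ J1 _] := psdform_jh; rewrite /ah -!/(vipS _ _ _) H1// J1.
Qed.

Lemma ah_linearl v : Sigmah k Th Om v -> linear_on (Sigmah k Th Om) (fun u => ah Om Ch jF gamma u v).
Proof.
move=> Vv c u w Vu Vw.
have VV := lspace_Sigmah k Om nd conf; have Vs := VV.2 c u w Vu Vw.
by rewrite ah_sym// (ah_linearr Vv)// (ah_sym Vu)// (ah_sym Vw).
Qed.

Lemma ah_bounded u v : Sigmah k Th Om u -> Sigmah k Th Om v ->
  `|ah Om Ch jF gamma u v| <= (1 + gamma * cj ^+ 2) * nrmS Om gamma u * nrmS Om gamma v.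
Proof.
move=> Vu Vv; have VV := lspace_Sigmah k Om nd conf.
have mOm := open_measurable_rV oOm; have [_ _ j3 _ j5] := gp.
have P1 := psdform_vipS (Sigmah k Th Om) mOm.
have CS1 := psdform_CauchySchwarz VV P1 Vu Vv.
have CS2 := psdform_CauchySchwarz VV psdform_jh Vu Vv.
have [_ _ Q0] := psdform_ipQ setT.
have le1 w : Num.sqrt (vipS Om w w) <= nrmS Om gamma w.
  rewrite nrmSE; apply: ler_wsqrtr; apply: (@le_trans _ _ (vipS dom w w)).
    by case: ifP => _ //; exact: vipS_le.
  by rewrite lerDl Q0.
have le2 w : Sigmah k Th Om w -> 0 < gamma -> Num.sqrt (jh Ch jF w w) <= `|cj| * nrmS Om gamma w.
  move=> Vw g0; have [H _] := j5 _ Vw.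
  apply: (@le_trans _ _ (cj * vnrm (OmT Th Om) (veval Om w))).
    by apply: le_trans H; rewrite lerDr sqrtr_ge0.
  apply: (@le_trans _ _ (`|cj| * vnrm (OmT Th Om) (veval Om w))).
    by apply: ler_wpM2r; [exact: sqrtr_ge0|exact: ler_norm].
  apply: ler_wpM2l; first exact: normr_ge0.
  by rewrite nrmSE /nS g0; apply: ler_wsqrtr; rewrite lerDl Q0.
have N0 w : 0 <= nrmS Om gamma w by exact: sqrtr_ge0.
rewrite /ah; apply: (le_trans (ler_normD _ _)); rewrite -[leRHS]mulrA mulrDl mul1r; apply: lerD.
  apply: (le_trans CS1); apply: ler_pM; try exact: sqrtr_ge0; exact: le1.
rewrite normrM (ger0_norm gamma_ge0) -mulrA.
move: gamma_ge0; rewrite le_eqVlt => /orP[/eqP <-|g0]; first by rewrite !mul0r.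
apply: ler_wpM2l => //; apply: (le_trans CS2).
rewrite -[cj ^+ 2]real_normK ?num_real// expr2 mulrACA.
by apply: ler_pM; rewrite ?sqrtr_ge0//; exact: le2.
Qed.

(** From |u|^2 on the active domain at most 2 cj^2 (A + J), with A = |u|^2 on [Om] and J the squared
    ghost semi-norm, and min(1, gamma) (A + J) <= A + gamma J. The added 1 keeps the denominator
    positive. *)
Definition coercivity : R := if 0 < gamma then Num.min 1 gamma / (1 + 2 * cj ^+ 2) else 1.

Lemma coercivity_gt0 : 0 < coercivity.
Proof.
rewrite /coercivity; case: ifP => // g0; rewrite divr_gt0//.
  by rewrite lt_min g0 ltr01.
by rewrite ltr_wpDr// mulr_ge0// sqr_ge0.
Qed.

Lemma ah_coercive u : Sigmah k Th Om u -> (forall q, Qh k Th Om q -> bh Om u q = 0) ->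
  coercivity * nrmS Om gamma u ^+ 2 <= ah Om Ch jF gamma u u.
Proof.
move=> Vu bu; have mOm := open_measurable_rV oOm.
have [_ _ S0] := psdform_nS setT; have [_ _ J0] := psdform_jh.
have [_ _ P0] := psdform_vipS setT mOm; have [_ _ Q0] := psdform_vipS setT (measurable_OmT Om nd).
rewrite nrmSE sqr_sqrtr ?S0// /nS -/(bh Om u (bdiv u)).
(* Testing with the divergence itself removes the divergence part of the norm. *)
rewrite [ipQ _ _](bu _ (bdiv_Qh Vu)) addr0 /coercivity /ah -/(vipS Om u u).
case: ifP => g0; last first.
  by rewrite mul1r lerDl mulr_ge0// J0.
have [_ _ _ _ /(_ u Vu)[_]] := gp; rewrite /vnrm /jnrm -!/(vipS _ u u) => H.
move: (P0 u I) (Q0 u I) (J0 u Vu) H.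
move: (vipS Om u u) (vipS (OmT Th Om) u u) (jh Ch jF u u) => A X J A0 X0 J0' H.
have XE : X <= 2 * cj ^+ 2 * (A + J).
  have sX := sqrtr_ge0 X; have sA := sqrtr_ge0 A; have sJ := sqrtr_ge0 J.
  rewrite -(sqr_sqrtr X0) -(sqr_sqrtr A0) -(sqr_sqrtr J0').
  apply: (@le_trans _ _ ((cj * (Num.sqrt A + Num.sqrt J)) ^+ 2)).
    by rewrite ler_sqr ?nnegrE//; exact: le_trans H.
  rewrite exprMn (mulrC 2) -(mulrA (cj ^+ 2)); apply: ler_wpM2l; first exact: sqr_ge0.
  by have := sqr_ge0 (Num.sqrt A - Num.sqrt J); nra.
have c0 : 0 <= 2 * cj ^+ 2 by rewrite mulr_ge0 ?sqr_ge0.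
set m := Num.min 1 gamma.
have m1 : m <= 1 by rewrite ge_min lexx.
have mg : m <= gamma by rewrite ge_min lexx orbT.
have m0 : 0 <= m by rewrite le_min ler01 ltW.
have mA : m * (A + J) <= A + gamma * J.
  by rewrite mulrDr; apply: lerD; [rewrite ler_piMl|exact: ler_wpM2r].
rewrite mulrAC ler_pdivrMr; last by rewrite ltr_wpDr.
apply: (@le_trans _ _ (m * (2 * cj ^+ 2 * (A + J)))); first exact: ler_wpM2l.
have B0 : 0 <= A + gamma * J by rewrite addr_ge0// mulr_ge0.
rewrite mulrCA (mulrDr (A + gamma * J)) mulr1 (mulrC (A + gamma * J)).
by apply: ler_wpDl => //; exact: ler_wpM2l.
Qed.

End norms.

(** * The right inverse of the divergence *)

Section lift.
Context (R : realType) (n k : nat).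
Variables (B s K D : R).
Hypotheses (B0 : 0 <= B) (s0 : 0 <= s) (K0 : 0 <= K).

(** The bounds on the active elements through which mesh and domain enter the constants of
    [div_lift]. *)
Definition regular_on (Th : mesh R n.+1) (Om : set 'rV[R]_n.+1) : Prop :=
  [/\ forall T l, T \in active Th Om -> l \in T -> `|vert l ord0 ord0| <= B,
      forall T l, T \in active Th Om -> l \in T -> `|lamg T l ord0 ord0| * hT T <= s,
      forall T T', T \in active Th Om -> T' \in active Th Om -> hT T <= K * hT T' &
      forall T, T \in active Th Om -> hT T <= D].

Lemma transport_estimates : exists CE CN : R, [/\ 0 <= CE, 0 <= CN &
  forall (Th : mesh R n.+1) (Om : set 'rV[R]_n.+1),
  (forall T, T \in elts Th -> Defs.nondegenerate T) ->
  (forall T T', T \in elts Th -> T' \in elts Th -> conforming T T') ->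
  regular_on Th Om -> forall phi, Qh k Th Om phi ->
  ipQ Om phi phi <= CE * bh Om (transport Om B phi) phi /\
  vipS Om (OmT Th Om) (transport Om B phi) (transport Om B phi) <= CN * ipQ Om phi phi].
Proof.
have [CP CP0 HP] := @cell_poincare R n k; have [CI CI0 HI] := @cell_inverse R n k.
pose C1 := 2 * n.+2%:R * (4 * B ^+ 2 * s ^+ 2 * (1 + K)) * (2 * n.+2%:R).
have C10 : 0 <= C1.
  have h : 0 <= 4 * B ^+ 2 * s ^+ 2 * (1 + K).
    by rewrite mulr_ge0 ?addr_ge0// mulr_ge0 ?sqr_ge0// mulr_ge0// sqr_ge0.
  by rewrite /C1; move: (4 * _ * _ * _) h => X h; rewrite !mulr_ge0.
have C20 : 0 <= 2 * D ^+ 2 by rewrite mulr_ge0 ?sqr_ge0.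
(* The factor 2 makes up for the factor 1/2 in front of the means in [transport_energy]; [CI] bounds
   the spread in the norm of the field by the L2 norm. *)
exists (2 * CP), (C1 + 2 * D ^+ 2 * CI); split.
- exact: mulr_ge0.
- by rewrite addr_ge0// mulr_ge0.
move=> Th Om nd conf [vB gs hK hD] phi Vphi.
have pT T : T \in active Th Om -> deg_le k (phi T) by have [+ _] := Vphi T; exact.
have E := transport_energy Om nd conf B phi.
have N := transport_bound nd conf B0 s0 K0 vB gs hK hD phi.
rewrite /ipQ /vipS ip_evalE//.
have H1 : \sum_(T in active Th Om) \int[vol R n.+1]_(x in hull T) (peval (phi T) x * peval (phi T) x) <=
    CP * (\sum_(T in active Th Om) \int[vol R n.+1]_(x in hull T) cell_spread T (phi T) x +
          \sum_(T in active Th Om) cellvol T * means phi T ^+ 2).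
  rewrite -big_split mulr_sumr; apply: ler_sum => T aT.
  by apply: HP; [exact: (active_nd nd aT)|exact: pT].
have H2 : \sum_(T in active Th Om) \int[vol R n.+1]_(x in hull T) cell_spread T (phi T) x <=
    CI * \sum_(T in active Th Om) \int[vol R n.+1]_(x in hull T) (peval (phi T) x * peval (phi T) x).
  rewrite mulr_sumr; apply: ler_sum => T aT.
  by apply: HI; [exact: (active_nd nd aT)|exact: pT].
have H3 : \sum_(T in active Th Om) cellvol T * means phi T ^+ 2 <=
    \sum_(T in active Th Om) \int[vol R n.+1]_(x in hull T) (peval (phi T) x * peval (phi T) x).
  by apply: ler_sum => T aT; apply: cell_mean_le; exact: (active_nd nd aT).
have H4 : 0 <= \sum_(T in active Th Om) \int[vol R n.+1]_(x in hull T) cell_spread T (phi T) x.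
  apply: sumr_ge0 => T aT; apply: Rintegral_ge0 => x hx.
  by apply: cell_spread_ge0 => //; exact: (active_nd nd aT).
move: N E H1 H2 H3 H4; rewrite -/C1.
move: (\sum_(T in active Th Om) cellvol T * means phi T ^+ 2)
  (\sum_(T in active Th Om) \int[vol R n.+1]_(x in hull T) cell_spread T (phi T) x)
  (\sum_(T in active Th Om) \int[vol R n.+1]_(x in hull T) (peval (phi T) x * peval (phi T) x))
  (bh Om (transport Om B phi) phi) (vip _ _ _) => S V Q b N0 N1 E H1 H2 H3 H4.
split.
  rewrite -mulrA (mulrCA 2); apply: (le_trans H1); apply: ler_wpM2l => //; lra.
apply: (le_trans N1); rewrite (mulrDl C1); apply: lerD; first exact: ler_wpM2l.
by rewrite -(mulrA (2 * D ^+ 2)); exact: ler_wpM2l.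
Qed.

Lemma div_lift : exists2 C0 : R, 0 < C0 &
  forall (Th : mesh R n.+1) (Om : set 'rV[R]_n.+1) (gamma : R),
  (forall T, T \in elts Th -> Defs.nondegenerate T) ->
  (forall T T', T \in elts Th -> T' \in elts Th -> conforming T T') ->
  open Om -> regular_on Th Om -> forall q, Qh k Th Om q ->
  exists u, [/\ Sigmah k Th Om u, forall r, Qh k Th Om r -> bh Om u r = ipQ Om q r &
    nrmS Om gamma u <= C0 * nrmQ Om q].
Proof.
have [CE [CN [CE0 CN0 est]]] := transport_estimates.
have CC0 : 0 <= CN * CE ^+ 2 by rewrite mulr_ge0 ?sqr_ge0.
exists (Num.sqrt (CN * CE ^+ 2 + 1)); first by rewrite sqrtr_gt0 ltr_wpDl.
move=> Th Om gamma nd conf oOm reg q Vq.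
have VV := lspace_Qh k Th Om; have SV := spanned_Qh k Th Om.
have PQ := psdform_ipQ Om nd conf (Qh k Th Om); have [Q1 Q2 Q3] := PQ.
pose Kb (phi psi : bscal Th) : R := bh Om (transport Om B phi) psi.
have Kl psi : Qh k Th Om psi -> linear_on (Qh k Th Om) (fun phi => Kb phi psi).
  move=> Vpsi c p p' Vp Vp'; rewrite /Kb transport_linear//.
  exact: (@bh_linearl _ _ _ _ nd conf psi setT).
have Kr phi : Qh k Th Om phi -> linear_on (Qh k Th Om) (Kb phi).
  by move=> _; exact: bh_linearr.
(* If psi is annihilated by every div A p, the choice p = psi and coercivity give psi = 0. *)
have comp psi : Qh k Th Om psi -> (forall p, Qh k Th Om p -> Kb p psi = 0) -> ipQ Om q psi = 0.
  move=> Vpsi H; have [E _] := est _ _ nd conf reg _ Vpsi.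
  have z : ipQ Om psi psi = 0.
    by apply/eqP; rewrite eq_le Q3// andbT; apply: (le_trans E); rewrite [bh _ _ _]H// mulr0.
  by rewrite Q2//; exact: (psdform0 VV PQ Vpsi Vq z).
have [phi Vphi Hphi] := linear_system_solvable VV SV Kl Kr (Q1 _ Vq) comp.
have [E N] := est _ _ nd conf reg _ Vphi.
pose u := transport Om B phi.
have Su : Sigmah k Th Om u by apply: transport_Sigmah.
exists u; split => //.
have Vd := bdiv_Qh Su.
have CS1 := psdform_CauchySchwarz_sqr VV PQ Vq Vphi.
have CS2 := psdform_CauchySchwarz_sqr VV PQ Vq Vd.
(* The divergence of [u] is itself a test function, so its squared norm equals its product with
   [q]. *)
have d1 : ipQ Om (bdiv u) (bdiv u) <= ipQ Om q q.
  have X : ipQ Om (bdiv u) (bdiv u) = ipQ Om q (bdiv u) by rewrite -(Hphi _ Vd).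
  move: CS2 (Q3 _ Vd) (Q3 _ Vq); rewrite -X.
  move: (ipQ Om (bdiv u) (bdiv u)) (ipQ Om q q) => a b ab a0 b0.
  have [->//|an] := eqVneq a 0.
  by move: ab; rewrite expr2 ler_pM2r// lt_neqAle eq_sym an.
have p1 : ipQ Om phi phi <= CE ^+ 2 * ipQ Om q q.
  have Hpp : bh Om (transport Om B phi) phi = ipQ Om q phi := Hphi _ Vphi.
  move: CS1 (Q3 _ Vphi) (Q3 _ Vq) E; rewrite Hpp.
  move: (ipQ Om phi phi) (ipQ Om q phi) (ipQ Om q q) => a c b cab a0 b0 aE.
  have [->|an] := eqVneq a 0; first by rewrite mulr_ge0 ?sqr_ge0.
  have a1 : 0 < a by rewrite lt_neqAle eq_sym an.
  rewrite -(ler_pM2r a1) -mulrA -expr2; apply: (@le_trans _ _ ((CE * c) ^+ 2)).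
    rewrite ler_sqr ?nnegrE//; exact: le_trans aE.
  by rewrite exprMn; apply: ler_wpM2l => //; exact: sqr_ge0.
rewrite (nrmSE nd conf oOm) nrmQE -sqrtrM ?addr_ge0//; apply: ler_wsqrtr.
rewrite mulrDl mul1r; apply: lerD => //.
apply: (le_trans (vipS_dom_le nd conf oOm _ _)); apply: (le_trans N).
by rewrite -mulrA; exact: ler_wpM2l.
Qed.

End lift.

(** * Hausdorff measure of a Lipschitz boundary *)

Section metric_outer_measure.
Context (R : realType) (d s : nat).
Local Open Scope ereal_scope.
Implicit Types (A B X : set 'rV[R]_d).
Local Notation H := (hausdorff_outer R d s).

Lemma coord_le_enorm (x : 'rV[R]_d) i : (`|x ord0 i| <= enorm x)%R.
Proof.
rewrite /enorm -sqrtr_sqr; apply: ler_wsqrtr.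
by rewrite /dotr (bigD1 i)//= -expr2 lerDl; apply: sumr_ge0 => j _; rewrite -expr2 sqr_ge0.
Qed.

(** A covering set of diameter less than e meets at most one of [A] and [B], so the cover splits
    into two. *)
Lemma hpre_separated delta e A B : (delta < e)%R ->
  (forall x y, A x -> B y -> (e <= enorm (x - y))%R) ->
  hpre s delta A + hpre s delta B <= hpre s delta (A `|` B).
Proof.
move=> de AB; apply: le_ereal_inf_tmp => _ [F [cF dF] <-].
pose part C i := if `[< F i `&` C !=set0 >] then F i else set0.
have partP C : C `<=` A `|` B -> hpre s delta C <= \sum_(i <oo) hgauge s (part C i).
  move=> CAB; apply: ereal_inf_lbound; exists (part C) => //; split.
    move=> x Cx; have [i _ Fx] := cF _ (CAB _ Cx); exists i => //.
    by rewrite /part; case: asboolP => // -[]; exists x.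
  move=> i; rewrite /part; case: asboolP => _; first exact: dF.
  apply: le_trans (dF i); rewrite ediam0; exact: ediam_ge0.
apply: (le_trans (leeD (partP A (@subsetUl _ _ _)) (partP B (@subsetUr _ _ _)))).
rewrite -nneseriesD; [|by move=> *; exact: hgauge_ge0|by move=> *; exact: hgauge_ge0].
apply: lee_nneseries => [i _ _|i _]; first by apply: adde_ge0; exact: hgauge_ge0.
rewrite /part; case: asboolP => [[x [Fx Ax]]|_]; case: asboolP => [[y [Fy By]]|_];
  rewrite ?hgauge0 ?adde0 ?add0e ?hgauge_ge0//.
exfalso; have := AB _ _ Ax By; apply/negP; rewrite -ltNge; apply: le_lt_trans de.
rewrite -lee_fin; apply: le_trans (dF i); apply: ereal_sup_ubound; right.
by exists x, y.
Qed.

Lemma ge_hpre A (a b : R) : (a <= b)%R -> hpre s b A <= hpre s a A.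
Proof.
move=> ab; apply: ereal_inf_le_tmp => _ [F [AF dF] <-]; exists F => //; split => // i.
by apply: (le_trans (dF i)); rewrite lee_fin.
Qed.

Lemma hausdorff_separated e A B : (0 < e)%R ->
  (forall x y, A x -> B y -> (e <= enorm (x - y))%R) -> H A + H B <= H (A `|` B).
Proof.
move=> e0 AB; have [->|Xoo] := eqVneq (H (A `|` B)) +oo; first exact: leey.
have hH C delta : (0 < delta)%R -> hpre s delta C <= H C.
  by move=> d0; apply: ereal_sup_ubound; exists delta.
have fin C : C `<=` A `|` B -> H C \is a fin_num.
  move=> CAB; rewrite ge0_fin_numE ?outer_measure_ge0//.
  by apply: (le_lt_trans (le_outer_measure H _ _ CAB)); rewrite ltey.
(* The pre-measures increase as delta decreases; a common delta below e / 2 serves both, and the two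
   suprema can then be taken separately. *)
have key d1 d2 : (0 < d1)%R -> (0 < d2)%R -> hpre s d1 A + hpre s d2 B <= H (A `|` B).
  move=> d10 d20; pose dl := Num.min (Num.min d1 d2) (e / 2)%R.
  have dl0 : (0 < dl)%R by rewrite !lt_min d10 d20 divr_gt0.
  apply: (@le_trans _ _ (hpre s dl A + hpre s dl B)).
    by apply: leeD; apply: ge_hpre; rewrite !ge_min lexx ?orbT.
  apply: le_trans (hH _ _ dl0); apply: hpre_separated AB.
  apply: (@le_lt_trans _ _ (e / 2)%R); first by rewrite ge_min lexx orbT.
  by rewrite ltr_pdivrMr// ltr_pMr// ltr1n.
have finA := fin _ (@subsetUl _ A B); have finB := fin _ (@subsetUr _ A B).
have finh C delta : (0 < delta)%R -> H C \is a fin_num -> hpre s delta C \is a fin_num.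
  move=> d0; rewrite !ge0_fin_numE ?outer_measure_ge0 ?hpre_ge0//.
  by apply: le_lt_trans; exact: hH.
rewrite -leeBrDr//; apply: ge_ereal_sup => _ [d1 /= d10 <-].
rewrite leeBrDr// addeC -leeBrDr; last exact: finh.
apply: ge_ereal_sup => _ [d2 /= d20 <-].
by rewrite leeBrDr; [rewrite addeC; exact: key|exact: finh].
Qed.

(** Caratheodory's criterion for metric outer measures: the half-space is exhausted by the sets x_i
    <= c - 1 / (j + 1), which keep a distance from its complement, and the layers between them have
    summable measure. *)
Lemma halfspace_caratheodory (i : 'I_d) (c : R) :
  H.-caratheodory [set x : 'rV[R]_d | (x ord0 i < c)%R].
Proof.
set E := [set x | _]; apply: le_caratheodory_measurable => X.
have [->|Xoo] := eqVneq (H X) +oo; first exact: leey.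
pose t (j : nat) : R := (c - j.+1%:R^-1)%R.
pose A j := X `&` [set x | (x ord0 i <= t j)%R].
pose S j := X `&` [set x | (t j.+1 < x ord0 i <= t j.+2)%R].
have tlt j : (t j < t j.+1)%R.
  by rewrite ltrD2l ltrN2 ltf_pV2 ?posrE// ltr_nat.
have XfinH C : C `<=` X -> H C <= H X by move=> CX; exact: le_outer_measure.
have sep (C1 C2 : set 'rV[R]_d) (a b : R) : (a < b)%R -> (forall x, C1 x -> (x ord0 i <= a)%R) ->
    (forall x, C2 x -> (b <= x ord0 i)%R) -> H C1 + H C2 <= H (C1 `|` C2).
  move=> ab h1 h2; apply: (@hausdorff_separated (b - a)%R); first by rewrite subr_gt0.
  move=> x y /h1 xa /h2 yb; apply: le_trans (coord_le_enorm (x - y) i).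
  rewrite !mxE distrC; apply: le_trans (ler_norm _); lra.
have H1 j : H (A j) + H (X `&` ~` E) <= H X.
  have tc : (t j < c)%R by rewrite ltrBlDr ltrDl invr_gt0.
  apply: (le_trans (@sep _ _ (t j) c tc _ _)).
  - by move=> x [_].
  - by move=> x [_ /= /negP]; rewrite -leNgt.
  - by apply: XfinH => x [[]|[]].
have H2 j : H (A j) + H (S j) <= H (A j.+2).
  apply: (le_trans (@sep _ _ (t j) (t j.+1) (tlt j) _ _)).
  - by move=> x [_].
  - by move=> x [_ /= /andP[/ltW]].
  apply: le_outer_measure => x [[Xx xt]|[Xx /andP[_ xt]]]; split => //=.
  by apply: (le_trans xt); apply/ltW/(lt_trans (tlt j)); exact: tlt.
have partial_sums N : \sum_(0 <= j < N) H (S j) <= H (A N.+1) + H (A N).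
  elim: N => [|N IH]; first by rewrite big_geq// adde_ge0// outer_measure_ge0.
  rewrite big_nat_recr//=; apply: (le_trans (leeD2r _ IH)); rewrite -addeA addeC.
  by apply: leeD2r; exact: H2.
have Sge0 j : 0 <= H (S j) by exact: outer_measure_ge0.
have fin_sum : \sum_(0 <= j <oo) H (S j) < +oo.
  apply: (@le_lt_trans _ _ (H X + H X)); last by rewrite lte_add_pinfty// ltey.
  apply: lime_le; first exact: is_cvg_nneseries.
  by apply: nearW => N; apply: (le_trans (partial_sums N)); apply: leeD; apply: XfinH => x [].
have tail := nneseries_tail_cvg fin_sum (fun k _ => Sge0 k).
have XE N : H (X `&` E) <= H (A N.+1) + \sum_(N <= j <oo) H (S j).
  apply: (@le_trans _ _ (H (A N.+1 `|` \bigcup_(j in ~` `I_N) S j))); last first.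
    apply: (le_trans (outer_measureU2 _ _ _)); apply: leeD2l.
    exact: outer_measure_sigma_subadditive_tail.
  apply: le_outer_measure => x [Xx xc].
  have ex : exists j, (x ord0 i <= t j)%R.
    have h : (0 < c - x ord0 i)%R by rewrite subr_gt0.
    exists (Num.truncn (c - x ord0 i)^-1).
    have := truncnS_gt (c - x ord0 i)^-1; rewrite /t lerBrDr => lt1.
    rewrite -lerBrDl -[leRHS]invrK lef_pV2 ?posrE ?invr_gt0//.
    exact: ltW.
  (* For the least such j, a point is already in [A N.+1] or lies in the layer [S] of index j -
     2. *)
  have [j xj minj] := ex_minnP ex.
  have [jN|jN] := leqP j N.+1.
    left; split => //=; apply: (le_trans xj); rewrite lerD2l lerN2 lef_pV2 ?posrE// ler_nat.
    by rewrite ltnS.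
  right; case: j xj minj jN => [|[|j]] // xj minj jN; exists j => /=.
    by apply/negP; rewrite -leqNgt; move: jN; rewrite !ltnS.
  split => //=; rewrite xj andbT ltNge; apply/negP => /minj.
  by rewrite ltnn.
have lim : (H X + \sum_(N <= j <oo) H (S j)) @[N --> \oo] --> H X + 0.
  apply: cvgeD => //; last exact: cvg_cst.
  by rewrite fin_num_adde_defl.
rewrite -[leRHS]adde0 -(cvg_lim _ lim)//; apply: lime_ge; first by apply/cvg_ex; exists (H X + 0).
apply: nearW => N; apply: (le_trans (leeD2r _ (XE N))).
rewrite addeAC; apply: leeD2r; exact: H1.
Qed.

Lemma measurable_id_caratheodory :
  measurable_fun [set: caratheodory_type H] (id : caratheodory_type H -> 'rV[R]_d).
Proof.
apply: measurable_fun_rVP => i.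
apply: (measurability _ (@RGenInftyO.measurableE R)) => _ [_ [c ->] <-].
rewrite setTI; have := halfspace_caratheodory i c; congr (caratheodory_measurable _ _).
Qed.

Lemma borel_caratheodory A : measurable A -> measurable (A : set (caratheodory_type H)).
Proof. by move=> mA; rewrite -[A]setTI; exact: measurable_id_caratheodory. Qed.

End metric_outer_measure.

(** * Finiteness of the surface measure of a Lipschitz boundary *)

Section hausdorff_finite.
Context (R : realType).

Lemma continuous_dotr_self (d e : nat) (u : 'rV[R]_e -> 'rV[R]_d) :
  (forall i, continuous (fun z => u z ord0 i)) -> continuous (fun z => dotr (u z) (u z)).
Proof. by move=> cu; apply: continuous_big_sum => i _; apply: continuous_mul; exact: cu. Qed.

Definition unit_ball_vol n : \bar R := vol R n [set y : 'rV[R]_n | enorm y <= 1].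

Lemma unit_ball_vol_fin n : unit_ball_vol n \is a fin_num.
Proof.
rewrite ge0_fin_numE ?measure_ge0//; apply: vol_bounded.
  rewrite (_ : [set y | _] = [set y : 'rV[R]_n | dotr y y <= 1]); last first.
    by apply/seteqP; split => y /=; rewrite -enorm_sqr expr_le1 ?sqrtr_ge0.
  apply: closed_measurable_rV; apply: (@closed_comp _ _ (fun y : 'rV[R]_n => dotr y y) [set t | t <= 1]).
    by move=> y _; apply: continuous_dotr_self => i; exact: coord_continuous.
  exact: closed_le.
apply: (sub_bounded (B := cube n 1)); last exact: bounded_cube.
by move=> y y1 i; apply: le_trans (coord_le_enorm y i) y1.
Qed.

Lemma hgauge_le n d (A : set 'rV[R]_d) r : 0 <= r -> (ediam A <= r%:E)%E ->
  (hgauge n A <= (fine (unit_ball_vol n) * (r / 2) ^+ n)%:E)%E.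
Proof.
move=> r0 Ar; have W0 : 0 <= fine (unit_ball_vol n) by apply: fine_ge0; exact: measure_ge0.
have efin : ediam A \is a fin_num.
  by rewrite ge0_fin_numE ?ediam_ge0//; exact: le_lt_trans Ar (ltry _).
rewrite /hgauge; case: ifP => _; first by rewrite lee_fin mulr_ge0// exprn_ge0// divr_ge0.
rewrite -/(unit_ball_vol n) -(fineK (unit_ball_vol_fin n)) -(fineK efin) -EFinM -EFin_expe -EFinM.
rewrite lee_fin ler_wpM2l// lerXn2r ?nnegrE ?divr_ge0//; first by rewrite fine_ge0// ediam_ge0.
by rewrite ler_pM2r// -lee_fin fineK.
Qed.

(** [G] maps [A] injectively into a cube of R^n with Lipschitz inverse. Cutting the cube into N^n
    cubes of edge h, with N h = 2 M', gives pieces of diameter at most K h, of total gauge bounded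
    independently of N. *)
Lemma hausdorff_lipschitz_image n d (A : set 'rV[R]_d) (G : 'rV[R]_d -> 'rV[R]_n) M K :
  0 <= K -> (forall x, A x -> cube n M (G x)) ->
  (forall C x y, 0 <= C -> A x -> A y -> (forall i, `|G x ord0 i - G y ord0 i| <= C) ->
     enorm (x - y) <= K * C) ->
  (hausdorff_outer R d n A < +oo)%E.
Proof.
move=> K0 AM AK; pose M' := `|M| + 1; have M'0 : 0 < M' by rewrite ltr_wpDl.
set W := fine (unit_ball_vol n).
apply: (@le_lt_trans _ _ (W * (K * M') ^+ n)%:E); last exact: ltry.
apply: ge_ereal_sup => _ [delta /= delta0 <-].
(* Large enough for K h <= delta. *)
pose N := (Num.truncn (2 * M' * K / delta)).+1.
have N0 : 0 < N%:R :> R by rewrite ltr0n.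
pose h := 2 * M' / N%:R; have h0 : 0 < h by rewrite divr_gt0// mulr_gt0.
have Kh : K * h <= delta.
  have := truncnS_gt (2 * M' * K / delta); rewrite -/N ltr_pdivrMr// => H.
  by rewrite /h mulrA ler_pdivrMr// [K * _]mulrC [leRHS]mulrC ltW.
pose idx (t : R) := Num.truncn ((t + M') / h).
have idxN x i : A x -> (idx (G x ord0 i) < N)%N.
  move=> /AM /(_ i) /ler_normlP[b1 b2]; have := ler_norm M => MM.
  rewrite /idx truncn_lt_nat.
    rewrite ltr_pdivrMr// /h mulrCA divff ?gt_eqF// mulr1 /M'; lra.
  by rewrite divr_ge0 ?ltW// /M'; lra.
have idx_dist a b : 0 <= a + M' -> 0 <= b + M' -> idx a = idx b -> `|a - b| <= h.
  have bracket t : 0 <= t + M' -> (idx t)%:R * h <= t + M' < (idx t)%:R * h + h.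
    move=> t0; have /andP[] := truncn_itv (divr_ge0 t0 (ltW h0)); rewrite -/(idx t) => p1 p2.
    have -> : (idx t)%:R * h + h = (idx t).+1%:R * h by rewrite -natr1 mulrDl mul1r.
    by rewrite -ler_pdivlMr// p1 -ltr_pdivrMr.
  move=> /bracket/andP[p1 p2] /bracket/andP[p3 p4] E; rewrite -E in p3 p4.
  by rewrite ler_norml; apply/andP; split; lra.
pose F := {ffun 'I_n -> 'I_N}; pose m := #|F|.
pose piece (f : F) := [set x | A x /\ forall i, idx (G x ord0 i) = f i].
have dpiece f : (ediam (piece f) <= (K * h)%:E)%E.
  apply: ge_ereal_sup => e [->|[x [y [[Ax fx] [Ay fy] ->]]]].
    by rewrite lee_fin mulr_ge0// ltW.
  rewrite lee_fin; apply: AK => //; first exact: ltW.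
  have pos z i : A z -> 0 <= G z ord0 i + M'.
    by move=> /AM /(_ i) /ler_normlP[b1 b2]; have := ler_norm M; rewrite /M' => MM; lra.
  by move=> i; apply: idx_dist; rewrite ?pos// fx fy.
(* The finite cover is padded with empty sets, whose gauge is zero. *)
pose B (j : nat) : set 'rV[R]_d :=
  if (insub j : option 'I_m) is Some o then piece (enum_val o) else set0.
have Bout j : (m <= j)%N -> B j = set0 by move=> mj; rewrite /B insubN// -leqNgt.
have dB j : (ediam (B j) <= (K * h)%:E)%E.
  rewrite /B; case: insub => [p|]; first exact: dpiece.
  by rewrite ediam0 lee_fin mulr_ge0// ltW.
apply: (@le_trans _ _ (\sum_(j <oo) hgauge n (B j))%E).
  apply: ereal_inf_lbound; exists B => //; split => [x Ax|j]; last first.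
    by apply: (le_trans (dB j)); rewrite lee_fin.
  pose f : F := [ffun i => Ordinal (idxN x i Ax)].
  exists (enum_rank f : nat) => //; rewrite /B (valK (enum_rank f : 'I_m)) enum_rankK.
  by split => // i; rewrite ffunE.
rewrite (nneseries_split 0 m); last by move=> *; exact: hgauge_ge0.
rewrite add0n [X in (_ + X)%E]eseries0 ?adde0; last by move=> j mj _; rewrite Bout// hgauge0.
apply: (@le_trans _ _ (\sum_(0 <= j < m) (W * (K * h / 2) ^+ n)%:E)%E).
  by apply: lee_sum => j _; apply: hgauge_le => //; rewrite mulr_ge0// ltW.
rewrite sumEFin lee_fin sumr_const_nat subn0 /m card_ffun !card_ord -[_ *+ _]mulr_natl.
rewrite natrX mulrCA -exprMn (_ : N%:R * (K * h / 2) = K * M')//.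
by rewrite /h; field; rewrite gt_eqF.
Qed.

End hausdorff_finite.

Section lipschitz_boundary.
Context (R : realType) (n : nat).
Implicit Types (x y z e : 'rV[R]_n.+1).

Lemma enorm_coord_le x c : 0 <= c -> (forall i, `|x ord0 i| <= c) -> enorm x <= cube_diam n c.
Proof.
move=> c0 xc; rewrite -[x]subr0; apply: enorm_cube => // i.
by rewrite mxE normr0.
Qed.

Definition orthoproj e y := y - dotr y e *: e.

Lemma orthoprojB e x y : orthoproj e x - orthoproj e y = orthoproj e (x - y).
Proof. by rewrite /orthoproj dotrBl scalerBl !opprB addrACA [in RHS]addrAC -!addrA; congr (_ + _); rewrite addrC -addrA. Qed.

Lemma dotr_unit_le e x c : enorm e = 1 -> (forall i, `|x ord0 i| <= c) -> `|dotr x e| <= n.+1%:R * c.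
Proof.
move=> e1 xc; apply: (le_trans (ler_norm_sum _ _ _)).
apply: (@le_trans _ _ (\sum_(i < n.+1) c)); last by rewrite sumr_const card_ord mulr_natl.
apply: ler_sum => i _; rewrite normrM -[leRHS]mulr1; apply: ler_pM => //.
by rewrite -e1; exact: coord_le_enorm.
Qed.

(* On a Lipschitz graph over the hyperplane orthogonal to [e], the coordinates *)
(* of the projection other than the [j]-th, with [e_j != 0], form a           *)
(* bi-Lipschitz chart.                                                        *)
Lemma hausdorff_graph_fin e L (psi : 'rV[R]_n.+1 -> R) (A : set 'rV[R]_n.+1) :
  enorm e = 1 -> (forall y z, `|psi y - psi z| <= L * enorm (y - z)) ->
  bounded_set A -> (forall y, A y -> psi (orthoproj e y) = dotr y e) ->
  (hausdorff_outer R n.+1 n A < +oo)%E.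
Proof.
move=> e1 Lpsi bA graph.
have ee : dotr e e = 1 by rewrite -enorm_sqr e1 expr1n.
have [j ej] : exists j, e ord0 j != 0.
  apply/existsP; apply: contraPT e1 => /existsPn H.
  rewrite /enorm /dotr big1 ?sqrtr0; first by move=> /eqP; rewrite eq_sym oner_eq0.
  by move=> i _; move: (H i); rewrite negbK => /eqP ->; rewrite mul0r.
have [M M0 AM] := bounded_sub_cube bA.
pose a := 1 + n%:R / `|e ord0 j|; have a0 : 0 <= a by rewrite addr_ge0// divr_ge0.
pose K1 := Num.sqrt n.+1%:R * (2 * a).
have eb i : `|e ord0 i| <= 1 by rewrite -e1; exact: coord_le_enorm.
have projK w C : 0 <= C -> (forall i, `|orthoproj e w ord0 (lift j i)| <= C) -> enorm (orthoproj e w) <= K1 * C.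
  move=> C0 H; set p := orthoproj e w in H *.
  have pe : dotr p e = 0 by rewrite /p /orthoproj dotrBl dotrZl ee mulr1 subrr.
  (* As [p] is orthogonal to [e] and [e_j] is nonzero, the omitted coordinate is recovered from the
     others. *)
  have pj : `|p ord0 j| <= n%:R / `|e ord0 j| * C.
    rewrite mulrAC ler_pdivlMr ?normr_gt0// -normrM.
    have -> : p ord0 j * e ord0 j = - \sum_(i < n) p ord0 (lift j i) * e ord0 (lift j i).
      move: pe; rewrite /dotr (bigD1_ord j)//= => /eqP; rewrite addr_eq0 => /eqP ->; by [].
    rewrite normrN; apply: (le_trans (ler_norm_sum _ _ _)).
    apply: (@le_trans _ _ (\sum_(i < n) C)); last by rewrite sumr_const card_ord mulr_natl.
    by apply: ler_sum => i _; rewrite normrM -[leRHS]mulr1; apply: ler_pM.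
  have -> : K1 * C = cube_diam n (a * C) by rewrite /K1 /cube_diam; ring.
  apply: enorm_coord_le; first exact: mulr_ge0.
  move=> i; case: (unliftP j i) => [i' ->|->].
    apply: (le_trans (H i')); rewrite /a mulrDl mul1r lerDl mulr_ge0// divr_ge0//.
  by apply: (le_trans pj); rewrite /a mulrDl lerDr mul1r.
pose K2 := Num.sqrt (2 * (1 + L ^+ 2)).
apply: (@hausdorff_lipschitz_image R n n.+1 A (fun y => \row_i orthoproj e y ord0 (lift j i))
   (M + n.+1%:R * M) (K2 * K1)).
- by rewrite !mulr_ge0 ?sqrtr_ge0.
- move=> y /AM yM i; rewrite !mxE; apply: (le_trans (ler_normB _ _)); apply: lerD; first exact: yM.
  rewrite normrM -[leRHS]mulr1; apply: ler_pM => //; exact: dotr_unit_le.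
move=> C x y C0 Ax Ay H; rewrite -mulrA.
have pC : enorm (orthoproj e (x - y)) <= K1 * C.
  by apply: projK => // i; have := H i; rewrite -orthoprojB !mxE.
apply: le_trans (ler_wpM2l (sqrtr_ge0 _) pC).
rewrite -sqrtrM ?mulr_ge0 ?addr_ge0 ?sqr_ge0//; apply: ler_wsqrtr.
set p := orthoproj e (x - y) in pC *.
have -> : x - y = p + dotr (x - y) e *: e by rewrite /p /orthoproj subrK.
apply: (le_trans (dotr_sqrD_le _ _)); rewrite dotrZl dotrZr ee mulr1 -expr2.
have : dotr (x - y) e ^+ 2 <= L ^+ 2 * dotr p p.
  rewrite dotrBl -!graph// -[leLHS]real_normK ?num_real// -enorm_sqr -exprMn.
  have := Lpsi (orthoproj e x) (orthoproj e y); rewrite orthoprojB -/p => h.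
  by rewrite ler_sqr ?nnegrE//; exact: le_trans h.
by nra.
Qed.

End lipschitz_boundary.

Section boundary_measure.
Context (R : realType) (n : nat).
Implicit Types (Om : set 'rV[R]_n.+1).

Lemma continuous_proj_dist (e a : 'rV[R]_n.+1) : continuous (fun z : 'rV[R]_n.+1 => enorm (orthoproj e z - a)).
Proof.
move=> z; apply: (@continuous_comp _ _ _ (fun z => dotr (orthoproj e z - a) (orthoproj e z - a)) (@Num.sqrt R)); last exact: sqrt_continuous.
apply: continuous_dotr_self => i.
under eq_fun do rewrite !mxE.
apply: continuous_add; last exact: continuous_const.
apply: continuous_add; first exact: coord_continuous.
under eq_fun do rewrite -mulNr mulrC -mulN1r.
apply: continuous_mul; first exact: continuous_const.
apply: continuous_mul; first exact: continuous_const.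
apply: continuous_big_sum => j _; apply: continuous_mul; first exact: coord_continuous.
exact: continuous_const.
Qed.

Lemma continuous_dotrl (e : 'rV[R]_n.+1) : continuous (fun z : 'rV[R]_n.+1 => dotr z e).
Proof.
apply: continuous_big_sum => j _; apply: continuous_mul; first exact: coord_continuous.
exact: continuous_const.
Qed.

(** The boundary is compact, and near each of its points it lies on the graph of the local Lipschitz
    function, so finitely many pieces of finite measure cover it. *)
Lemma hausdorff_bdry_fin Om : open Om -> bounded_set (bdry Om) -> lipschitz_bdry Om ->
  (hausdorff_outer R n.+1 n (bdry Om) < +oo)%E.
Proof.
move=> oOm bB lip; set H := hausdorff_outer R n.+1 n.
have cB : closed (bdry Om).
  by apply: closedI; [exact: closed_closure|apply: open_closedC; exact: open_interior].
have kB : compact (bdry Om) by exact: bounded_closed_compact.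
have loc x : exists V, bdry Om x -> [/\ open V, V x & (H (bdry Om `&` V) < +oo)%E].
  have [bx|nbx] := pselect (bdry Om x); last by exists set0.
  have [e [L [psi [e1 Lpsi Nx]]]] := lip x bx.
  pose V := interior [set y | Om y <-> psi (y - dotr y e *: e) < dotr y e].
  exists V => _; split; [exact: open_interior|exact: Nx|].
  apply: (hausdorff_graph_fin e1 Lpsi); first by apply: sub_bounded bB; exact: subIsetl.
  move=> y [[cy niy] Vy]; have := interior_subset Vy; rewrite /= -/(orthoproj e y) => Oy.
  apply/eqP; rewrite eq_le; apply/andP; split; last first.
    rewrite leNgt; apply/negP => /Oy Omy; apply: niy.
    by move: oOm; rewrite openE; exact.
  rewrite leNgt; apply/negP => lt.
  (* If the boundary point [y] were strictly below the graph, then [q < 0] near [y], and by the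
     Lipschitz bound all points nearby would be below the graph and outside [Om], against [y] being
     in its closure. *)
  pose q z := dotr z e + (`|L| * enorm (orthoproj e z - orthoproj e y) + - psi (orthoproj e y)).
  have cq : continuous q.
    apply: continuous_add; first exact: continuous_dotrl.
    apply: continuous_add; last exact: continuous_const.
    by apply: continuous_mul; [exact: continuous_const|exact: continuous_proj_dist].
  have q0 : q y < 0.
    rewrite /q subrr (_ : enorm 0 = 0); last by rewrite /enorm dotr0l sqrtr0.
    by rewrite mulr0 add0r subr_lt0.
  have N1 : \forall z \near y, q z < 0 by move: q0 => /lt_nbhsl; exact: cq.
  have N2 : \forall z \near y, V z by apply: open_nbhs_nbhs; split => //; exact: open_interior.
  have [z [Oz [qz Vz]]] := cy _ (filterI N1 N2).
  have := interior_subset Vz; rewrite /= -/(orthoproj e z) => -[/(_ Oz) + _].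
  have := Lpsi (orthoproj e z) (orthoproj e y); rewrite ler_norml => /andP[lo _].
  have : L * enorm (orthoproj e z - orthoproj e y) <= `|L| * enorm (orthoproj e z - orthoproj e y).
    by apply: ler_wpM2r; [exact: sqrtr_ge0|exact: ler_norm].
  move: qz; rewrite /q; lra.
have [V HV] := choice loc.
have cover : bdry Om `<=` cover (bdry Om) V.
  by move=> x bx; exists x => //; have [] := HV x bx.
move: kB; rewrite compact_cover => /(_ _ (bdry Om) V) [|//|D' D'B sub].
  by move=> x /HV[].
have fin (s : seq 'rV[R]_n.+1) : {in s, forall x, bdry Om x} ->
    (H (bdry Om `&` [set y | exists2 x, x \in s & V x y]) < +oo)%E.
  elim: s => [|x s IH] Hs.
    rewrite (_ : _ `&` _ = set0) ?outer_measure0//.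
    by apply/seteqP; split => y // [_ [x]].
  have IHs : (H (bdry Om `&` [set y | exists2 x, x \in s & V x y]) < +oo)%E.
    by apply: IH => y ys; apply: Hs; rewrite inE ys orbT.
  have [_ _ Hx] := HV x (Hs x (mem_head x s)).
  apply: (@le_lt_trans _ _ (H ((bdry Om `&` V x) `|` (bdry Om `&` [set y | exists2 x, x \in s & V x y])))).
    apply: le_outer_measure => y [By [z]]; rewrite inE => /orP[/eqP ->|zs] Vy; first by left.
    by right; split => //; exists z.
  by apply: (le_lt_trans (outer_measureU2 _ _ _)); exact: lte_add_pinfty.
apply: le_lt_trans (fin (finmap.enum_fset D') _); last first.
  by move=> x xD; have := D'B x xD; rewrite inE.
apply: le_outer_measure => y By; split => //.
by have [x xD Vy] := sub y By; exists x.
Qed.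

Lemma hausdorff_null_measurable d s (N : set 'rV[R]_d) : hausdorff_outer R d s N = 0%E ->
  measurable (N : set (caratheodory_type (hausdorff_outer R d s))).
Proof.
move=> N0; apply: le_caratheodory_measurable => X.
rewrite [X in (X + _)%E](_ : _ = 0%E) ?add0e.
  by apply: le_outer_measure; exact: subIsetl.
apply/eqP; rewrite eq_le outer_measure_ge0 andbT -N0.
by apply: le_outer_measure; exact: subIsetr.
Qed.

End boundary_measure.

(** * Linearity of the loads *)

Section loads.
Context (R : realType) (n k : nat) (Th : mesh R n.+1) (Om : set 'rV[R]_n.+1).
Hypothesis nd : forall T, T \in elts Th -> Defs.nondegenerate T.
Hypothesis conf : forall T T', T \in elts Th -> T' \in elts Th -> conforming T T'.

Lemma source_load_linear f (V : set (bscal Th)) : L2 (vol R n.+1) (OmT Th Om) f ->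
  linear_on V (source_load Om f).
Proof.
move=> Lf c q r _ _; have mO := measurable_OmT Om nd.
have fO := fin_mu_OmT mO (@subset_refl _ _).
have ig (p : bscal Th) : (vol R n.+1).-integrable (OmT Th Om) (EFin \o (fun x => Defs.eval Om p x * f x)).
  have cp T : T \in active Th Om -> continuous (peval (p T)) by move=> _; exact: continuous_peval.
  have [K _ HK] := piecewise_bounded cp.
  have mp : measurable_fun (OmT Th Om) (Defs.eval Om p).
    exact: measurable_funS measurableT (@subsetT _ _) (measurable_piecewise nd conf cp).
  exact: (L2_mul_integrable mO fO Lf mp measurable0 (measure0 _) (fun x _ _ => HK x)).
have ipE p : ip (OmT Th Om) f (Defs.eval Om p) =
    \int[vol R n.+1]_(x in OmT Th Om) (Defs.eval Om p x * f x).
  by apply: eq_Rintegral => x _; exact: mulrC.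
rewrite /source_load !ipE eval_linear.
have -> : \int[vol R n.+1]_(x in OmT Th Om) ((c * Defs.eval Om q x + Defs.eval Om r x) * f x) =
    \int[vol R n.+1]_(x in OmT Th Om) (c * (Defs.eval Om q x * f x) + Defs.eval Om r x * f x).
  by apply: eq_Rintegral => x _; rewrite mulrDl mulrA.
rewrite (RintegralD mO (integrable_mulr mO c (ig q)) (ig r)) (RintegralZl c mO (ig q)).
by rewrite opprD mulrN.
Qed.

(** Additivity of the integral requires integrable integrands: the discrete field is bounded, the
    normal is a unit vector off a null set, the boundary has finite measure and [pD] is square
    integrable. *)
Lemma bdry_load_linear nu pD (V : set (bvec Th)) :
  open Om -> bounded_set (bdry Om) -> lipschitz_bdry Om ->
  outward_unit_normal Om nu -> L2 (Hbdry R n.+1) (bdry Om) pD ->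
  linear_on V (bdry_load Om nu pD).
Proof.
move=> oOm bB lip [mnu N0] LpD c u v _ _.
pose X := caratheodory_type (hausdorff_outer R n.+1 n).
pose mu : {measure set X -> \bar R} := Hbdry R n.+1.
pose D : set X := bdry Om.
have mD : measurable D.
  apply: borel_caratheodory; apply: closed_measurable_rV.
  by apply: closedI; [exact: closed_closure|apply: open_closedC; exact: open_interior].
have Dfin : (mu D < +oo)%E by exact: hausdorff_bdry_fin.
pose N : set X := [set x | bdry Om x /\ ~ outward_normal_at Om (nu x) x].
have mN : measurable N by exact: hausdorff_null_measurable.
have ig (w : bvec Th) : mu.-integrable D (EFin \o (fun x : X => dotr (veval Om w x) (nu x) * pD x)).
  have cw i T : T \in active Th Om -> continuous (peval (w T i)) by move=> _; exact: continuous_peval.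
  have HK i : exists K, forall x, `|veval Om w x ord0 i| <= K.
    have [K _ HK] := piecewise_bounded (cw i); exists K => x; rewrite vevalE; exact: HK.
  have [K HK'] := choice HK.
  have mi i : measurable_fun D (fun x : X => veval Om w x ord0 i).
    have m1 : measurable_fun [set: X] (piecewise Om (fun T => peval (w T i)) \o (id : X -> 'rV[R]_n.+1)).
      exact: measurableT_comp (measurable_piecewise nd conf (cw i)) (@measurable_id_caratheodory R n.+1 n).
    have -> : (fun x : X => veval Om w x ord0 i) =
        piecewise Om (fun T => peval (w T i)) \o (id : X -> 'rV[R]_n.+1).
      by apply/funext => x; exact: vevalE.
    exact: measurable_funS measurableT (@subsetT _ D) m1.
  have mh : measurable_fun D (fun x : X => \sum_i (veval Om w x ord0 i * nu x ord0 i)).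
    by apply: measurable_sum => i; exact: measurable_funM (mi i) (mnu i).
  apply: (@L2_mul_integrable _ X _ mu D mD Dfin pD (fun x => dotr (veval Om w x) (nu x)) (\sum_i K i) N LpD mh mN N0).
  move=> x Dx Nx; have [e1 _] : outward_normal_at Om (nu x) x.
    by apply: contrapT => no; apply: Nx.
  apply: (le_trans (ler_norm_sum _ _ _)); apply: ler_sum => i _.
  rewrite normrM -[leRHS]mulr1; apply: ler_pM => //.
  by rewrite -e1; exact: coord_le_enorm.
have E (w : bvec Th) : bdry_load Om nu pD w = \int[mu]_(x in D) (dotr (veval Om w x) (nu x) * pD x) by [].
rewrite !E.
have -> : \int[mu]_(x in D) (dotr (veval Om (c *: u + v) x) (nu x) * pD x) =
    \int[mu]_(x in D) (c * (dotr (veval Om u x) (nu x) * pD x) + dotr (veval Om v x) (nu x) * pD x).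
  by apply: eq_Rintegral => x _; rewrite veval_linear dotrDl dotrZl mulrDl mulrA.
rewrite (RintegralD mD (integrable_mulr mD c (ig u)) (ig v)).
by rewrite (RintegralZl c mD (ig u)).
Qed.

End loads.

(** * Well-posedness *)

Section background.
Context (R : realType) (n : nat).

Lemma closed_cube M : closed (cube n.+1 M : set 'rV[R]_n.+1).
Proof. by apply: compact_closed; [exact: norm_hausdorff|exact: compact_cube]. Qed.

(** All elements lie in the closure of the background domain, so one cube bounds vertices and
    diameters; two diameters compare through the mesh size. *)
Lemma regular_on_mesh (Om bg : set 'rV[R]_n.+1) (sigma kappa M : R) (Th : mesh R n.+1) :
  0 <= M -> closure bg `<=` cube n.+1 M -> triangulates Th bg ->
  shape_regular Th sigma -> quasi_uniform Th kappa ->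
  regular_on M (`|sigma| / 2) `|kappa| (cube_diam n M) Th Om.
Proof.
move=> M0 bM [nd _ cov] sr qu.
have TM T : T \in active Th Om -> hull T `<=` cube n.+1 M.
  move=> aT x hx; apply: bM; rewrite cov; exists T => //.
  exact: active_elts aT.
split=> [T l aT lT|T l aT lT|T T' aT aT'|T aT].
- by apply: (TM T aT (vert l)); apply: hull_vert => //; exact: active_nd nd _ aT.
- by apply: lamg_bound sr => //; [exact: active_elts aT|exact: active_nd nd _ aT].
- apply: (@le_trans _ _ (mesh_size Th)).
    by rewrite /mesh_size; apply: le_bigmax_cond; exact: active_elts aT.
  apply: (le_trans (qu _ (active_elts aT'))); apply: ler_wpM2r; first exact: hT_ge0.
  exact: ler_norm.
- by apply: hT_le => //; exact: TM.
Qed.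

End background.

Theorem lemma4 (R : realType) (d k : nat) (hd : d = 2%N \/ d = 3%N)
  (Om bg : set 'rV[R]_d) (n : 'rV[R]_d -> 'rV[R]_d)
  (hOm : bounded_domain Om) (hlip : lipschitz_bdry Om)
  (hn : outward_unit_normal Om n)
  (hbg : bounded_domain bg) (hsub : closure Om `<=` bg)
  (gamma : R) (hgamma : 0 <= gamma)
  (sigma kappa cj : R) (Np Nf : nat) :
  exists c C : R, [/\ 0 < c, 0 < C &
    forall (Th : mesh R d) (Ch : {set {set cell Th}})
           (jF : cell Th -> bvec Th -> bvec Th -> R),
      triangulates Th bg -> shape_regular Th sigma -> quasi_uniform Th kappa ->
      patches Om Np Nf Ch -> ghost_penalty k Om Ch jF cj ->
      (c%:E <= inf_sup (Sigmah k Th Om) (Qh k Th Om)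
                 (nrmS Om gamma) (nrmQ Om) (bh Om))%E /\
      (forall pD f : 'rV[R]_d -> R,
         L2 (Hbdry R d) (bdry Om) pD -> L2 (vol R d) (OmT Th Om) f ->
         well_posed (Sigmah k Th Om) (Qh k Th Om)
           (nrmS Om gamma) (nrmQ Om) (ah Om Ch jF gamma) (bh Om)
           C (bdry_load Om n pD) (source_load Om f))].
Proof.
have [d' Ed] : exists d', d = d'.+1 by case: hd => ->; [exists 1%N|exists 2%N].
subst d; have [_ oOm _ _] := hOm; have [_ _ _ bbg] := hbg.
have bB : bounded_set (bdry Om) by apply: sub_bounded bbg => x [cx _]; exact: hsub.
(* [M] depends on the background domain only, so the constants are fixed before the mesh is
   introduced. *)
have [M M0 bM] := bounded_sub_cube bbg.
have cbM : closure bg `<=` cube d'.+1 M.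
  by rewrite (closure_id (cube d'.+1 M)).1; [exact: closure_subset|exact: closed_cube].
have s0 : 0 <= `|sigma| / 2 by rewrite divr_ge0.
have [C0 C00 lift] := div_lift d' k (cube_diam d' M) M0 s0 (normr_ge0 kappa).
pose alpha := coercivity gamma cj; have alpha0 : 0 < alpha by exact: coercivity_gt0.
pose Mb := 1 + gamma * cj ^+ 2.
have Mb0 : 0 <= Mb by rewrite addr_ge0// mulr_ge0// sqr_ge0.
pose K := alpha^-1 + (1 + Mb / alpha) * C0.
have K0 : 0 <= K.
  apply: addr_ge0; first by rewrite invr_ge0 ltW.
  apply: mulr_ge0; last exact: ltW.
  by rewrite addr_ge0// divr_ge0// ltW.
exists C0^-1, (1 + K + C0 * (1 + Mb * K)); split.
- by rewrite invr_gt0.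
- apply: ltr_wpDr; last exact: ltr_wpDr K0 ltr01.
  by apply: mulr_ge0; [exact: ltW|exact: addr_ge0 ler01 (mulr_ge0 Mb0 K0)].
move=> Th Ch jF tri sr qu _ gp; have [nd conf _] := tri.
have reg := regular_on_mesh Om M0 cbM tri sr qu.
have VV := lspace_Sigmah k Om nd conf; have VQ := lspace_Qh k Th Om.
have PS := psdform_nS nd conf oOm gamma (Sigmah k Th Om).
have PQ := psdform_ipQ Om nd conf (Qh k Th Om).
have defS := nS_eq0 nd conf oOm (gamma := gamma) (k := k).
have defQ := ipQ_eq0 nd conf oOm (k := k).
have NSE : nrmS Om gamma = (fun v : bvec Th => Num.sqrt (nS Om gamma v v)).
  by apply/funext => v; exact: nrmSE.
have NQE : nrmQ Om = (fun q : bscal Th => Num.sqrt (ipQ Om q q)) by [].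
have lf r : Qh k Th Om r -> exists u, [/\ Sigmah k Th Om u,
    forall q, Qh k Th Om q -> bh Om u q = ipQ Om r q &
    Num.sqrt (nS Om gamma u u) <= C0 * Num.sqrt (ipQ Om r r)].
  move=> Vr; have [u [Su bu nu]] := lift Th Om gamma nd conf oOm reg r Vr.
  by exists u; split => //; move: nu; rewrite NSE.
have bl q : Qh k Th Om q -> linear_on (Sigmah k Th Om) (fun u => bh Om u q).
  by move=> _; exact: bh_linearl.
have br u : Sigmah k Th Om u -> linear_on (Qh k Th Om) (bh Om u).
  by move=> _; exact: bh_linearr.
split.
  by rewrite NSE NQE; exact: (inf_sup_ge VV PS PQ defS defQ bl C00 lf).
move=> pD f LpD Lf; rewrite NSE NQE.
have ab u v : Sigmah k Th Om u -> Sigmah k Th Om v ->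
    `|ah Om Ch jF gamma u v| <= Mb * Num.sqrt (nS Om gamma u u) * Num.sqrt (nS Om gamma v v).
  by move=> Su Sv; have := ah_bounded nd conf oOm hgamma gp Su Sv; rewrite NSE.
have ac u : Sigmah k Th Om u -> (forall q, Qh k Th Om q -> bh Om u q = 0) ->
    alpha * Num.sqrt (nS Om gamma u u) ^+ 2 <= ah Om Ch jF gamma u u.
  by move=> Su bu; have := ah_coercive nd conf oOm hgamma gp Su bu; rewrite NSE.
apply: (saddle_well_posed VV VQ (spanned_Sigmah k Om nd conf) (spanned_Qh k Th Om) PS PQ defS defQ
  _ _ bl br C00 lf alpha0 Mb0 ab ac).
- by move=> v Sv; apply: ah_linearl gp _ Sv.
- by move=> u Su; apply: ah_linearr gp _ Su.
- exact: bdry_load_linear.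
- exact: source_load_linear.
Qed.
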